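(* Let $s\ge0$ and $t>s$ be integers, set $\delta=t-s$, and let $B_{z^t\overline{z}^s}$ be the H-Toeplitz operator on the Bergman space $L^2_a(\mathbb{D})$ with symbol $z^t\overline{z}^s$. (a) If $\delta>1$, then $B^*_{z^t\overline{z}^s}$ has a direct sum decomposition as the sum of an operator $M$ on $\mathbb{C}^{2\delta}$ that is neither hyponormal nor co-hyponormal, a normal operator on $\mathbb{C}$, and a direct sum of weighted shifts, each of which is at least $1$-hyponormal, and each of which is at least $k$-hyponormal for certain ranges in the parameter $s$, namely whenever $k\in\mathbb{N}$ satisfies $$s\ge\min\{2^{k-1}(2\delta+1),\ 2^{k-2}(2\delta-1)+2^{k-1}-1\}.$$ Thus neither $B^*_{z^t\overline{z}^s}$ nor $B_{z^t\overline{z}^s}$ is hyponormal; each is contractive. (b) If $\delta=1$, then there is the same form of decomposition (an operator $M$ on $\mathbb{C}^2$, a normal operator on $\mathbb{C}$, and a direct sum of weighted shifts each at least $1$-hyponormal, and each at least $k$-hyponormal under the same condition on $s$), the operator $M$ on $\mathbb{C}^2$ is normal, and $B^*_{z^t\overline{z}^s}$ is hyponormal; $B_{z^t\overline{z}^s}$ is not hyponormal, and each of $B^*_{z^t\overline{z}^s}$, $B_{z^t\overline{z}^s}$ is contractive.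
   Context: $\mathbb{N}=\{1,2,\dots\}$. $\mathbb{D}$ is the open unit disk and $L^2(\mathbb{D})$ has inner product $\langle f,g\rangle=\frac1\pi\int_{\mathbb{D}}f\overline{g}\,dA$, with $dA$ area measure. The Bergman space $L^2_a(\mathbb{D})$ is the closed subspace of analytic functions in $L^2(\mathbb{D})$, with orthonormal basis $e_n(z)=\sqrt{n+1}\,z^n$, $n\ge 0$; $P$ is the orthogonal projection of $L^2(\mathbb{D})$ onto $L^2_a(\mathbb{D})$. $L^2_{harm}(\mathbb{D})$ is the closed subspace of complex-valued harmonic functions in $L^2(\mathbb{D})$. The bounded linear operator $K:L^2_a(\mathbb{D})\to L^2_{harm}(\mathbb{D})$ is defined by $K(e_{2n})=e_n$ and $K(e_{2n+1})=\overline{e_{n+1}}$ for all $n\ge0$. For $\varphi\in L^\infty(\mathbb{D})$, the H-Toeplitz operator $B_\varphi:L^2_a(\mathbb{D})\to L^2_a(\mathbb{D})$ is $B_\varphi(f)=P(\varphi\cdot K(f))$, with Hilbert space adjoint $B_\varphi^*$. A (unilateral) weighted shift with bounded positive weight sequence $(\alpha_n)_{n\ge0}$ is an operator $W$ with $Wu_n=\alpha_n u_{n+1}$ for an orthonormal basis $(u_n)_{n\ge0}$ of its space; its moments are $\gamma_0=1$, $\gamma_n=\prod_{j=0}^{n-1}\alpha_j^2$. It is $k$-hyponormal if for each $n\ge0$ the $(k+1)\times(k+1)$ Hankel matrix $(\gamma_{n+i+j})_{0\le i,j\le k}$ is positive semidefinite ($1$-hyponormal is the same as hyponormal). An operator $T$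 is hyponormal if $T^*T-TT^*\ge0$, and co-hyponormal if $T^*$ is hyponormal. ''Contractive'' means operator norm at most $1$. Direct sums are orthogonal direct sums over reducing subspaces. *)

(* Defs.v *)
From HB Require Import structures.
From mathcomp Require Import all_boot all_order all_algebra.
From mathcomp Require Import complex.
From mathcomp Require Import all_classical all_reals all_analysis.

Set Implicit Arguments.
Unset Strict Implicit.
Unset Printing Implicit Defensive.

Import Order.TTheory GRing.Theory Num.Theory.
Import numFieldNormedType.Exports.

Local Open Scope classical_set_scope.
Local Open Scope ring_scope.
Local Open Scope complex_scope.

Section FunctionSpaces.
Variable R : realType.
Local Notation C := R[i].

Definition disk : set C := [set z | `|z| < 1].

(* A function on the disk is represented by its extension by 0 to C, so that
   Leibniz equality of such functions is equality on the disk. *)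
Definition on_disk (f : C -> C) : Prop := forall z, ~ disk z -> f z = 0.
Definition restrict_disk (f : C -> C) : C -> C :=
  fun z => if `|z| < 1 then f z else 0.

Definition cplx (p : R * R) : C := p.1 +i* p.2.
Definition disk2 : set (R * R) := cplx @^-1` disk.

Definition area := (@lebesgue_measure R \x @lebesgue_measure R)%E.

Definition disk_integral (f : C -> C) : C :=
  Rintegral area disk2 (fun p => complex.Re (f (cplx p)))
    +i* Rintegral area disk2 (fun p => complex.Im (f (cplx p))).

(* Elements of L^2(D) are represented by functions, not by a.e. classes. *)
Definition L2 : set (C -> C) := [set f |
  [/\ on_disk f,
      measurable_fun disk2 (fun p => complex.Re (f (cplx p))),
      measurable_fun disk2 (fun p => complex.Im (f (cplx p))) &
      area.-integrable disk2
        (fun p => (complex.Re (f (cplx p)) ^+ 2 + complex.Im (f (cplx p)) ^+ 2)%:E)]].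

Definition ip (f g : C -> C) : C :=
  (pi^-1)%:C * disk_integral (fun z => f z * (g z)^*).

Definition analytic_on_disk (f : C -> C) : Prop :=
  forall z0, disk z0 -> exists (r : R) (a : nat -> C), 0 < r /\
    forall z, `|z - z0| < r%:C ->
      series (fun n => a n * (z - z0) ^+ n : C^o) @ \oo --> (f z : C^o).

Definition C1_on (U : set (R * R)) (u : R * R -> R) : Prop :=
  forall p, U p ->
    [/\ {for p, continuous u},
        derivable u p (1, 0), derivable u p (0, 1),
        {for p, continuous ('D_((1, 0) : R * R) u)} &
        {for p, continuous ('D_((0, 1) : R * R) u)}].

Definition real_harmonic_on (U : set (R * R)) (u : R * R -> R) : Prop :=
  [/\ C1_on U u,
      C1_on U ('D_((1, 0) : R * R) u),
      C1_on U ('D_((0, 1) : R * R) u) &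
      forall p, U p ->
        'D_((1, 0) : R * R) ('D_((1, 0) : R * R) u) p
        + 'D_((0, 1) : R * R) ('D_((0, 1) : R * R) u) p = 0].

Definition harmonic_on_disk (f : C -> C) : Prop :=
  real_harmonic_on disk2 (fun p => complex.Re (f (cplx p)))
  /\ real_harmonic_on disk2 (fun p => complex.Im (f (cplx p))).

Definition bergman : set (C -> C) := L2 `&` [set f | analytic_on_disk f].
Definition L2harm : set (C -> C) := L2 `&` [set f | harmonic_on_disk f].

Definition e_ (n : nat) : C -> C :=
  restrict_disk (fun z => (Num.sqrt n.+1%:R)%:C * z ^+ n).

End FunctionSpaces.

Arguments bergman {R}.
Arguments L2harm {R}.
Arguments L2 {R}.

(* The Hilbert spaces are closed subspaces H of the Bergman space, given as
   sets; an operator is a function of which only the values on H matter. *)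

Section Operators.
Variable R : realType.
Local Notation C := R[i].
Local Notation V := (C -> C).

Definition nrm (f : V) : R := Num.sqrt (complex.Re (ip f f)).

Definition linear_on (H : set V) (T : V -> V) : Prop :=
  forall (a : C) f g, H f -> H g -> T (a *: f + g) = a *: T f + T g.

Definition bounded_operator (H H' : set V) (T : V -> V) : Prop :=
  [/\ forall f, H f -> H' (T f), linear_on H T &
      exists c : R, forall f, H f -> nrm (T f) <= c * nrm f].

Definition opnorm (H : set V) (T : V -> V) : \bar R :=
  ereal_sup [set (nrm (T f))%:E | f in H `&` [set f | nrm f <= 1]].

Definition contractive (H : set V) (T : V -> V) : Prop :=
  (opnorm H T <= 1%:E)%E.

Definition is_adjoint (H : set V) (T Ts : V -> V) : Prop :=
  (forall f, H f -> H (Ts f)) /\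
  (forall f g, H f -> H g -> ip (T f) g = ip f (Ts g)).

(* The adjoint of an operator on H is unique on H. In C, 0 <= z means that z
   is real and nonnegative. For a T-invariant subspace S of H, [hyponormal S T]
   is about the restriction of T to S, whose adjoint is taken in S. *)
Definition hyponormal (H : set V) (T : V -> V) : Prop :=
  exists Ts, is_adjoint H T Ts /\
    forall f, H f -> 0 <= ip (Ts (T f) - T (Ts f)) f.

Definition cohyponormal (H : set V) (T : V -> V) : Prop :=
  exists Ts, is_adjoint H T Ts /\ hyponormal H Ts.

Definition normal (H : set V) (T : V -> V) : Prop :=
  exists Ts, is_adjoint H T Ts /\
    forall f, H f -> Ts (T f) = T (Ts f).

Definition closed_subspace (H S : set V) : Prop :=
  [/\ S `<=` H, S 0,
      forall (a : C) f g, S f -> S g -> S (a *: f + g) &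
      forall f, H f ->
        (forall eps : R, 0 < eps -> exists2 g, S g & nrm (f - g) < eps) -> S f].

Definition orthocomplement (H S : set V) : set V :=
  [set f | H f /\ forall g, S g -> ip f g = 0].

Definition reducing (H : set V) (T : V -> V) (S : set V) : Prop :=
  [/\ closed_subspace H S, forall f, S f -> S (T f) &
      forall f, orthocomplement H S f -> orthocomplement H S (T f)].

Definition orthonormal_basis (I : eqType) (S : set V) (u : I -> V) : Prop :=
  [/\ forall i, S (u i),
      forall i j, ip (u i) (u j) = (i == j)%:R &
      forall f, S f -> forall eps : R, 0 < eps ->
        exists (r : seq I) (c : I -> C),
          nrm (f - \sum_(i <- r) c i *: u i) < eps].

Definition has_dim (n : nat) (S : set V) : Prop :=
  exists u : 'I_n -> V, orthonormal_basis S u.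

Definition orthogonal_direct_sum (J : Type) (H : set V) (S : J -> set V) :
    Prop :=
  [/\ forall j, closed_subspace H (S j),
      forall j k, j <> k ->
        forall f g, S j f -> S k g -> ip f g = 0 &
      forall f, H f -> forall eps : R, 0 < eps ->
        exists (r : seq J) (g : J -> V),
          (forall j, S j (g j)) /\ nrm (f - \sum_(j <- r) g j) < eps].

Definition weighted_shift (S : set V) (T : V -> V) (alpha : nat -> R) : Prop :=
  [/\ forall n, 0 < alpha n, exists c, forall n, alpha n <= c &
      exists u : nat -> V, orthonormal_basis S u /\
        forall n, T (u n) = (alpha n)%:C *: u n.+1].

Definition moment (alpha : nat -> R) (n : nat) : R :=
  \prod_(j < n) alpha j ^+ 2.

Definition psd (n : nat) (A : 'M[R]_n) : Prop :=
  A^T = A /\ forall x : 'cV[R]_n, 0 <= (x^T *m A *m x) 0 0.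

Definition k_hyponormal (k : nat) (alpha : nat -> R) : Prop :=
  forall n, psd (\matrix_(i < k.+1, j < k.+1) moment alpha (n + i + j)).

End Operators.

Section HToeplitz.
Variable R : realType.
Local Notation C := R[i].
Local Notation V := (C -> C).

Definition is_bergman_projection (P : V -> V) : Prop :=
  forall g, L2 g -> bergman (P g) /\
    forall h, bergman h -> ip (g - P g) h = 0.

(* These properties determine K on the Bergman space, where the span of the
   e_ n is dense. *)
Definition is_K_operator (K : V -> V) : Prop :=
  [/\ bounded_operator bergman L2harm K,
      forall n : nat, K (e_ (2 * n)%N) = e_ n &
      forall n : nat, K (e_ (2 * n + 1)%N) = fun z => (e_ n.+1 z)^*].

Definition HToeplitz (P K : V -> V) (phi : V) : V -> V :=
  fun f => P (fun z => phi z * K f z).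

Definition symbol (t s : nat) : V := fun z => z ^+ t * (z^*) ^+ s.

(* The powers have integer exponents: for k = 1 the second bound contains
   2^(-1), so the comparison takes place in R rather than in nat. *)
Definition k_range (delta s k : nat) : Prop :=
  Num.min (2 ^ (k%:Z - 1) * (2 * delta%:R + 1))
          (2 ^ (k%:Z - 2) * (2 * delta%:R - 1) + 2 ^ (k%:Z - 1) - 1)
    <= s%:R :> R.

(* An operator on C^d is rendered as the restriction of T to a subspace of
   dimension d, on which the inner product is that of C^d up to a unitary. *)
Definition shift_decomposition (H : set V) (T : V -> V) (d : nat)
    (propM : set V -> (V -> V) -> Prop) (delta s : nat) : Prop :=
  exists (HM HN : set V) (I : Type) (HW : I -> set V) (alpha : I -> nat -> R),
    let summand (j : bool + I) :=
      match j with
      | inl true => HM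
      | inl false => HN
      | inr i => HW i
      end in
    [/\ orthogonal_direct_sum H summand,
        forall j, reducing H T (summand j),
        has_dim d HM /\ propM HM T,
        has_dim 1 HN /\ normal HN T &
        forall i,
          [/\ weighted_shift (HW i) T (alpha i),
              k_hyponormal 1 (alpha i) &
              forall k : nat, (1 <= k)%N -> k_range delta s k ->
                k_hyponormal k (alpha i)]].

End HToeplitz.

(* Main.v *)
(* The adjoint B* acts on the basis by B* e_m = beta_m e_(sigma m), where sigma permutes
   {0, ..., 2 delta - 1}, fixes 2 delta and maps 2 delta + x to 2 delta + 2 x. The orbits of
   sigma therefore give reducing subspaces: a block of dimension 2 delta, a normal block of
   dimension 1, and for every odd j a weighted shift along the indices 2 delta + j 2^l.
   Hyponormality is decided by comparing the weights of consecutive basis vectors.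

   The moments of such a shift are a product of two sequences
   prod_l (1 + B q^l) / (1 + C q^l) with q = 1/2. Their Hankel matrices have an explicit
   L D L^T factorization whose r-th pivot has the sign of prod_(n < r) (C q^n - B), so the
   first bound on s makes both factors positive semidefinite and Schur's product theorem
   applies. Under the second bound at most the last pivot of one factor is negative, and it
   is dominated by the positive terms.

   The Bergman space is reduced to coefficients as follows: Green's formula gives
   the area moments of z^m f(z) conj(z)^n, hence the Taylor coefficients of f are its inner
   products with the e_n; the identity theorem makes them determine f, and Fatou's lemma
   gives Parseval's identity. *)
Require Import Defs.
From HB Require Import structures.
From mathcomp Require Import all_boot all_order all_algebra.
From mathcomp Require Import complex.
From mathcomp Require Import all_classical all_reals all_analysis.
From mathcomp Require Import measurable_realfun ring lra zify.

Set Implicit Arguments.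
Unset Strict Implicit.
Unset Printing Implicit Defensive.

Import Order.TTheory GRing.Theory Num.Theory.
Import numFieldNormedType.Exports.

Local Open Scope ring_scope.

(** * Hankel forms of the shift moments *)

(** The sequences [ratio B C] are the moments of little q-Jacobi polynomials with q = 1/2, which is
    where the explicit factorization comes from. A shift started at step n of the chain of j has,
    with h = 1/(j 2^n), the parameters A = (delta + 1) h, B = (2 delta + 1) h and C = (s + 2 delta +
    1) h, so that 2 A = B + h. For order k + 2 the second bound reads B + (B - h) y <= C y with y =
    2^-k. All pivots up to index k + 1 are then nonnegative, but the last one may be negative for B,
    and even for A as well, so Schur's theorem does not apply. What compensates is the column k + 1
    of the expansion along the factor A: there the form of the other factor is a 2 by 2 form whose
    Schur complement is explicit ([gain]). On the analytic side, analyticity gives at each point a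
    power series of unknown radius. Moments therefore cannot be found by integrating one series over
    the disk; they come from differentiability alone, after a Taylor polynomial has been split
    off. *)

Section Stieltjes.
Variables (R : realFieldType) (mu la : nat -> R).

(* If [mu] and [la] are the coefficients of the Jacobi matrix of a moment sequence,
   then [stieltjes] is the unit lower triangular factor L and [pivot] the diagonal of
   D in the factorization L D L^T of its Hankel matrix. *)
Fixpoint stieltjes (i r : nat) : R :=
  if i is i'.+1 then
    (if r is r'.+1 then stieltjes i' r' else 0) + mu r * stieltjes i' r
      + la r * stieltjes i' r.+1
  else (r == 0%N)%:R.

Definition pivot (r : nat) : R := \prod_(n < r) la n.

Lemma pivotS r : pivot r.+1 = pivot r * la r.
Proof. by rewrite /pivot big_ord_recr. Qed.

Lemma stieltjes_gt i r : (i < r)%N -> stieltjes i r = 0.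
Proof.
elim: i r => [|i IH] [|r] //= ir.
by rewrite !IH ?mulr0 ?addr0//; lia.
Qed.

Lemma stieltjes_diag i : stieltjes i i = 1.
Proof.
by elim: i => [|i IH]//=; rewrite IH !(@stieltjes_gt i) ?mulr0 ?addr0.
Qed.

Let S N i j := \sum_(r < N) pivot r * stieltjes i r * stieltjes j r.

(** The Jacobi matrix is self-adjoint for the bilinear form with weights [pivot], so a
    multiplication by the variable can be moved from one argument to the other. *)
Let S_shift N i j : (i.+1 < N)%N -> (j.+1 < N)%N -> S N i.+1 j = S N i j.+1.
Proof.
case: N => // N iN jN.
(* The recursion for row i' + 1 gives three sums. Exchanging i' and j' swaps the two outer ones and
   fixes the middle one. *)
have E i' j' : (i'.+1 < N.+1)%N -> (j'.+1 < N.+1)%N ->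
  S N.+1 i'.+1 j' =
    \sum_(r < N) pivot r.+1 * stieltjes i' r * stieltjes j' r.+1
    + \sum_(r < N.+1) pivot r * mu r * stieltjes i' r * stieltjes j' r
    + \sum_(r < N) pivot r.+1 * stieltjes i' r.+1 * stieltjes j' r.
  move=> i'N j'N; rewrite /S.
  transitivity
   (\sum_(r < N.+1)
     ((pivot r * (if val r is r'.+1 then stieltjes i' r' else 0) * stieltjes j' r
     + pivot r * mu r * stieltjes i' r * stieltjes j' r)
     + pivot r.+1 * stieltjes i' r.+1 * stieltjes j' r)).
    apply: eq_bigr => r _ /=.
    by rewrite pivotS; case: r => -[|r] rN /=; ring.
  rewrite !big_split /=; congr (_ + _ + _).
    by rewrite big_ord_recl /= mulr0 mul0r add0r.
  by rewrite [LHS]big_ord_recr /= (@stieltjes_gt i' N.+1) ?mulr0 ?mul0r ?addr0//; lia.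
rewrite E//.
have -> : S N.+1 i j.+1 = S N.+1 j.+1 i.
  by apply: eq_bigr => r _; ring.
rewrite E// addrAC [RHS]addrAC; congr (_ + _); last by apply: eq_bigr => r _; ring.
by rewrite addrC; congr (_ + _); apply: eq_bigr => r _; ring.
Qed.

(** [S_shift] moves the whole of j over to i; in row 0 only the term r = 0 is left. *)
Lemma stieltjes_hankel N i j : (i + j < N)%N ->
  \sum_(r < N) pivot r * stieltjes i r * stieltjes j r = stieltjes (i + j) 0.
Proof.
elim: j i => [|j IH] i ijN.
  case: N ijN => // N ijN; rewrite big_ord_recl /= /pivot big_ord0 mul1r mulr1 addn0.
  by rewrite big1 ?addr0// => r _; rewrite mulr0.
by rewrite -[LHS]/(S N i j.+1) -S_shift; [rewrite /S IH ?addSnnS//; lia|lia|lia].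
Qed.

Lemma stieltjes_form k (v : nat -> R) :
  \sum_(i < k.+1) \sum_(j < k.+1) v i * v j * stieltjes (i + j) 0
  = \sum_(r < k.+1) pivot r * (\sum_(i < k.+1) stieltjes i r * v i) ^+ 2.
Proof.
(* A common length for all sums i + j <= 2 k; the terms beyond k vanish since L is lower
   triangular. *)
pose N := (k + k).+1.
have kN : (k.+1 <= N)%N by rewrite /N; lia.
transitivity (\sum_(r < N) pivot r * (\sum_(i < k.+1) stieltjes i r * v i) ^+ 2).
  under eq_bigr => i _.
    under eq_bigr => j _.
      rewrite -(@stieltjes_hankel N); last by have := ltn_ord i; have := ltn_ord j; rewrite /N; lia.
      rewrite mulr_sumr; over.
    rewrite exchange_big /=; over.
  rewrite exchange_big /=; apply: eq_bigr => r _.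
  rewrite expr2 mulr_suml mulr_sumr; apply: eq_bigr => i _.
  rewrite mulr_sumr mulr_sumr; apply: eq_bigr => j _; ring.
rewrite [RHS](big_ord_widen N (fun r => pivot r * (\sum_(i < k.+1) stieltjes i r * v i) ^+ 2))//.
rewrite [RHS]big_mkcond /=; apply: eq_bigr => r _; case: ifPn => //; rewrite -leqNgt => kr.
by rewrite big1 ?expr0n ?mulr0// => i _; rewrite stieltjes_gt ?mul0r//; have := ltn_ord i; lia.
Qed.

End Stieltjes.

(** * Moments of little q-Jacobi type and their pivots *)

Section Ratio.
Variable R : realFieldType.
Implicit Types (A B C x y z : R) (n r m k : nat).

(* q-Pochhammer products with q = 1/2: [poch (-B)] is (B; q)_n, and [poch (-2^-1)] is (q; q)_n. *)
Definition poch B n : R := \prod_(l < n) (1 + B * 2^-1 ^+ l).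
Definition ratio B C n : R := \prod_(l < n) ((1 + B * 2^-1 ^+ l) / (1 + C * 2^-1 ^+ l)).

(** [rec_up] and [rec_down] are the recurrence coefficients A_n and C_n of the little q-Jacobi
    polynomials for q = 1/2, with a q = -B and a b q^2 = -C. Their moments (a q; q)_n / (a b q^2;
    q)_n are [ratio B C n]. The diagonal of the Jacobi matrix is A_n + C_n and the product of its
    off-diagonal entries is A_n C_(n+1). *)
Definition rec_up B C n : R := let y := 2^-1 ^+ n in
  y * (1 + B * y) * (1 + 2 * C * y) / ((1 + 2 * C * y ^+ 2) * (1 + C * y ^+ 2)).
Definition rec_down B C n : R := let y := 2^-1 ^+ n in
  2 * y * (1 - y) * (2 * C * y - B) / ((1 + 4 * C * y ^+ 2) * (1 + 2 * C * y ^+ 2)).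
Definition rec_mu B C n : R := rec_up B C n + rec_down B C n.
Definition rec_la B C n : R := rec_up B C n * rec_down B C n.+1.

Local Notation L B C := (stieltjes (rec_mu B C) (rec_la B C)).

(* The entry (r + m, r) of L for the moments [ratio B C]: a q-binomial coefficient
   times (-B q^r)_m / (-C q^(2r))_m. *)
Definition entry B C r m : R :=
  poch (-2^-1) (r + m) / (poch (-2^-1) r * poch (-2^-1) m)
  * (poch B (r + m) / poch B r) * (poch C (r + r) / poch C (r + r + m)).

Lemma pochS B n : poch B n.+1 = poch B n * (1 + B * 2^-1 ^+ n).
Proof. by rewrite /poch big_ord_recr. Qed.

Lemma poch0 B : poch B 0 = 1. Proof. exact: big_ord0. Qed.

Lemma half_exp_gt0 n : 0 < 2^-1 ^+ n :> R.
Proof. by rewrite exprn_gt0// invr_gt0. Qed.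

Lemma half_exp_le1 n : 2^-1 ^+ n <= 1 :> R.
Proof. by rewrite exprn_ile1//; lra. Qed.

Lemma poch_factor_gt0 B n : 0 <= B -> 0 < 1 + B * 2^-1 ^+ n.
Proof. by move=> B0; rewrite ltr_pwDl// mulr_ge0// ltW// half_exp_gt0. Qed.

Lemma pochq_factor_gt0 n : 0 < 1 + - 2^-1 * 2^-1 ^+ n :> R.
Proof. by have := half_exp_le1 n; have := half_exp_gt0 n; lra. Qed.

Lemma poch_gt0 B n : 0 <= B -> 0 < poch B n.
Proof. by move=> B0; apply: prodr_gt0 => l _; exact: poch_factor_gt0. Qed.

Lemma pochq_gt0 n : 0 < poch (- 2^-1 : R) n.
Proof. by apply: prodr_gt0 => l _; exact: pochq_factor_gt0. Qed.

Lemma entrySr B C r m : 0 <= B -> 0 <= C ->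
  let y := 2^-1 ^+ r in let z := 2^-1 ^+ m in
  entry B C r m.+1 = entry B C r m *
    ((1 - y * z / 2) / (1 - z / 2) * (1 + B * (y * z)) / (1 + C * (y ^+ 2 * z))).
Proof.
move=> B0 C0 y z; rewrite /entry !addnS !pochS !exprD -/y -/z.
have := pochq_factor_gt0 m; rewrite -/z => zg.
have := poch_factor_gt0 (r + r + m) C0; rewrite !exprD -/y -/z => yz.
have := pochq_gt0 m; have := pochq_gt0 r; have := poch_gt0 r B0.
have := poch_gt0 (r + r + m) C0.
move: (poch _ m) (poch _ r) (poch _ r) (poch _ (r + r + m)) => a b c d *.
by field; rewrite ?gt_eqF//=; lra.
Qed.

Lemma entrySl B C r m : 0 <= B -> 0 <= C ->
  let y := 2^-1 ^+ r in let z := 2^-1 ^+ m in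
  entry B C r.+1 m = entry B C r m.+1 *
    ((1 - z / 2) / (1 - y / 2) / (1 + B * y)
     * ((1 + C * y ^+ 2) * (1 + C * y ^+ 2 / 2)) / (1 + C * (y ^+ 2 * z) / 2)).
Proof.
move=> B0 C0 y z; rewrite /entry !(addnS, addSn) !pochS !exprS !exprD -/y -/z.
have := pochq_factor_gt0 m; rewrite -/z => zg.
have := pochq_factor_gt0 r; rewrite -/y => yg.
have := poch_factor_gt0 r B0; rewrite -/y => By.
have := poch_factor_gt0 (r + r + m) C0; rewrite !exprD -/y -/z => yz.
have := poch_factor_gt0 (r + r + m).+1 C0; rewrite !exprS !exprD -/y -/z => yz'.
have := pochq_gt0 m; have := pochq_gt0 r; have := poch_gt0 r B0.
have := poch_gt0 (r + r + m) C0.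
move: (poch _ m) (poch _ r) (poch _ r) (poch _ (r + r + m)) => a b c d *.
by field; rewrite ?gt_eqF//=; lra.
Qed.

Lemma entry0 B C r : 0 <= B -> 0 <= C -> entry B C r 0 = 1.
Proof.
move=> B0 C0; rewrite /entry !addn0 poch0 mulr1.
rewrite !divff ?mulr1//; apply: lt0r_neq0;
  by [exact: poch_gt0|exact: pochq_gt0].
Qed.

(** Induction on the row: the three neighbours in the previous row are rational multiples of one
    entry, and the recursion becomes an identity of rational functions. *)
Lemma stieltjes_entry B C r m : 0 <= B -> 0 <= C ->
  L B C (r + m) r = entry B C r m.
Proof.
move=> B0 C0; move: {2}(r + m)%N (erefl (r + m)%N) => i.
elim: i r m => [|i IH] r m.
  by case: r => // -; case: m => // _; rewrite /= entry0.
case: m => [_|m]; first by rewrite addn0 stieltjes_diag entry0.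
rewrite addnS => -[irm]; rewrite /= irm.
(* Written relative to [entry B C r m], this neighbour carries the factor 1 - 2^-m. The factor
   vanishes for m = 0, where the neighbour lies above the diagonal, so both cases get the same
   formula. *)
have e3 : L B C i r.+1 = entry B C r m *
   ((1 - 2^-1 ^+ m) / (1 - 2^-1 ^+ r / 2) / (1 + B * 2^-1 ^+ r)
     * ((1 + C * (2^-1 ^+ r) ^+ 2) * (1 + C * (2^-1 ^+ r) ^+ 2 / 2))
     / (1 + C * ((2^-1 ^+ r) ^+ 2 * 2^-1 ^+ m))).
  case: m irm => [|m] irm.
    by rewrite expr0 subrr !mul0r mulr0 stieltjes_gt//; lia.
  have <- : (r.+1 + m)%N = i by lia.
  rewrite IH; last by lia.
  rewrite entrySl// !exprS; congr (_ * _).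
  by congr (_ / _ / _ * _ / _); field.
rewrite e3 -irm IH// entrySr//.
have := pochq_factor_gt0 m; set z := 2^-1 ^+ m => zg.
case: r irm {e3} => [|r] irm.
  rewrite /rec_mu /rec_la /rec_up /rec_down expr0 expr1.
  have := poch_factor_gt0 m C0; rewrite -/z => Cz.
  field; rewrite ?gt_eqF//=; try lra.
rewrite addSnnS.
rewrite IH; last by lia.
rewrite (entrySl r m)// /rec_mu /rec_la /rec_up /rec_down !exprS !expr0 !mulr1 -/z.
have := pochq_factor_gt0 r; have := half_exp_gt0 r.
have := poch_factor_gt0 r B0.
set y := 2^-1 ^+ r => By y0 yg.
have := mulr_gt0 (mulr_gt0 y0 y0) (half_exp_gt0 m); rewrite -/z => yyz.
have ? := mulr_ge0 C0 (ltW yyz).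
have ? := mulr_ge0 C0 (ltW (mulr_gt0 y0 y0)).
have ? := mulr_ge0 B0 (ltW y0).
field; rewrite ?gt_eqF//=; try lra.
Qed.

#[local] Arguments stieltjes : simpl never.

Lemma ratioE B C n : 0 <= C -> ratio B C n = poch B n / poch C n.
Proof. by move=> C0; rewrite /ratio big_split /= prodfV. Qed.

Lemma ratioS B C n : ratio B C n.+1 =
  ratio B C n * ((1 + B * 2^-1 ^+ n) / (1 + C * 2^-1 ^+ n)).
Proof. by rewrite /ratio big_ord_recr. Qed.

Lemma ratio_gt0 B C n : 0 <= B -> 0 <= C -> 0 < ratio B C n.
Proof. by move=> B0 C0; rewrite ratioE// divr_gt0// poch_gt0. Qed.

Lemma stieltjes_ratio B C n : 0 <= B -> 0 <= C -> L B C n 0 = ratio B C n.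
Proof.
move=> B0 C0; rewrite -(add0n n) stieltjes_entry// /entry ratioE// !add0n !poch0.
by rewrite !mul1r divr1 divff ?mul1r// gt_eqF// pochq_gt0.
Qed.

Local Notation piv B C := (pivot (rec_la B C)).

Definition hform (g : nat -> R) k (v : nat -> R) : R :=
  \sum_(i < k.+1) \sum_(j < k.+1) v i * v j * g (i + j)%N.

(* Schur product: expanding one factor as L D L^T turns the form of the product into a
   combination of forms of the other factor, with the pivots as coefficients. *)
Lemma hform_mul B C g k v : 0 <= B -> 0 <= C ->
  hform (fun n => ratio B C n * g n) k v =
  \sum_(r < k.+1) piv B C r * hform g k (fun i => L B C i r * v i).
Proof.
move=> B0 C0; rewrite /hform; pose N := (k + k).+1.
transitivity (\sum_(r < N) piv B C r *
    \sum_(i < k.+1) \sum_(j < k.+1)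
      L B C i r * v i * (L B C j r * v j) * g (i + j)%N).
  under eq_bigr => i _.
    under eq_bigr => j _.
      rewrite -stieltjes_ratio// -(@stieltjes_hankel _ _ _ N); last first.
        by have := ltn_ord i; have := ltn_ord j; rewrite /N; lia.
      rewrite mulr_suml mulr_sumr; over.
    rewrite exchange_big /=; over.
  rewrite exchange_big /=; apply: eq_bigr => r _.
  rewrite mulr_sumr; apply: eq_bigr => i _.
  rewrite mulr_sumr; apply: eq_bigr => j _; ring.
have kN : (k.+1 <= N)%N by rewrite /N; lia.
rewrite [RHS](big_ord_widen N (fun r => piv B C r *
    \sum_(i < k.+1) \sum_(j < k.+1)
      L B C i r * v i * (L B C j r * v j) * g (i + j)%N))//.
rewrite [RHS]big_mkcond /=; apply: eq_bigr => r _; case: ifPn => //.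
rewrite -leqNgt => kr; rewrite big1 ?mulr0// => i _; rewrite big1// => j _.
by rewrite stieltjes_gt ?mul0r//; have := ltn_ord i; lia.
Qed.

Lemma hform_ratio B C k v : 0 <= B -> 0 <= C ->
  hform (ratio B C) k v =
  \sum_(r < k.+1) piv B C r * (\sum_(i < k.+1) L B C i r * v i) ^+ 2.
Proof.
move=> B0 C0; rewrite -stieltjes_form; apply: eq_bigr => i _.
by apply: eq_bigr => j _; rewrite stieltjes_ratio.
Qed.

(** The positive part of [rec_la] that depends on C alone. It is shared by the factors [ratio A C]
    and [ratio B C] and cancels when their pivots are compared. *)
Definition la_common C n : R := let y := 2^-1 ^+ n in
  y ^+ 2 * (1 + 2 * C * y) * (1 - y / 2) /
  ((1 + 2 * C * y ^+ 2) * (1 + C * y ^+ 2) ^+ 2 * (1 + C * y ^+ 2 / 2)).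

Lemma rec_laE B C n : 0 <= C ->
  rec_la B C n = la_common C n * (1 + B * 2^-1 ^+ n) * (C * 2^-1 ^+ n - B).
Proof.
move=> C0; rewrite /rec_la /rec_up /rec_down /la_common (exprS _ n).
have := half_exp_gt0 n; move: (2^-1 ^+ n) => y y0.
have ? : 0 <= C * y ^+ 2 by rewrite mulr_ge0// exprn_ge0// ltW.
by field; rewrite ?gt_eqF//=; lra.
Qed.

Lemma la_common_gt0 C n : 0 <= C -> 0 < la_common C n.
Proof.
move=> C0; rewrite /la_common.
have := half_exp_le1 n; have := half_exp_gt0 n; move: (2^-1 ^+ n) => y y0 y1.
have ? : 0 <= C * y ^+ 2 by rewrite mulr_ge0// exprn_ge0// ltW.
have ? : 0 <= C * y by rewrite mulr_ge0// ltW.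
by rewrite divr_gt0 ?mulr_gt0 ?exprn_gt0//; lra.
Qed.

Lemma piv_ge0 B C k : 0 <= B -> 0 <= C ->
  (forall n, (n < k)%N -> B <= C * 2^-1 ^+ n) -> 0 <= piv B C k.
Proof.
move=> B0 C0 BC; apply: prodr_ge0 => n _; rewrite rec_laE//.
by rewrite mulr_ge0 ?subr_ge0 ?BC// ltW// mulr_gt0 ?la_common_gt0 ?poch_factor_gt0.
Qed.

Lemma half_exp_le (n m : nat) : (n <= m)%N -> 2^-1 ^+ m <= 2^-1 ^+ n :> R.
Proof. by move=> nm; rewrite ler_wiXn2l//; lra. Qed.

(** Pivot r is a product over n < r, and C 2^-n - B decreases with n, so the condition at n = k
    covers all r up to k + 1. *)
Lemma piv_ge0_last B C k r : 0 <= B -> 0 <= C -> (r <= k.+1)%N ->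
  B <= C * 2^-1 ^+ k -> 0 <= piv B C r.
Proof.
move=> B0 C0 rk BC; apply: piv_ge0 => // n nr; apply: le_trans BC _.
by rewrite ler_wpM2l// half_exp_le//; lia.
Qed.

Lemma hform_ratio_ge0 B C k v : 0 <= B -> 0 <= C ->
  B <= C * 2^-1 ^+ k -> 0 <= hform (ratio B C) k.+1 v.
Proof.
move=> B0 C0 BC; rewrite hform_ratio//; apply: sumr_ge0 => r _.
by rewrite mulr_ge0 ?sqr_ge0//; apply: piv_ge0_last BC => //; rewrite -ltnS.
Qed.

Lemma hform_ratio2_ge0 A B C k v : 0 <= A -> 0 <= B -> 0 <= C ->
  A <= C * 2^-1 ^+ k -> B <= C * 2^-1 ^+ k ->
  0 <= hform (fun n => ratio A C n * ratio B C n) k.+1 v.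
Proof.
move=> A0 B0 C0 AC BC; rewrite hform_mul//; apply: sumr_ge0 => r _.
rewrite mulr_ge0 ?hform_ratio_ge0//.
by apply: piv_ge0_last AC => //; rewrite -ltnS.
Qed.

Lemma hform_ratio_ge B C k v : 0 <= B -> 0 <= C ->
  B <= C * 2^-1 ^+ k ->
  piv B C k.+2 * v k.+2 ^+ 2 <= hform (ratio B C) k.+2 v.
Proof.
move=> B0 C0 BC; rewrite hform_ratio// big_ord_recr /= -[leLHS]add0r lerD//.
  apply: sumr_ge0 => r _; rewrite mulr_ge0 ?sqr_ge0//.
  by apply: piv_ge0_last BC => //; have := ltn_ord r; lia.
rewrite big_ord_recr /= stieltjes_diag mul1r big1 ?add0r// => i _.
by rewrite stieltjes_gt ?mul0r.
Qed.

(** The diagonal Hankel entry is the sum of pivot r times L(i, r)^2, and the term r = i is the pivot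
    itself. *)
Lemma ratio_ge_piv B C k i : 0 <= B -> 0 <= C -> (i <= k.+1)%N ->
  B <= C * 2^-1 ^+ k -> piv B C i <= ratio B C (i + i).
Proof.
move=> B0 C0 ik BC; rewrite -stieltjes_ratio// -(@stieltjes_hankel _ _ _ (i + i).+1)//.
have ii : (i < (i + i).+1)%N by lia.
rewrite (bigD1 (Ordinal ii))//= stieltjes_diag !mulr1 lerDl sumr_ge0// => r _.
have [ri|ri] := leqP r i; last by rewrite stieltjes_gt// mulr0.
rewrite -mulrA -expr2 mulr_ge0 ?sqr_ge0//.
by apply: piv_ge0_last BC => //; lia.
Qed.

Lemma poch_cross A B n m : 0 <= A -> A <= B ->
  poch A (n + m) * poch B n <= poch B (n + m) * poch A n.
Proof.
move=> A0 AB; have B0 := le_trans A0 AB.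
elim: m => [|m IH]; first by rewrite addn0 mulrC.
rewrite addnS !pochS -[leLHS]mulrAC -[leRHS]mulrAC ler_pM//.
- by rewrite mulr_ge0// ltW// poch_gt0.
- by rewrite ltW// poch_factor_gt0.
- by rewrite lerD2l ler_wpM2r// ltW// half_exp_gt0.
Qed.

(** In the quotient of the two pivots the C-dependent parts cancel, and what remains besides the
    Pochhammer products is C 2^-n - B <= C 2^-n - A. *)
Lemma piv_cross A B C k r : 0 <= A -> A <= B -> 0 <= C -> (r <= k.+1)%N ->
  B <= C * 2^-1 ^+ k -> piv B C r * poch A r <= piv A C r * poch B r.
Proof.
move=> A0 AB C0 rk BC; have B0 := le_trans A0 AB.
elim: r rk => [|r IH] rk; first by rewrite !poch0 /pivot !big_ord0.
rewrite !pivotS !pochS !rec_laE//.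
have h : C * 2^-1 ^+ r - B <= C * 2^-1 ^+ r - A by lra.
have Bk : B <= C * 2^-1 ^+ r.
  by apply: le_trans BC _; rewrite ler_wpM2l// half_exp_le//; lia.
have l0 := la_common_gt0 r C0.
have A1 := poch_factor_gt0 r A0; have B1 := poch_factor_gt0 r B0.
set cr := la_common C r * (1 + A * 2^-1 ^+ r) * (1 + B * 2^-1 ^+ r).
have cr0 : 0 <= cr by rewrite ltW//; do 2![apply: mulr_gt0 => //].
have -> : piv B C r * (la_common C r * (1 + B * 2^-1 ^+ r) * (C * 2^-1 ^+ r - B)) *
  (poch A r * (1 + A * 2^-1 ^+ r)) = (piv B C r * poch A r) * (cr * (C * 2^-1 ^+ r - B)).
  by rewrite /cr; ring.
have -> : piv A C r * (la_common C r * (1 + A * 2^-1 ^+ r) * (C * 2^-1 ^+ r - A)) *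
  (poch B r * (1 + B * 2^-1 ^+ r)) = (piv A C r * poch B r) * (cr * (C * 2^-1 ^+ r - A)).
  by rewrite /cr; ring.
apply: ler_pM.
- apply: mulr_ge0; last by rewrite ltW// poch_gt0.
  by apply: piv_ge0_last BC => //; lia.
- by apply: mulr_ge0 => //; rewrite subr_ge0.
- by apply: IH; lia.
- exact: ler_wpM2l.
Qed.

(** The exchange rate between the two factors: it bounds the terms that come with the negative pivot
    of B by those that come with the pivots of A. [piv_cross] handles the pivots and [poch_cross]
    the moments of index 2 k + 4. *)
Lemma piv_cross_last A B C k : 0 <= A -> A <= B -> 0 <= C ->
  B <= C * 2^-1 ^+ k ->
  piv B C k.+1 * ratio A C (k.+2 + k.+2) * (1 + B * 2^-1 ^+ k.+1)
    * (C * 2^-1 ^+ k - A)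
  <= piv A C k.+1 * ratio B C (k.+2 + k.+2) * (1 + A * 2^-1 ^+ k.+1)
    * (C * 2^-1 ^+ k - B).
Proof.
move=> A0 AB C0 BC; have B0 := le_trans A0 AB.
have h1 := @piv_cross A B C k k A0 AB C0 (leqnSn k) BC.
have h2 := @poch_cross A B k.+2 k.+2 A0 AB.
rewrite !pivotS !rec_laE// !ratioE//.
have l0 := la_common_gt0 k C0.
have A1 := poch_factor_gt0 k A0; have B1 := poch_factor_gt0 k B0.
have Ak := poch_gt0 k.+2 A0; have Bk := poch_gt0 k.+2 B0.
have Ck := poch_gt0 (k.+2 + k.+2) C0.
(* The quantities common to both sides. Once they are taken out, the claim is the product of [h1]
   and [h2]. *)
set cr := la_common C k * (C * 2^-1 ^+ k - A) * (C * 2^-1 ^+ k - B)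
   / (poch C (k.+2 + k.+2) * poch A k.+2 * poch B k.+2)
   * (1 + A * 2^-1 ^+ k) * (1 + B * 2^-1 ^+ k)
   * (1 + A * 2^-1 ^+ k.+1) * (1 + B * 2^-1 ^+ k.+1).
have cr0 : 0 <= cr.
  have Ap : 0 <= C * 2^-1 ^+ k - A by rewrite subr_ge0 (le_trans AB).
  have Bp : 0 <= C * 2^-1 ^+ k - B by rewrite subr_ge0.
  have Ak1 := poch_factor_gt0 k.+1 A0; have Bk1 := poch_factor_gt0 k.+1 B0.
  do 4![apply: mulr_ge0; last exact: ltW]; apply: mulr_ge0.
    by apply: mulr_ge0 => //; apply: mulr_ge0 => //; exact: ltW.
  by rewrite invr_ge0 ltW//; do 2![apply: mulr_gt0 => //].
have e1 : piv B C k * (la_common C k * (1 + B * 2^-1 ^+ k) * (C * 2^-1 ^+ k - B)) *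
  (poch A (k.+2 + k.+2) / poch C (k.+2 + k.+2)) * (1 + B * 2^-1 ^+ k.+1) *
  (C * 2^-1 ^+ k - A) =
  cr * (piv B C k * poch A k) * (poch A (k.+2 + k.+2) * poch B k.+2).
  have := poch_gt0 k A0; rewrite /cr.
  move: Ak Bk Ck; rewrite (pochS A k.+1) (pochS A k).
  move: (poch A k) => a Ak Bk Ck a0.
  have := poch_factor_gt0 k.+1 A0.
  by move=> ?; field; rewrite ?gt_eqF//=.
have e2 : piv A C k * (la_common C k * (1 + A * 2^-1 ^+ k) * (C * 2^-1 ^+ k - A)) *
  (poch B (k.+2 + k.+2) / poch C (k.+2 + k.+2)) * (1 + A * 2^-1 ^+ k.+1) *
  (C * 2^-1 ^+ k - B) =
  cr * (piv A C k * poch B k) * (poch B (k.+2 + k.+2) * poch A k.+2).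
  have := poch_gt0 k B0; rewrite /cr.
  move: Ak Bk Ck; rewrite (pochS B k.+1) (pochS B k).
  move: (poch B k) => a Ak Bk Ck a0.
  have := poch_factor_gt0 k.+1 B0.
  by move=> ?; field; rewrite ?gt_eqF//=.
rewrite e1 e2; apply: ler_pM => //.
- apply: mulr_ge0 => //; apply: mulr_ge0; last by rewrite ltW// poch_gt0.
  by apply: piv_ge0_last BC => //; lia.
- by apply: mulr_ge0; rewrite ltW// poch_gt0.
- exact: ler_wpM2l.
Qed.

End Ratio.

(** * Real inequalities that compensate a negative last pivot *)

Section GainInequalities.
Variable R : realFieldType.
Implicit Types (A B C x y z : R) (n r m k : nat).
(** This is the normalized form a = A / h, u = C y / h, 2 a - 1 = B / h. The constant 7/8 is the
    least value of 1 - y / 4 for y <= 1/2. *)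
Lemma core_ineq (a u h : R) : 2 <= a -> 2 * a - 1 <= u -> 0 <= h -> h <= 1 ->
  0 <= (u / 2 - a) * (u - a) - (2 * a - 1 - u / 2) * (u - (2 * a - 1))
       + 7 / 8 * (2 + h * a / 2) * u / (1 + h * u) * (u - a).
Proof.
move=> a2 ua h0 h1.
have hu : 0 <= h * u by rewrite mulr_ge0//; lra.
(* Here u >= 2 a - 1 >= 3, and 3/4 is the value of u / (1 + u) at u = 3. Once the denominator is
   cleared, the bound is affine in h. *)
have e : 7 / 8 * (2 + a / 2) * (3 / 4) <= 7 / 8 * (2 + h * a / 2) * u / (1 + h * u).
  rewrite ler_pdivlMr; last lra.
  have : (1 - h) * (u - a / 4) >= 0 by rewrite mulr_ge0; lra.
  nra.
have : 0 <= (7 / 8 * (2 + h * a / 2) * u / (1 + h * u)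
   - 7 / 8 * (2 + a / 2) * (3 / 4)) * (u - a) by rewrite mulr_ge0; lra.
move: (_ / (1 + h * u)) => T hT.
(* With the fraction replaced by its bound, four times the expression is this square plus a
   polynomial in a that is positive for a >= 2. *)
have := sqr_ge0 (2 * u + (45 / 16 - 267 / 64 * a)).
have : 0 <= (a - 2) * a by rewrite mulr_ge0; lra.
nra.
Qed.

(** With y = 2^-k, [gain A B C y * (C - B)] measures the Schur complement at column k + 1 in the
    unit in which the last pivot of the factor A is C y / 2 - A; see [la_common_gain]. *)
Definition gain A B C y : R :=
  2 * (1 - y / 4) * (1 + A * y / 2) * (1 + C * y ^+ 2 / 2) * (1 + C * y ^+ 2 / 8)
  / ((1 + C * y) * (1 + C * y ^+ 2 / 4) * (1 + B * y ^+ 2 / 8)).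

(** From B <= C y and y <= 1 follows B y^2 <= C y^2, so the factors left out have a quotient of at
    least 1. *)
Lemma gain_ge A B C y : 0 <= A -> 0 <= B -> B <= C * y -> 0 < y -> y <= 1 ->
  2 * (1 - y / 4) * (1 + A * y / 2) / (1 + C * y) <= gain A B C y.
Proof.
move=> A0 B0 BC y0 y1.
have Ay : 0 <= A * y by rewrite mulr_ge0// ltW.
have Cy : 0 <= C * y by lra.
have Cyy : 0 <= C * y ^+ 2 by rewrite expr2 mulrA mulr_ge0// ltW.
have Byy : 0 <= B * y ^+ 2 by rewrite mulr_ge0// exprn_ge0// ltW.
have BCy : B * y ^+ 2 <= C * y ^+ 2.
  rewrite ler_wpM2r ?sqr_ge0//; apply: (le_trans BC).
  by rewrite ler_piMr//; rewrite -(pmulr_lge0 _ y0).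
have -> : gain A B C y = 2 * (1 - y / 4) * (1 + A * y / 2) / (1 + C * y) *
   ((1 + C * y ^+ 2 / 2) * (1 + C * y ^+ 2 / 8) /
    ((1 + C * y ^+ 2 / 4) * (1 + B * y ^+ 2 / 8))).
  by rewrite /gain; field; rewrite ?gt_eqF//=; lra.
rewrite ler_peMr ?divr_ge0 ?mulr_ge0//; try lra.
by rewrite ler_pdivlMr ?mulr_gt0//; nra.
Qed.

Lemma gain_ineq A B C y h : 0 < h -> h <= 1 -> 2 * A = B + h -> 3 * h <= B ->
  0 < y -> y <= 1 -> y = 1 \/ y <= 2^-1 ->
  B + (B - h) * y <= C * y -> C * y < 2 * B ->
  0 <= (C * y / 2 - A) * (C * y - A) - (B - C * y / 2) * (C * y - B)
     + gain A B C y * (C - B) * (C * y - A).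
Proof.
move=> h0 h1 AB Bh y0 y1 yy Cy Cy2.
have Bhy : 0 <= (B - h) * y by rewrite mulr_ge0//; lra.
have C0 : 0 < C by rewrite -(pmulr_lgt0 _ y0); lra.
have CyC : C * y <= C by rewrite ler_piMr// ltW.
have Ay : 0 <= A * y by rewrite mulr_ge0//; lra.
have G := @gain_ge A B C y ltac:(lra) ltac:(lra) ltac:(lra) y0 y1.
case: yy => [y_1|y2].
  (* At y = 1 the first product dominates the second: C / 2 - A >= B / 2 - h >= h / 2 >= B - C / 2,
     and C - A >= C - B. *)
  rewrite y_1 !mulr1 in Cy Cy2 G *.
  have : 0 <= gain A B C 1 * (C - B) * (C - A).
    apply: mulr_ge0; last lra; apply: mulr_ge0; last lra.
    by apply: le_trans G; rewrite divr_ge0// ?mulr_ge0//; lra.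
  nra.
have K := @core_ineq (A / h) (C * y / h) h.
have {}K : 0 <= (C * y / 2 - A) * (C * y - A) - (B - C * y / 2) * (C * y - B)
       + 7 / 8 * (2 + A / 2) * (C * y) / (1 + C * y) * (C * y - A).
  have -> : B = 2 * A - h by lra.
  have : 0 <= h ^+ 2 * ((C * y / h / 2 - A / h) * (C * y / h - A / h) -
      (2 * (A / h) - 1 - C * y / h / 2) * (C * y / h - (2 * (A / h) - 1)) +
      7 / 8 * (2 + h * (A / h) / 2) * (C * y / h) / (1 + h * (C * y / h)) *
      (C * y / h - A / h)).
    apply: mulr_ge0; first by rewrite sqr_ge0.
    apply: K => //.
    - by rewrite ler_pdivlMr//; lra.
    - rewrite -subr_ge0 (_ : _ - _ = (C * y - (2 * A - h)) / h).
        by rewrite divr_ge0//; lra.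
      by field; rewrite gt_eqF.
    - exact: ltW.
  rewrite (_ : h * (C * y / h) = C * y); last by field; rewrite gt_eqF.
  rewrite (_ : h * (A / h) = A); last by field; rewrite gt_eqF.
  congr (_ <= _); field; rewrite !gt_eqF//; lra.
apply: (le_trans K); rewrite lerD2l ler_wpM2r//; first lra.
(* From here on y <= 1/2. It gives 2 C y <= C and, with B <= C y, also C - B >= C / 2, which turns
   the true gain into the one of [core_ineq]. *)
have C2 : C * y * 2 <= C.
  rewrite -mulrA ler_piMr ?(ltW C0)//; lra.
apply: (@le_trans _ _ (2 * (1 - y / 4) * (1 + A * y / 2) / (1 + C * y) * (C - B))); last first.
  by rewrite ler_wpM2r//; lra.
rewrite [leRHS]mulrAC ler_pM2r ?invr_gt0; last lra.
apply: (@le_trans _ _ (7 / 8 * (1 + A * y / 2) * C)).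
  have : 0 <= A * (C * y) by rewrite mulr_ge0; lra.
  nra.
have : 0 <= (1 + A * y / 2) * ((1 - y / 4) * (C - B * 2)) by rewrite !mulr_ge0; lra.
have : 0 <= (1 + A * y / 2) * C * (2^-1 - y) by rewrite !mulr_ge0; lra.
nra.
Qed.

(** The case where both last pivots are negative. Then B <= C y < 2 A = B + h, so the negative
    products are of size at most about h B, while the gain term is at least 4 h (C y - A), where C y
    - A >= (B - h) / 2. *)
Lemma gain_ineq2 A B C y h : 0 < h -> h <= 1 -> 2 * A = B + h -> 3 * h <= B ->
  0 < y -> y <= 4^-1 ->
  B <= C * y -> C * y / 2 < A ->
  0 <= (C * y / 2 - A) * (C * y - A) - 2 * (B - C * y / 2) * (C * y - B)
     + gain A B C y * (C - B) * (C * y - A).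
Proof.
move=> h0 h1 AB Bh y0 y4 BC CA.
have Ay : 0 <= A * y by rewrite mulr_ge0//; lra.
have C0 : 0 < C by rewrite -(pmulr_lgt0 _ y0); lra.
have C4 : C * y * 4 <= C by rewrite -mulrA ler_piMr ?(ltW C0)//; lra.
have G := @gain_ge A B C y ltac:(lra) ltac:(lra) ltac:(lra) y0 ltac:(lra).
have G4 : 4 * h <= gain A B C y * (C - B).
  apply: (@le_trans _ _ (2 * (1 - y / 4) * (1 + A * y / 2) / (1 + C * y) * (C - B))).
    rewrite mulrAC ler_pdivlMr; last lra.
    have : 0 <= (1 - y / 4) * (A * y) * (C - B) by rewrite !mulr_ge0; lra.
    have : 0 <= (16^-1 - y / 4) * (C - B) by rewrite !mulr_ge0; lra.
    have : 0 <= (1 - h) * (C * y) by rewrite !mulr_ge0; lra.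
    nra.
  by rewrite ler_wpM2r//; lra.
have : 0 <= (gain A B C y * (C - B) - 4 * h) * (C * y - A) by rewrite mulr_ge0; lra.
have : 0 <= (C * y - B) * (C * y / 2 - B / 2) by rewrite mulr_ge0; lra.
have : 0 <= (h - (C * y - B)) * B by rewrite mulr_ge0; lra.
have : 0 <= h * (C * y - A - B / 3) by rewrite mulr_ge0; lra.
have : 0 <= (C * y - A) * (C * y / 2 - A + h / 2) by rewrite mulr_ge0; lra.
nra.
Qed.

End GainInequalities.

(** * Products of two moment sequences under the second bound *)

Section RatioProduct.
Variable R : realFieldType.
Implicit Types (A B C x y z : R) (n r m k : nat) (g v : nat -> R).
Local Notation L B C := (stieltjes (rec_mu B C) (rec_la B C)).
Local Notation piv B C := (pivot (rec_la B C)).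
#[local] Arguments stieltjes : simpl never.

Lemma stieltjes_subdiag B C k : 0 <= B -> 0 <= C ->
  L B C k.+1 k = 2 * (1 - 2^-1 ^+ k.+1) * (1 + B * 2^-1 ^+ k) / (1 + C * (2^-1 ^+ k) ^+ 2).
Proof.
move=> B0 C0; rewrite -[k.+1]addn1 stieltjes_entry// entrySr// entry0// addn1 (exprS 2^-1 k) expr0 !mulr1 mul1r.
have := poch_factor_gt0 (k + k) C0; rewrite exprD -expr2 => ?.
by field; rewrite gt_eqF.
Qed.

Lemma hform_last2 g k v : (forall i, (i < k.+1)%N -> v i = 0) ->
  hform g k.+2 v = v k.+1 ^+ 2 * g (k.+1 + k.+1)%N
    + 2 * v k.+1 * v k.+2 * g (k.+1 + k.+2)%N + v k.+2 ^+ 2 * g (k.+2 + k.+2)%N.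
Proof.
move=> v0; rewrite /hform 2!big_ord_recr /= big1 ?add0r; last first.
  by move=> i _; rewrite big1// => j _; rewrite (v0 i)// !mul0r.
rewrite !big_ord_recr /= !big1 ?add0r; try by move=> i _; rewrite (v0 i) ?mulr0 ?mul0r//; have := ltn_ord i; lia.
by rewrite (addnC k.+2 k.+1) (v0 k)//; ring.
Qed.

Lemma quad_ge (p q r x y : R) : 0 < p -> y ^+ 2 * (r - q ^+ 2 / p) <=
  x ^+ 2 * p + 2 * x * y * q + y ^+ 2 * r.
Proof.
move=> p0; rewrite -subr_ge0.
have -> : x ^+ 2 * p + 2 * x * y * q + y ^+ 2 * r - y ^+ 2 * (r - q ^+ 2 / p)
  = p * (x + q / p * y) ^+ 2 by field; rewrite gt_eqF.
by rewrite mulr_ge0 ?sqr_ge0// ltW.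
Qed.

(* Only the last pivot of the second factor is negative; its contribution is compensated by
   the last two terms of the expansion along the first factor. *)
Lemma hform_ratio2_ge A B C k v : 0 <= A -> 0 <= B -> 0 <= C ->
  A <= C * 2^-1 ^+ k -> B <= C * 2^-1 ^+ k -> piv B C k.+2 <= 0 ->
  forall F G : nat -> R, F = ratio A C -> G = ratio B C ->
  v k.+2 ^+ 2 *
   (piv A C k.+2 * G (k.+2 + k.+2)%N
    + piv B C k.+2 * (F (k.+2 + k.+2)%N - piv A C k.+2)
    + piv A C k.+1 * L A C k.+2 k.+1 ^+ 2
      * (G (k.+2 + k.+2)%N - G (k.+1 + k.+2)%N ^+ 2 / G (k.+1 + k.+1)%N))
  <= hform (fun n => F n * G n) k.+2 v.
Proof.
move=> A0 B0 C0 AC BC b0 F G FE GE.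
have -> : hform (fun n => F n * G n) k.+2 v = hform (fun n => ratio A C n * G n) k.+2 v.
  by rewrite FE.
rewrite hform_mul// 2!big_ord_recr /=.
have al r : (r <= k.+1)%N -> 0 <= piv A C r by move=> rk; apply: piv_ge0_last AC.
(* In the columns r <= k each form is bounded below by its last coordinate. The coefficients then
   add up to the moment of index 2 k + 4 of the first factor, less the contributions of its last two
   columns. *)
have h1 : piv B C k.+2 * v k.+2 ^+ 2 * (F (k.+2 + k.+2)%N - piv A C k.+2
     - piv A C k.+1 * L A C k.+2 k.+1 ^+ 2) <=
  \sum_(i < k.+1) piv A C i * hform G k.+2 (fun i0 => L A C i0 i * v i0).
  have -> : F (k.+2 + k.+2)%N - piv A C k.+2 - piv A C k.+1 * L A C k.+2 k.+1 ^+ 2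
     = \sum_(i < k.+1) piv A C i * L A C k.+2 i ^+ 2.
    rewrite FE -stieltjes_ratio// -(@stieltjes_hankel _ _ _ (k.+2 + k.+2).+1)//.
    have kN : (k.+3 <= (k.+2 + k.+2).+1)%N by lia.
    transitivity (\sum_(i < k.+3) piv A C i * L A C k.+2 i ^+ 2
      - piv A C k.+2 - piv A C k.+1 * L A C k.+2 k.+1 ^+ 2); last first.
      by rewrite 2!big_ord_recr /= stieltjes_diag; ring.
    congr (_ - _ - _).
    rewrite [RHS](big_ord_widen _ (fun i => piv A C i * L A C k.+2 i ^+ 2) kN).
    rewrite [RHS]big_mkcond /=; apply: eq_bigr => i _; case: ifPn => [_|]; first ring.
    by rewrite -leqNgt => ki; rewrite stieltjes_gt ?mulr0.
  rewrite mulr_sumr; apply: ler_sum => i _.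
  have := @hform_ratio_ge _ B C k (fun i0 => L A C i0 i * v i0) B0 C0 BC.
  rewrite -GE => /(ler_wpM2l (al i _)) => /(_ (ltnW (ltn_ord i))); apply: le_trans.
  by rewrite le_eqVlt; apply/orP; left; apply/eqP; ring.
(* Column k + 1 of L meets only the last two coordinates; [quad_ge] minimizes the 2 by 2 form over
   the first of them. *)
have h2 : piv A C k.+1 * (L A C k.+2 k.+1 ^+ 2 * v k.+2 ^+ 2
      * (G (k.+2 + k.+2)%N - G (k.+1 + k.+2)%N ^+ 2 / G (k.+1 + k.+1)%N)) <=
  piv A C k.+1 * hform G k.+2 (fun i0 => L A C i0 k.+1 * v i0).
  apply: ler_wpM2l; first exact: al.
  rewrite hform_last2; last by move=> i ik; rewrite stieltjes_gt ?mul0r.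
  rewrite -exprMn; apply: quad_ge; rewrite GE; exact: ratio_gt0.
have h3 : hform G k.+2 (fun i0 => L A C i0 k.+2 * v i0) = v k.+2 ^+ 2 * G (k.+2 + k.+2)%N.
  rewrite hform_last2; last by move=> i ik; rewrite stieltjes_gt ?mul0r//; lia.
  by rewrite stieltjes_diag stieltjes_gt//; ring.
rewrite h3; apply: le_trans (lerD (lerD h1 h2) (lexx _)); rewrite -subr_ge0.
set l := L A C k.+2 k.+1; set p := piv A C k.+1.
set GG := (G (k.+2 + k.+2)%N - _ / _).
rewrite [X in 0 <= X](_ : _ = - piv B C k.+2 * v k.+2 ^+ 2 * (p * l ^+ 2)); last ring.
apply: mulr_ge0; first by rewrite mulr_ge0 ?oppr_ge0 ?sqr_ge0.
by apply: mulr_ge0; [exact: al|exact: sqr_ge0].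
Qed.

Lemma la_common_gain A B C k : 0 <= A -> 0 <= B -> 0 <= C ->
  let y := 2^-1 ^+ k in
  L A C k.+2 k.+1 ^+ 2 * (1 - (ratio B C (k.+1 + k.+2) / ratio B C (k.+1 + k.+1))
       * (ratio B C (k.+1 + k.+2) / ratio B C (k.+2 + k.+2)))
  = la_common C k.+1 * (1 + A * (y / 2)) * (gain A B C y * (C - B)).
Proof.
move=> A0 B0 C0 y.
have -> : (k.+2 + k.+2 = (k.+1 + k.+1).+2)%N by lia.
have -> : (k.+1 + k.+2 = (k.+1 + k.+1).+1)%N by lia.
have := ratio_gt0 (k.+1 + k.+1) B0 C0.
rewrite (ratioS B C (k.+1 + k.+1).+1) (ratioS B C (k.+1 + k.+1)).
rewrite stieltjes_subdiag// /la_common /gain.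
have := poch_factor_gt0 (k.+1 + k.+1).+1 C0; have := poch_factor_gt0 (k.+1 + k.+1).+1 B0.
have := poch_factor_gt0 (k.+1 + k.+1) C0; have := poch_factor_gt0 (k.+1 + k.+1) B0.
rewrite !(exprS _ (k.+1 + k.+1)) !exprD !(exprS 2^-1 k.+1) !(exprS 2^-1 k) -/y.
have y0 : 0 < y := half_exp_gt0 _ k.
have ? : 0 <= C * y by rewrite mulr_ge0// ltW.
have ? : 0 <= C * y ^+ 2 by rewrite mulr_ge0// sqr_ge0.
have ? : 0 <= B * y ^+ 2 by rewrite mulr_ge0// sqr_ge0.
move: (ratio _ _ _) => r B1 C1 B2 C2 r0.
by field; rewrite ?gt_eqF//=; lra.
Qed.

(** Multiplied by [D], the claim is a sum of three products: the scalar inequality, the exchange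
    rate [H1] and the bound on [W]. Here [N * a1 * X] is the last step of the pivot of A, [- S]
    gives the sign of that of B, and [W] is the moment of A without its last pivot. *)
Lemma combine_bound (al be N a1 b1 F G D S X E g kap W : R) :
  0 <= al -> 0 <= be -> 0 <= N -> 0 <= a1 -> 0 <= b1 -> 0 <= G -> 0 < D ->
  0 <= S -> be * F * b1 * D <= al * G * a1 * E -> W <= kap * F -> 0 <= kap ->
  0 <= X * D - kap * S * E + g * D ->
  0 <= al * (N * a1 * X) * G + be * (N * b1 * (- S)) * W + al * (N * a1 * g) * G.
Proof.
move=> al0 be0 N0 a0 b0 G0 D0 S0 H1 H2 k0 H3.
rewrite -(pmulr_lge0 _ D0).
have e1 : 0 <= al * N * a1 * G * (X * D - kap * S * E + g * D).
  by rewrite mulr_ge0// !mulr_ge0.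
have e2 : 0 <= N * S * kap * (al * G * a1 * E - be * F * b1 * D).
  by rewrite mulr_ge0 ?subr_ge0// !mulr_ge0.
have e3 : 0 <= be * N * b1 * S * D * (kap * F - W).
  by rewrite mulr_ge0 ?subr_ge0// !mulr_ge0// ltW.
nra.
Qed.

(** It keeps a negative last pivot of A below the corresponding moment in absolute value, so that
    subtracting it at most doubles the moment. *)
Lemma la_common_le A C k : 0 <= A -> 0 <= C ->
  la_common C k * (1 + A * 2^-1 ^+ k) * ratio A C (k + k) <= ratio A C (k + k).+2.
Proof.
move=> A0 C0; rewrite (ratioS A C (k + k).+1) (ratioS A C (k + k)) mulrC -[leRHS]mulrA.
rewrite ler_pM2l ?ratio_gt0// /la_common (exprS _ (k + k)) exprD.
have := half_exp_le1 R k; have := half_exp_gt0 R k; move: (2^-1 ^+ k) => y y0 y1.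
have Cy : 0 <= C * y ^+ 2 by rewrite mulr_ge0// sqr_ge0.
have Ay : 0 <= A * y ^+ 2 by rewrite mulr_ge0// sqr_ge0.
have Cy1 : 0 <= C * y by rewrite mulr_ge0// ltW.
have Ay1 : 0 <= A * y by rewrite mulr_ge0// ltW.
have p1 : y * (1 + 2 * C * y) / (1 + 2 * C * y ^+ 2) <= 1.
  by rewrite ler_pdivrMr; nra.
have p2 : (1 - y / 2) / (1 + C * y ^+ 2) <= 1.
  by rewrite ler_pdivrMr; lra.
have p3 : y * (1 + A * y) <= (1 + A * y ^+ 2) * (1 + A * y ^+ 2 / 2).
  have : 0 <= A * y ^+ 2 * (A * y ^+ 2) by rewrite mulr_ge0.
  nra.
have D0 : 0 < (1 + C * y ^+ 2) * (1 + C * y ^+ 2 / 2) by rewrite mulr_gt0; lra.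
rewrite [leLHS](_ : _ = y * (1 + 2 * C * y) / (1 + 2 * C * y ^+ 2) *
   ((1 - y / 2) / (1 + C * y ^+ 2)) *
   (y * (1 + A * y) / ((1 + C * y ^+ 2) * (1 + C * y ^+ 2 / 2)))); last first.
  by field; rewrite ?gt_eqF//=; lra.
rewrite [leRHS](_ : _ = 1 * ((1 + A * y ^+ 2) * (1 + A * y ^+ 2 / 2) /
   ((1 + C * y ^+ 2) * (1 + C * y ^+ 2 / 2)))); last first.
  by field; rewrite ?gt_eqF//=; lra.
have q1 : 0 <= y * (1 + 2 * C * y) / (1 + 2 * C * y ^+ 2).
  by rewrite divr_ge0 ?mulr_ge0 ?(ltW y0)//; lra.
have q2 : 0 <= (1 - y / 2) / (1 + C * y ^+ 2) by rewrite divr_ge0//; lra.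
apply: ler_pM.
- exact: mulr_ge0.
- by rewrite divr_ge0 ?(ltW D0)// mulr_ge0 ?(ltW y0)//; lra.
- by rewrite -[leRHS]mulr1 ler_pM.
- by rewrite ler_pM2r// invr_gt0.
Qed.

Lemma hform_ratio2_gain A B C h k v : 0 < h -> h <= 1 -> 2 * A = B + h ->
  3 * h <= B -> B + (B - h) * 2^-1 ^+ k <= C * 2^-1 ^+ k ->
  0 <= hform (fun n => ratio A C n * ratio B C n) k.+2 v.
Proof.
move=> h0 h1 AB Bh CB.
have y0 := half_exp_gt0 R k; have y1 := half_exp_le1 R k.
have Bhy : 0 <= (B - h) * 2^-1 ^+ k by rewrite mulr_ge0 ?(ltW y0)//; lra.
have BC : B <= C * 2^-1 ^+ k by lra.
have A0 : 0 < A by lra.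
have B0 : 0 < B by lra.
have AB' : A <= B by lra.
have C0 : 0 < C by rewrite -(pmulr_lgt0 _ y0); lra.
have ey : 2^-1 ^+ k.+1 = 2^-1 ^+ k / 2 :> R by rewrite exprS mulrC.
have [BC2|BC2] := leP B (C * 2^-1 ^+ k.+1).
  by apply: hform_ratio2_ge0; rewrite ?(ltW A0) ?(ltW B0) ?(ltW C0)//; apply: le_trans BC2.
have piv_neg : piv B C k.+2 <= 0.
  rewrite pivotS rec_laE ?(ltW C0)//; apply: mulr_ge0_le0.
    by apply: piv_ge0_last BC; rewrite ?(ltW B0) ?(ltW C0).
  apply: mulr_ge0_le0; last by rewrite subr_le0 ltW.
  by rewrite ltW// mulr_gt0 ?la_common_gt0 ?poch_factor_gt0// ltW.
apply: le_trans (hform_ratio2_ge v _ _ _ _ _ piv_neg (erefl _) (erefl _));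
  rewrite ?(ltW A0) ?(ltW B0) ?(ltW C0) ?(le_trans AB')//.
apply: mulr_ge0; first exact: sqr_ge0.
set y := 2^-1 ^+ k in y0 y1 Bhy BC CB ey *.
pose F := ratio A C (k.+2 + k.+2); pose G := ratio B C (k.+2 + k.+2).
have F0 : 0 < F by rewrite ratio_gt0// ltW.
have G0 : 0 < G by rewrite ratio_gt0// ltW.
have Gl0 : 0 < ratio B C (k.+1 + k.+1) by rewrite ratio_gt0// ltW.
have N0 := la_common_gt0 k.+1 (ltW C0).
have gainE := @la_common_gain A B C k (ltW A0) (ltW B0) (ltW C0).
have cross := piv_cross_last (ltW A0) AB' (ltW C0) BC.
have al0 := @piv_ge0_last _ A C k k.+1 (ltW A0) (ltW C0) (leqnn _) (le_trans AB' BC).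
have be0 := @piv_ge0_last _ B C k k.+1 (ltW B0) (ltW C0) (leqnn _) BC.
have alF := @ratio_ge_piv _ A C k k.+1 (ltW A0) (ltW C0) (leqnn _) (le_trans AB' BC).
have laF := @la_common_le A C k.+1 (ltW A0) (ltW C0).
have ek : (k.+2 + k.+2 = (k.+1 + k.+1).+2)%N by rewrite !addSn !addnS.
have FE : ratio A C (k.+1 + k.+1).+2 = F by rewrite /F ek.
rewrite FE in laF.
have E1 : L A C k.+2 k.+1 ^+ 2 * (ratio B C (k.+2 + k.+2) -
    ratio B C (k.+1 + k.+2) ^+ 2 / ratio B C (k.+1 + k.+1)) =
    la_common C k.+1 * (1 + A * (y / 2)) * (gain A B C y * (C - B)) * G.
  by rewrite -gainE -/G; field; rewrite ?gt_eqF.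
rewrite -[piv A C k.+1 * _ * _]mulrA E1 (pivotS _ k.+1) (pivotS (rec_la B C) k.+1).
rewrite !rec_laE ?(ltW C0)// -/F -/G.
move: al0 be0 alF laF cross; rewrite -/F -/G ey -/y.
set al := pivot _ _; set be := pivot _ _; set N := la_common _ _ => al0 be0 alF laF cross.
have Ay0 : 0 <= A * (y / 2) by rewrite mulr_ge0//; lra.
have By0 : 0 <= B * (y / 2) by rewrite mulr_ge0//; lra.
have a0 : 0 <= 1 + A * (y / 2) by lra.
have b0 : 0 <= 1 + B * (y / 2) by lra.
have D0 : 0 < C * y - A by lra.
have S0 : 0 <= B - C * (y / 2) by rewrite ey in BC2; lra.
rewrite -(opprB B) [al * (_ * _ * (gain _ _ _ _ * _) * G)]mulrA.
have comb W kap X := @combine_bound al be N (1 + A * (y / 2)) (1 + B * (y / 2)) F G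
  (C * y - A) (B - C * (y / 2)) X (C * y - B) (gain A B C y * (C - B)) kap W
  al0 be0 (ltW N0) a0 b0 (ltW G0) D0 S0 cross.
have yk : y = 1 \/ y <= 2^-1.
  rewrite /y; case: k {E1 gainE cross al0 be0 alF laF FE ek comb F G F0 G0 Gl0 N0 N al be
    ey BC2 piv_neg CB BC y0 y1 Bhy y Ay0 By0 a0 b0 D0 S0} => [|k]; [by left|right].
  by rewrite exprS ler_piMr ?half_exp_le1 ?invr_ge0.
(* In the first case the last pivot of A is nonnegative and subtracting it leaves at most [F], hence
   the 1. In the second it is negative too; since A - C y / 2 <= h / 2 <= 1, its absolute value is
   at most [F], hence the 2. *)
have [AC|AC] := leP A (C * (y / 2)).
  apply: (comb _ 1) => //.
    rewrite mul1r lerBlDr lerDl; apply: mulr_ge0 => //.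
    by apply: mulr_ge0; rewrite ?subr_ge0//; apply: mulr_ge0; rewrite ?(ltW N0).
  have := @gain_ineq _ A B C y h h0 h1 AB Bh y0 y1 yk CB.
  by rewrite mul1r mulrA; apply; rewrite ey in BC2; lra.
apply: (comb _ 2) => //.
  rewrite mulrDl mul1r lerD2l -mulrN -mulrN opprB.
  apply: le_trans laF; rewrite mulrC; apply: ler_pM => //.
  - by apply: mulr_ge0; rewrite ?subr_ge0 ?(ltW AC)//; apply: mulr_ge0; rewrite ?(ltW N0).
  - by rewrite (ler_piMr (mulr_ge0 (ltW N0) a0))//; lra.
(* For y = 1 and y = 1/2 the assumptions on C and A contradict 3 h <= B, which is delta >= 1. *)
suff y4 : y <= 4^-1.
  have := @gain_ineq2 _ A B C y h h0 h1 AB Bh y0 y4 BC.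
  rewrite mulrA in AC; move=> /(_ AC); congr (0 <= _); ring.
case: yk => [yk|yk]; first by rewrite yk in CB AC; lra.
rewrite /y in yk AC CB BC *.
case: k {E1 gainE cross al0 be0 alF laF FE ek comb F G F0 G0 Gl0 N0 N al be
    ey BC2 piv_neg y0 y1 Bhy y Ay0 By0 a0 b0 D0 S0} yk AC CB BC => [|[|k]].
- by rewrite expr0; lra.
- by rewrite expr1; lra.
- move=> *; rewrite !exprS mulrA.
  by have := half_exp_le1 R k; have := half_exp_gt0 R k; lra.
Qed.

End RatioProduct.

(** * From Hankel forms to k-hyponormality of the shifts *)

Section ShiftMoments.
Variable R : realType.

(** Restarting at n replaces x by x 2^n; dividing each factor by x 2^(n+l) leaves 1 + B q^l over 1 +
    C q^l with q = 1/2. *)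
Lemma moment_ratio (alpha : nat -> R) (a b c x : R) (n m : nat) :
  0 < x -> 0 <= c ->
  (forall l, alpha l ^+ 2 = (x * 2 ^+ l + a) * (x * 2 ^+ l + b) / (x * 2 ^+ l + c) ^+ 2) ->
  moment alpha (n + m) = moment alpha n *
    (ratio (a / (x * 2 ^+ n)) (c / (x * 2 ^+ n)) m
     * ratio (b / (x * 2 ^+ n)) (c / (x * 2 ^+ n)) m).
Proof.
move=> x0 c0 al; rewrite /moment big_split_ord /=; congr (_ * _).
rewrite /ratio -big_split /=; apply: eq_bigr => l _; rewrite al exprD exprVn.
have n0 : 0 < 2 ^+ n :> R by rewrite exprn_gt0.
have l0 : 0 < 2 ^+ l :> R by rewrite exprn_gt0.
have xnl : 0 < x * (2 ^+ n * 2 ^+ l) by rewrite !mulr_gt0.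
by field; rewrite ?gt_eqF//= ltr_wpDr// -mulrA.
Qed.

Lemma moment_ge0 (alpha : nat -> R) n : 0 <= moment alpha n.
Proof. by apply: prodr_ge0 => i _; rewrite sqr_ge0. Qed.

Lemma psd_hankel (g : nat -> R) k (c : R) : 0 <= c ->
  (forall v, 0 <= hform g k v) -> psd (\matrix_(i < k.+1, j < k.+1) (c * g (i + j)%N)).
Proof.
move=> c0 gv; split; first by apply/matrixP => i j; rewrite !mxE addnC.
move=> x; have := gv (fun i => x (inord i) 0) => /(mulr_ge0 c0); congr (0 <= _).
rewrite /hform exchange_big /= mulr_sumr !mxE; apply: eq_bigr => j _.
rewrite !mxE mulr_sumr mulr_suml; apply: eq_bigr => i _.
by rewrite !mxE !inord_val (addnC i); ring.
Qed.

Lemma shift_k_hyponormal (delta s j k : nat) (alpha : nat -> R) :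
  (0 < delta)%N -> (0 < j)%N ->
  (forall l, alpha l ^+ 2 = (j%:R * 2 ^+ l + delta.+1%:R) * (j%:R * 2 ^+ l + (2 * delta).+1%:R)
                              / (j%:R * 2 ^+ l + (s + (2 * delta).+1)%:R) ^+ 2) ->
  k = 1%N \/ ((1 <= k)%N /\ k_range R delta s k) ->
  k_hyponormal k alpha.
Proof.
move=> d0 j0 al kk n.
have j0' : 0 < j%:R :> R by rewrite ltr0n.
have d1 : 1 <= delta%:R :> R by rewrite ler1n.
have s0 : 0 <= s%:R :> R by [].
pose x : R := j%:R * 2 ^+ n; pose A := delta.+1%:R / x; pose B := (2 * delta).+1%:R / x.
pose C := (s + (2 * delta).+1)%:R / x.
have x0 : 0 < x by rewrite mulr_gt0// exprn_gt0.
have x1 : 1 <= x.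
  by rewrite -[leLHS]mulr1 ler_pM// ?ler1n// exprn_ege1// ler1n.
(* The common scale of the parameters; the relation 2 A = B + h used below is 2 (delta + 1) = (2
   delta + 1) + 1. *)
pose h := x^-1.
have h0 : 0 < h by rewrite invr_gt0.
have h1 : h <= 1 by rewrite invf_le1.
have -> : (\matrix_(i < k.+1, j < k.+1) moment alpha (n + i + j)) =
  \matrix_(i < k.+1, j < k.+1) (moment alpha n * (ratio A C (i + j) * ratio B C (i + j))).
  apply/matrixP => i i'; rewrite !mxE -addnA (moment_ratio _ _ j0' _ al)//.
apply: (@psd_hankel (fun m => ratio A C m * ratio B C m)); first exact: moment_ge0.
move=> v.
have AE : A = (delta%:R + 1) * h by rewrite /A -natr1.
have BE : B = (2 * delta%:R + 1) * h by rewrite /B -natr1 natrM.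
have CE : C = (s%:R + 2 * delta%:R + 1) * h by rewrite /C natrD -natr1 natrM addrA.
have A0 : 0 <= A by rewrite AE mulr_ge0 ?(ltW h0)//; lra.
have B0 : 0 <= B by rewrite BE mulr_ge0 ?(ltW h0)//; lra.
have C0 : 0 <= C by rewrite CE mulr_ge0 ?(ltW h0)//; lra.
have AB : A <= B by rewrite AE BE ler_wpM2r ?(ltW h0)//; lra.
have schur k' : B <= C * 2^-1 ^+ k' ->
    0 <= hform (fun m => ratio A C m * ratio B C m) k'.+1 v.
  by move=> BC; apply: hform_ratio2_ge0 => //; exact: le_trans BC.
(* Order 1 only involves n = 0, where B <= C is s >= 0; this is why the shifts are hyponormal for
   every s. *)
have schur1 : 0 <= hform (fun m => ratio A C m * ratio B C m) 1 v.
  by apply: schur; rewrite expr0 mulr1 BE CE ler_wpM2r ?(ltW h0)//; lra.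
case: kk => [->//|[]]; case: k => // -[|k] _ //.
rewrite /k_range ge_min => /orP[].
- rewrite (_ : _ - 1 = k.+1%:Z); last by rewrite -[k.+2]addn1 PoszD addrK.
  rewrite -exprnP => H; apply: schur.
  rewrite exprVn ler_pdivlMr ?exprn_gt0// BE CE -mulrA (mulrC h) mulrA.
  by rewrite ler_wpM2r ?(ltW h0)//; lra.
(* At order k + 2 the second bound is 2^k (2 delta - 1) + 2^(k+1) - 1 = 2^k (2 delta + 1) - 1. *)
- rewrite (_ : k.+2%:Z - 1 = k.+1%:Z); last by rewrite -[k.+2]addn1 PoszD addrK.
  rewrite (_ : _ - 2 = k%:Z); last by rewrite -[k.+2]addn2 PoszD addrK.
  rewrite -!exprnP => H.
  apply: (@hform_ratio2_gain _ A B C h) => //.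
  + by rewrite AE BE; ring.
  + by rewrite BE ler_wpM2r ?(ltW h0)//; lra.
  + have e0 : 0 < 2 ^+ k :> R by rewrite exprn_gt0.
    rewrite BE CE exprVn -(ler_pM2r e0) mulrDl -!mulrA -/h mulVf ?gt_eqF// !mulr1.
    rewrite exprS in H.
    rewrite [leLHS](_ : _ = ((2 * delta%:R + 1) * 2 ^+ k + 2 * delta%:R) * h); last ring.
    by rewrite ler_wpM2r ?(ltW h0)//; lra.
Qed.

End ShiftMoments.

Import Normc.
Local Open Scope classical_set_scope.
Local Open Scope ring_scope.
Local Open Scope complex_scope.

(** * Area integrals and the inner product *)

Section ComplexIntegral.
Variable R : realType.
Local Notation C := R[i].
Local Notation cj := (@conjc R).
Local Notation T2 := (measurableTypeR R * measurableTypeR R)%type.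
Local Notation Re := (@complex.Re R).
Local Notation Im := (@complex.Im R).
Implicit Types (f g : C -> C) (a z w : C).

Lemma cReD z w : Re (z + w) = Re z + Re w. Proof. by case: z; case: w. Qed.
Lemma cImD z w : Im (z + w) = Im z + Im w. Proof. by case: z; case: w. Qed.
Lemma cReM z w : Re (z * w) = Re z * Re w - Im z * Im w.
Proof. by case: z; case: w. Qed.
Lemma cImM z w : Im (z * w) = Re z * Im w + Im z * Re w.
Proof. by case: z => a b; case: w => c d /=; rewrite addrC (mulrC b). Qed.
Lemma cReC z : Re (cj z) = Re z. Proof. by case: z. Qed.
Lemma cImC z : Im (cj z) = - Im z. Proof. by case: z. Qed.
Lemma cReN z : Re (- z) = - Re z. Proof. by case: z. Qed.
Lemma cImN z : Im (- z) = - Im z. Proof. by case: z. Qed.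

Lemma rcM (x y : R) : (x * y)%:C = x%:C * y%:C :> C. Proof. exact: rmorphM. Qed.
Lemma rcB (x y : R) : (x - y)%:C = x%:C - y%:C :> C. Proof. exact: rmorphB. Qed.
Lemma rcN (x : R) : (- x)%:C = - x%:C :> C. Proof. exact: rmorphN. Qed.
Lemma rcX (x : R) n : (x ^+ n)%:C = x%:C ^+ n :> C. Proof. exact: rmorphXn. Qed.
Lemma rcV (x : R) : (x^-1)%:C = x%:C^-1 :> C. Proof. exact: fmorphV. Qed.
Lemma rcn n : (n%:R)%:C = n%:R :> C. Proof. exact: rmorph_nat. Qed.
Lemma conjcR (x : R) : (cj (x%:C)) = x%:C :> C. Proof. exact: conjc_real. Qed.
Lemma cjK z : cj (cj z) = z. Proof. exact: conjcK. Qed.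
Lemma conjcM z w : (cj (z * w)) = (cj z) * (cj w). Proof. exact: rmorphM. Qed.
Lemma conjcD z w : (cj (z + w)) = (cj z) + (cj w). Proof. exact: rmorphD. Qed.
Lemma conjcN z : (cj (- z)) = - (cj z). Proof. exact: rmorphN. Qed.
Lemma conjcX z n : (cj (z ^+ n)) = (cj z) ^+ n. Proof. exact: rmorphXn. Qed.

Lemma normc_sqr z : normc z ^+ 2 = Re z ^+ 2 + Im z ^+ 2.
Proof. by case: z => a b /=; rewrite sqr_sqrtr// addr_ge0// sqr_ge0. Qed.

Lemma normc_ge0 z : 0 <= normc z.
Proof. by case: z => a b /=; rewrite sqrtr_ge0. Qed.

Lemma normcE z : `|z| = (normc z)%:C.
Proof. by []. Qed.

Lemma abs_Re_le z : `|Re z| <= normc z.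
Proof.
rewrite -(@ler_pXn2r _ 2)// ?nnegrE ?normc_ge0//.
by rewrite normc_sqr real_normK ?num_real// lerDl sqr_ge0.
Qed.

Lemma abs_Im_le z : `|Im z| <= normc z.
Proof.
rewrite -(@ler_pXn2r _ 2)// ?nnegrE ?normc_ge0//.
by rewrite normc_sqr real_normK ?num_real// lerDr sqr_ge0.
Qed.

Lemma normcD_le z w : normc (z + w) <= normc z + normc w.
Proof. exact: le_normcD. Qed.

Lemma normcNR z : normc (- z) = normc z. Proof. exact: normcN. Qed.

Lemma normcJR z : normc (cj z) = normc z.
Proof. by case: z => a b /=; rewrite sqrrN. Qed.

Lemma normcX z n : normc (z ^+ n) = normc z ^+ n.
Proof. by elim: n => [|n IH]; rewrite ?expr0 ?normc1// !exprS normcM IH. Qed.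

Lemma diskE (p : T2) : disk2 p <-> p.1 ^+ 2 + p.2 ^+ 2 < 1.
Proof.
rewrite /disk2 /disk /= ltcE /= eqxx /=.
rewrite -{1}(sqrtr1 R) ltr_sqrt//.
Qed.

Lemma measurable_coord1 (D : set T2) : measurable_fun D (fst : T2 -> R).
Proof. exact: measurable_funS measurable_fst. Qed.
Lemma measurable_coord2 (D : set T2) : measurable_fun D (snd : T2 -> R).
Proof. exact: measurable_funS measurable_snd. Qed.

Definition cre f (p : T2) : R := Re (f (cplx p)).
Definition cim f (p : T2) : R := Im (f (cplx p)).

Definition cmeas (D : set T2) f := measurable_fun D (cre f) /\ measurable_fun D (cim f).
Definition cint (D : set T2) f :=
  (@area R).-integrable D (EFin \o cre f) /\ (@area R).-integrable D (EFin \o cim f).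
Definition cI (D : set T2) f : C :=
  Rintegral (@area R) D (cre f) +i* Rintegral (@area R) D (cim f).

Definition drho (rho : R) : set T2 := [set p | p.1 ^+ 2 + p.2 ^+ 2 < rho ^+ 2].

Lemma drho1 : drho 1 = @disk2 R.
Proof. by apply/seteqP; split => p; rewrite /drho /= expr1n => /diskE. Qed.

Lemma measurable_drho rho : measurable (drho rho).
Proof.
have mf : measurable_fun setT (fun p : T2 => p.1 ^+ 2 + p.2 ^+ 2 : R).
  by apply: measurable_funD; apply: measurable_funX;
    [exact: measurable_coord1|exact: measurable_coord2].
rewrite (_ : drho rho = setT `&` (fun p : T2 => p.1 ^+ 2 + p.2 ^+ 2 : R) @^-1` `]-oo, rho ^+ 2[).
  exact: mf.
by rewrite setTI; apply/seteqP; split => p /=; rewrite in_itv.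
Qed.

Lemma measurable_disk2 : measurable (@disk2 R : set T2).
Proof. by rewrite -drho1; exact: measurable_drho. Qed.

Lemma area_drho_fin rho : (area (drho rho) < +oo)%E.
Proof.
have sub : drho rho `<=` `[- `|rho|, `|rho|] `*` `[- `|rho|, `|rho|].
  move=> p; rewrite /drho /= => h; rewrite !in_itv /= -!ler_norml.
  by split; rewrite -(@ler_pXn2r _ 2)// ?nnegrE// !real_normK ?num_real//;
    have := sqr_ge0 p.1; have := sqr_ge0 p.2; lra.
have m1 : measurable (`[- `|rho|, `|rho|] : set (measurableTypeR R)) by exact: measurable_itv.
apply: (@le_lt_trans _ _ (area (`[- `|rho|, `|rho|] `*` `[- `|rho|, `|rho|] : set T2))).
  apply: le_measure; rewrite ?inE//; first exact: measurable_drho.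
  exact: measurableX.
rewrite /area product_measure1E//.
pose I := `[- `|rho|, `|rho|]; have E : (@lebesgue_measure R [set` I] < +oo)%E.
  by rewrite lebesgue_measure_itv /=; case: ifP => _; rewrite ?ltry// -EFinB ltry.
by apply: lte_mul_pinfty => //; rewrite ge0_fin_numE.
Qed.

Lemma cmeas_add D f g : measurable D -> cmeas D f -> cmeas D g ->
  cmeas D (fun z => f z + g z).
Proof.
move=> mD [f1 f2] [g1 g2]; rewrite /cmeas /cre /cim.
by split; [under eq_fun do rewrite cReD|under eq_fun do rewrite cImD];
  exact: measurable_funD.
Qed.

Lemma cmeas_mul D f g : measurable D -> cmeas D f -> cmeas D g ->
  cmeas D (fun z => f z * g z).
Proof.
move=> mD [f1 f2] [g1 g2]; rewrite /cmeas /cre /cim.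
split; [under eq_fun do rewrite cReM|under eq_fun do rewrite cImM].
- by apply: measurable_funB; exact: measurable_funM.
- by apply: measurable_funD; exact: measurable_funM.
Qed.

Lemma cmeas_conj D f : measurable D -> cmeas D f -> cmeas D (fun z => (cj (f z))).
Proof.
move=> mD [f1 f2]; rewrite /cmeas /cre /cim.
split; [under eq_fun do rewrite cReC|under eq_fun do rewrite cImC] => //.
exact: measurableT_comp.
Qed.

Lemma cmeas_cst D a : cmeas D (fun=> a).
Proof. by split; exact: measurable_cst. Qed.

Lemma cmeas_id D : measurable D -> cmeas D id.
Proof. by move=> mD; split; [exact: measurable_coord1|exact: measurable_coord2]. Qed.

Lemma cmeas_exp D f n : measurable D -> cmeas D f -> cmeas D (fun z => f z ^+ n).
Proof.
move=> mD mf; elim: n => [|n IH]; first by under eq_fun do rewrite expr0; exact: cmeas_cst.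
by under eq_fun do rewrite exprS; exact: cmeas_mul.
Qed.

Lemma cmeas_eq D f g : measurable D -> (forall p, D p -> f (cplx p) = g (cplx p)) -> cmeas D f -> cmeas D g.
Proof.
move=> mD fg [f1 f2]; split; [apply: eq_measurable_fun f1|apply: eq_measurable_fun f2] => p;
  by rewrite inE => Dp; rewrite /cre /cim fg.
Qed.

Lemma cint_dom D f (g : T2 -> R) : measurable D -> cmeas D f ->
  (@area R).-integrable D (EFin \o g) ->
  (forall p, D p -> normc (f (cplx p)) <= g p) -> cint D f.
Proof.
move=> mD [f1 f2] ig fg.
split; apply: le_integrable ig => //; try exact/measurable_EFinP;
  move=> p Dp /=; rewrite lee_fin.
- by apply: le_trans (abs_Re_le _) _; apply: le_trans (fg _ Dp) (ler_norm _).
- by apply: le_trans (abs_Im_le _) _; apply: le_trans (fg _ Dp) (ler_norm _).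
Qed.

Lemma cint_add D f g : measurable D -> cint D f -> cint D g -> cint D (fun z => f z + g z).
Proof.
move=> mD [f1 f2] [g1 g2]; split.
- rewrite (_ : _ \o _ = ((EFin \o cre f) \+ (EFin \o cre g))%E); first exact: integrableD.
  by apply/funext => p /=; rewrite /cre cReD.
- rewrite (_ : _ \o _ = ((EFin \o cim f) \+ (EFin \o cim g))%E); first exact: integrableD.
  by apply/funext => p /=; rewrite /cim cImD.
Qed.

Lemma cI_add D f g : measurable D -> cint D f -> cint D g ->
  cI D (fun z => f z + g z) = cI D f + cI D g.
Proof.
move=> mD [f1 f2] [g1 g2]; rewrite /cI; apply/eqP; rewrite eq_complex /= -!RintegralD//.
by apply/andP; split; apply/eqP; apply: eq_Rintegral => p _; rewrite /cre /cim ?cReD ?cImD.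
Qed.

Lemma cint_scale D a f : measurable D -> cint D f -> cint D (fun z => a * f z).
Proof.
move=> mD [f1 f2].
have h (c d : R) : (@area R).-integrable D (EFin \o (fun p => c * cre f p + d * cim f p)).
  rewrite (_ : _ \o _ = ((fun p => c%:E * (cre f p)%:E) \+ (fun p => d%:E * (cim f p)%:E))%E)//.
  by apply: integrableD => //; exact: integrableZl.
split.
- rewrite (_ : cre _ = (fun p => Re a * cre f p + (- Im a) * cim f p)); first exact: h.
  by apply/funext => p; rewrite /cre cReM mulNr.
- rewrite (_ : cim _ = (fun p => Im a * cre f p + Re a * cim f p)); first exact: h.
  by apply/funext => p; rewrite /cim cImM addrC.
Qed.

Lemma cI_scale D a f : measurable D -> cint D f -> cI D (fun z => a * f z) = a * cI D f.
Proof.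
move=> mD [f1 f2].
have h (c d : R) : Rintegral (@area R) D (fun p => c * cre f p + d * cim f p) =
   c * Rintegral (@area R) D (cre f) + d * Rintegral (@area R) D (cim f).
  rewrite RintegralD ?RintegralZl//.
  - by rewrite (_ : _ \o _ = (fun p => c%:E * (cre f p)%:E)%E)//; exact: integrableZl.
  - by rewrite (_ : _ \o _ = (fun p => d%:E * (cim f p)%:E)%E)//; exact: integrableZl.
apply/eqP; rewrite eq_complex cReM cImM /=; apply/andP; split; apply/eqP.
- rewrite -mulNr -h; apply: eq_Rintegral => p _; by rewrite /cre cReM mulNr.
- rewrite addrC -h; apply: eq_Rintegral => p _; by rewrite /cim cImM addrC.
Qed.

Lemma cI_conj D f : measurable D -> cint D f -> cI D (fun z => (cj (f z))) = (cj (cI D f)).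
Proof.
move=> mD [f1 f2]; apply/eqP; rewrite eq_complex /=; apply/andP; split; apply/eqP.
- by apply: eq_Rintegral => p _; rewrite /cre cReC.
- rewrite -mulN1r -RintegralZl//; apply: eq_Rintegral => p _; by rewrite /cim cImC mulN1r.
Qed.

Lemma cI_eq D f g : (forall p, D p -> f (cplx p) = g (cplx p)) -> cI D f = cI D g.
Proof.
move=> fg; rewrite /cI; congr (_ +i* _); apply: eq_Rintegral => p;
  by rewrite inE => Dp; rewrite /cre /cim fg.
Qed.

Lemma cint_eq D f g : measurable D -> (forall p, D p -> f (cplx p) = g (cplx p)) -> cint D f -> cint D g.
Proof.
move=> mD fg [f1 f2]; split; [apply: eq_integrable f1|apply: eq_integrable f2] => // p;
  by rewrite inE => Dp /=; rewrite /cre /cim fg.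
Qed.

Lemma cint_cst D a : measurable D -> (area D < +oo)%E -> cint D (fun=> a).
Proof.
move=> mD Dfin.
by split; apply: (measurable_bounded_integrable (f := fun=> _)) => //;
  exact: bounded_cst.
Qed.

End ComplexIntegral.

(** * Inner product and norm of square-integrable functions *)

Section L2Space.
Variable R : realType.
Local Notation C := R[i].
Local Notation cj := (@conjc R).
Local Notation T2 := (measurableTypeR R * measurableTypeR R)%type.
Local Notation Re := (@complex.Re R).
Local Notation Im := (@complex.Im R).
Local Notation D := (@disk2 R : set T2).
Implicit Types (f g h : C -> C) (a z w : C).
Local Notation mD := (@measurable_disk2 R).

Lemma L2_meas f : L2 f -> cmeas D f. Proof. by case. Qed.

Lemma L2_sqr_integrable f : L2 f ->
  (@area R).-integrable D (EFin \o (fun p => normc (f (cplx p)) ^+ 2)).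
Proof. by case=> _ _ _; under eq_fun do rewrite -normc_sqr. Qed.

Lemma measurable_normc2 f : cmeas D f -> measurable_fun D (fun p => normc (f (cplx p)) ^+ 2).
Proof.
move=> [m1 m2]; rewrite (_ : (fun _ => _) = (fun p => cre f p ^+ 2 + cim f p ^+ 2)).
  by apply: measurable_funD; exact: measurable_funX.
by apply/funext => p; rewrite normc_sqr.
Qed.

Lemma L2P f : on_disk f -> cmeas D f ->
  (@area R).-integrable D (EFin \o (fun p => normc (f (cplx p)) ^+ 2)) -> L2 f.
Proof.
move=> od [f1 f2] fi; split=> //.
by under eq_fun do rewrite -normc_sqr.
Qed.

Lemma integrable_lincomb (c d : R) (u v : T2 -> R) :
  (@area R).-integrable D (EFin \o u) -> (@area R).-integrable D (EFin \o v) ->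
  (@area R).-integrable D (EFin \o (fun p => c * u p + d * v p)).
Proof.
move=> iu iv.
rewrite (_ : _ \o _ = ((fun p => c%:E * (u p)%:E) \+ (fun p => d%:E * (v p)%:E))%E)//.
by apply: integrableD; [exact: mD|apply: integrableZl => //; exact: mD|
  apply: integrableZl => //; exact: mD].
Qed.

Lemma L2_cint f g : L2 f -> L2 g -> cint D (fun z => f z * (cj (g z))).
Proof.
move=> Lf Lg.
have ig := integrable_lincomb 1 1 (L2_sqr_integrable Lf) (L2_sqr_integrable Lg).
apply: cint_dom ig _; first exact: mD.
  by apply: cmeas_mul; [exact: mD|exact: L2_meas|apply: cmeas_conj; [exact: mD|exact: L2_meas]].
move=> p _ /=; rewrite normcM normcJR !mul1r.
have := normc_ge0 (f (cplx p)); have := normc_ge0 (g (cplx p)).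
have := sqr_ge0 (normc (f (cplx p)) - normc (g (cplx p))); nra.
Qed.

Lemma L2_lin a f g : L2 f -> L2 g -> L2 (a *: f + g).
Proof.
move=> Lf Lg; apply: L2P.
- case: Lf => of1 _ _ _; case: Lg => og _ _ _ z Dz.
  by rewrite -[LHS]/(a * f z + g z) of1// og// mulr0 addr0.
- apply: cmeas_add; [exact: mD| |exact: L2_meas].
  by apply: cmeas_mul; [exact: mD|exact: cmeas_cst|exact: L2_meas].
- have ig := integrable_lincomb (2 * normc a ^+ 2) 2 (L2_sqr_integrable Lf) (L2_sqr_integrable Lg).
  apply: le_integrable ig; first exact: mD.
    apply/measurable_EFinP; apply: measurable_normc2.
    apply: cmeas_add; [exact: mD| |exact: L2_meas].
    by apply: cmeas_mul; [exact: mD|exact: cmeas_cst|exact: L2_meas].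
  move=> p _ /=; rewrite lee_fin -[X in normc X]/(a * f (cplx p) + g (cplx p)).
  rewrite ger0_norm ?sqr_ge0// ger0_norm; last by rewrite addr_ge0// mulr_ge0 ?sqr_ge0// mulr_ge0 ?sqr_ge0.
  have := le_normcD (a * f (cplx p)) (g (cplx p)); rewrite normcM.
  have := normc_ge0 (a * f (cplx p) + g (cplx p)).
  have := mulr_ge0 (normc_ge0 a) (normc_ge0 (f (cplx p))); have := normc_ge0 (g (cplx p)).
  have := sqr_ge0 (normc a * normc (f (cplx p)) - normc (g (cplx p))).
  set x := normc (_ + _); set y := normc a * _; set z := normc (g _) => h1 h2 h3 h4 h5.
  rewrite -mulrA -exprMn -/y.
  have : x ^+ 2 <= (y + z) ^+ 2 by rewrite ler_pXn2r// nnegrE addr_ge0.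
  nra.
Qed.

Lemma L20 : L2 (0 : C -> C).
Proof.
apply: L2P; [by []|exact: cmeas_cst|].
rewrite (_ : _ \o _ = cst 0%E); first by apply: integrable0; exact: mD.
by apply/funext => p /=; rewrite expr0n /= addr0 sqrtr0 expr0n.
Qed.

Lemma L2_mul f phi : L2 f -> cmeas D phi -> (forall p, D p -> normc (phi (cplx p)) <= 1) ->
  L2 (fun z => phi z * f z).
Proof.
move=> Lf mphi phi1.
have mf : cmeas D (fun z => phi z * f z) by apply: cmeas_mul; [exact: mD| |exact: L2_meas].
apply: L2P => //.
  by case: Lf => of1 _ _ _ z Dz; rewrite of1// mulr0.
apply: le_integrable (L2_sqr_integrable Lf); first exact: mD.
  by apply/measurable_EFinP; exact: (measurable_normc2 mf).
move=> p Dp /=; rewrite lee_fin !ger0_norm ?sqr_ge0// normcM exprMn.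
by rewrite ler_piMl ?sqr_ge0// exprn_ile1 ?normc_ge0// phi1.
Qed.

Lemma ipE f g : ip f g = (pi^-1)%:C * cI D (fun z => f z * (cj (g z))).
Proof. by []. Qed.

Lemma ip_lin a f g h : L2 f -> L2 g -> L2 h -> ip (a *: f + g) h = a * ip f h + ip g h.
Proof.
move=> Lf Lg Lh; rewrite !ipE mulrCA -mulrDr; congr (_ * _).
rewrite -cI_scale; [|exact: mD|exact: L2_cint].
rewrite -cI_add; [|exact: mD| |exact: L2_cint]; last first.
  by apply: cint_scale; [exact: mD|exact: L2_cint].
by apply: cI_eq => p _; rewrite -[X in X * _]/(a * f (cplx p) + g (cplx p)) mulrDl mulrA.
Qed.

Lemma ip_conj f g : L2 f -> L2 g -> ip g f = (cj (ip f g)).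
Proof.
move=> Lf Lg; rewrite !ipE conjcM. rewrite conjcR -cI_conj; [|exact: mD|exact: L2_cint].
by congr (_ * _); apply: cI_eq => p _; rewrite conjcM cjK mulrC.
Qed.

Lemma ip0l h : L2 h -> ip 0 h = 0.
Proof.
move=> Lh; have := ip_lin 1 L20 L20 Lh; rewrite scaler0 add0r mul1r => /eqP.
by rewrite -subr_eq subrr eq_sym => /eqP.
Qed.

Lemma ipDl f g h : L2 f -> L2 g -> L2 h -> ip (f + g) h = ip f h + ip g h.
Proof. by move=> Lf Lg Lh; rewrite -{1}(scale1r f) ip_lin// mul1r. Qed.

Lemma L2Z a f : L2 f -> L2 (a *: f).
Proof. by move=> Lf; rewrite -[_ *: _]addr0; apply: L2_lin => //; exact: L20. Qed.

Lemma L2D f g : L2 f -> L2 g -> L2 (f + g).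
Proof. by move=> Lf Lg; rewrite -(scale1r f); exact: L2_lin. Qed.

Lemma ipZl a f h : L2 f -> L2 h -> ip (a *: f) h = a * ip f h.
Proof.
by move=> Lf Lh; rewrite -[_ *: _]addr0 ip_lin ?ip0l ?addr0//; exact: L20.
Qed.

Lemma L2N f : L2 f -> L2 (- f).
Proof. by move=> Lf; rewrite -scaleN1r; exact: L2Z. Qed.

Lemma ipBl f g h : L2 f -> L2 g -> L2 h -> ip (f - g) h = ip f h - ip g h.
Proof.
move=> Lf Lg Lh; rewrite ipDl//; last exact: L2N.
by rewrite -scaleN1r ipZl// mulN1r.
Qed.

Lemma ipZr a f h : L2 f -> L2 h -> ip h (a *: f) = (cj a) * ip h f.
Proof. by move=> Lf Lh; rewrite ip_conj//; [rewrite ipZl// conjcM -ip_conj|exact: L2Z]. Qed.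

Lemma ipDr f g h : L2 f -> L2 g -> L2 h -> ip h (f + g) = ip h f + ip h g.
Proof.
by move=> Lf Lg Lh; rewrite ip_conj//; [rewrite ipDl// conjcD -!ip_conj|exact: L2D].
Qed.

Lemma ip_self_int f : ip f f = (pi^-1 * Rintegral (@area R) D (fun p => normc (f (cplx p)) ^+ 2))%:C.
Proof.
rewrite ipE rmorphM /=; congr (_ * _); apply/eqP; rewrite eq_complex /=.
have h p : f (cplx p) * (cj (f (cplx p))) = (normc (f (cplx p)) ^+ 2)%:C.
  by rewrite normc_sqr; case: (f _) => x y /=; apply/eqP; rewrite eq_complex /=;
    apply/andP; split; apply/eqP; ring.
apply/andP; split; apply/eqP.
  by apply: eq_Rintegral => p _; rewrite /cre h.
rewrite -[RHS](mul0r (fine (area D))) -Rintegral_cst; last exact: mD.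
by apply: eq_Rintegral => p _; rewrite /cim h.
Qed.

Lemma nrm_sqr_int f : nrm f ^+ 2 = pi^-1 * Rintegral (@area R) D (fun p => normc (f (cplx p)) ^+ 2).
Proof.
rewrite /nrm ip_self_int /= sqr_sqrtr// mulr_ge0 ?invr_ge0 ?pi_ge0//.
by apply: Rintegral_ge0 => p _; exact: sqr_ge0.
Qed.

Lemma ip_self f : ip f f = (nrm f ^+ 2)%:C.
Proof. by rewrite nrm_sqr_int ip_self_int. Qed.

Lemma nrm_ge0 f : 0 <= nrm f. Proof. exact: sqrtr_ge0. Qed.

Lemma normcZ_sqr z : (normc z ^+ 2)%:C = z * (cj z).
Proof.
by rewrite normc_sqr; case: z => x y /=; apply/eqP; rewrite eq_complex /=;
  apply/andP; split; apply/eqP; ring.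
Qed.

Lemma pythagoras f g : L2 f -> L2 g -> ip f g = 0 -> nrm (f + g) ^+ 2 = nrm f ^+ 2 + nrm g ^+ 2.
Proof.
move=> Lf Lg fg; apply: complexI; rewrite rmorphD /= -!ip_self//.
have gf : ip g f = 0 by rewrite ip_conj// fg conjc0.
by rewrite ipDl ?ipDr ?fg ?gf ?addr0 ?add0r//; exact: L2D.
Qed.

Lemma nrmZ a f : L2 f -> nrm (a *: f) = normc a * nrm f.
Proof.
move=> Lf; apply/eqP; rewrite -(@eqrXn2 _ 2)// ?mulr_ge0 ?nrm_ge0 ?normc_ge0//; apply/eqP.
apply: complexI; rewrite -ip_self.
rewrite ipZl ?ipZr//; last exact: L2Z.
by rewrite mulrA -normcZ_sqr ip_self// -rcM -exprMn.
Qed.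

Lemma nrm_sub_sqr a b f g : L2 f -> L2 g ->
  (nrm (a *: f + b *: g) ^+ 2)%:C = a * (cj a) * (nrm f ^+ 2)%:C + b * (cj b) * (nrm g ^+ 2)%:C
     + (a * (cj b) * ip f g + (cj (a * (cj b) * ip f g))).
Proof.
move=> Lf Lg; have La := L2Z a Lf; have Lb := L2Z b Lg.
rewrite -!ip_self//.
rewrite ipDl ?ipDr//; last exact: L2D.
rewrite !ipZl ?ipZr//.
by rewrite (ip_conj Lf Lg); move: (ip f g) => u; rewrite !conjcM cjK; ring.
Qed.

Let cauchy_schwarz_nz f g : L2 f -> L2 g -> nrm g != 0 -> normc (ip f g) <= nrm f * nrm g.
Proof.
move=> Lf Lg g0.
have : 0 <= nrm ((nrm g ^+ 2)%:C *: f + (- ip f g) *: g) ^+ 2 by exact: sqr_ge0.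
rewrite -lecR nrm_sub_sqr// conjcN conjcR.
rewrite (_ : _ + _ = (nrm g ^+ 2 * ((nrm f * nrm g) ^+ 2 - normc (ip f g) ^+ 2))%:C).
  rewrite lecR pmulr_rge0; last by rewrite exprn_gt0// lt_neqAle eq_sym g0 nrm_ge0.
  by rewrite subr_ge0 ler_pXn2r// ?nnegrE ?mulr_ge0 ?nrm_ge0 ?normc_ge0.
rewrite rcM rcB normcZ_sqr; move: (ip f g) (nrm f) (nrm g) => u a b.
by rewrite !(conjcM, conjcN, conjcR) cjK exprMn rcM !rcX; ring.
Qed.

Lemma normc_ip_sym f g : L2 f -> L2 g -> normc (ip g f) = normc (ip f g).
Proof. by move=> Lf Lg; rewrite (ip_conj Lf Lg) normcJR. Qed.

(** Elements of [L2] are functions and not classes, so a norm can vanish for a nonzero g. If both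
    norms vanish, the vector f - <f, g> g has squared norm -2 |<f, g>|^2, which forces <f, g> =
    0. *)
Lemma cauchy_schwarz f g : L2 f -> L2 g -> normc (ip f g) <= nrm f * nrm g.
Proof.
move=> Lf Lg; have [g0|g0] := eqVneq (nrm g) 0; last exact: cauchy_schwarz_nz.
have [f0|f0] := eqVneq (nrm f) 0; last first.
  by rewrite -normc_ip_sym// mulrC; exact: cauchy_schwarz_nz.
have : 0 <= nrm (1 *: f + (- ip f g) *: g) ^+ 2 by exact: sqr_ge0.
rewrite -lecR nrm_sub_sqr// f0 g0 (_ : (0 ^+ 2)%:C = 0 :> C) ?mulr0 ?add0r; last by rewrite expr0n.
rewrite (_ : _ + _ = (- (2 * normc (ip f g) ^+ 2))%:C).
  rewrite lecR oppr_ge0 pmulr_rle0// => h.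
  by rewrite -(@ler_pXn2r _ 2)// ?nnegrE ?normc_ge0// expr0n.
rewrite rcN rcM normcZ_sqr rcn; move: (ip f g) => u.
by rewrite !(conjcM, conjcN, conjcR, conjc1) cjK; ring.
Qed.

Lemma nrm0 : nrm (0 : C -> C) = 0.
Proof. by rewrite -(scale0r (0 : C -> C)) nrmZ ?normc0 ?mul0r//; exact: L20. 
Qed.

End L2Space.

(** * Green's formula on closed disks of radius less than 1 *)

Section Green.
Variable R : realType.
Local Notation T2 := (measurableTypeR R * measurableTypeR R)%type.
Local Notation D := (@disk2 R).
Local Notation leb := (@lebesgue_measure R).
Implicit Types (u v w : R * R -> R).

Lemma ball2 (p q : R * R) e : ball p e q <-> `|p.1 - q.1| < e /\ `|p.2 - q.2| < e.
Proof. by []. Qed.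

(** The measurable sets of the plane are those of the product sigma-algebra; an open set belongs to
    it as a countable union of boxes with rational corners. *)
Lemma open_measurable2 (A : set (R * R)) : open A -> measurable (A : set T2).
Proof.
move=> oA.
pose box (q : (rat * rat) * (rat * rat)) : set T2 :=
  `]ratr q.1.1, ratr q.1.2[%classic `*` `]ratr q.2.1, ratr q.2.2[%classic.
have -> : A = \bigcup_q (if `[< box q `<=` A >] then box q else set0).
  apply/seteqP; split; last first.
    by move=> p [q _]; case: asboolP => // sub /sub.
  move=> p Ap; have /nbhs_ballP[e /= e0 eA] := open_nbhs_nbhs (conj oA Ap).
  have r1 (x : R) : x - e < x by lra.
  have r2 (x : R) : x < x + e by lra.
  have [a ] := rat_in_itvoo (r1 p.1); rewrite in_itv /= => /andP[a1 a2].
  have [b ] := rat_in_itvoo (r2 p.1); rewrite in_itv /= => /andP[b1 b2].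
  have [c ] := rat_in_itvoo (r1 p.2); rewrite in_itv /= => /andP[c1 c2].
  have [d ] := rat_in_itvoo (r2 p.2); rewrite in_itv /= => /andP[d1 d2].
  exists ((a, b), (c, d)) => //; rewrite asboolT; first by split; rewrite /= in_itv /=; apply/andP.
  move=> q [] /=; rewrite !in_itv /= => /andP[h1 h2] /andP[h3 h4]; apply: eA.
  by apply/ball2; rewrite !ltr_norml; split; apply/andP; split; lra.
apply: countable_bigcupT_measurable; first exact: countableP.
move=> q; case: asboolP => // _.
by apply: measurableX; exact: measurable_itv.
Qed.

Lemma continuous_measurable2 (U : set (R * R)) u : open U ->
  (forall p, U p -> {for p, continuous u}) -> measurable_fun (U : set T2) (u : T2 -> R).
Proof.
move=> oU cu; apply: (measurability _ (RGenOInfty.measurableE R)).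
move=> _ [_ [x ->] <-]; apply: open_measurable2.
rewrite openE => p [Up /=]; rewrite in_itv /= andbT => xu.
have h1 : \forall q \near p, U q by apply: open_nbhs_nbhs.
have h2 : \forall q \near p, x < u q by move: (cu p Up) => /cvgr_gt /(_ _ xu).
rewrite /interior; apply: filterS2 h1 h2 => q Uq uq; split => //.
by rewrite /= in_itv /= andbT.
Qed.

(** Continuous differentiability on the disk, with the partial derivatives carried as data so that
    sums and products yield explicit formulas. *)
Definition RC1 u ux uy := forall p, D p ->
  [/\ is_derive p.1 1 (fun t => u (t, p.2)) (ux p),
      is_derive p.2 1 (fun t => u (p.1, t)) (uy p),
      {for p, continuous u}, {for p, continuous ux} & {for p, continuous uy}].

Lemma RC1_add u ux uy v vx vy : RC1 u ux uy -> RC1 v vx vy ->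
  RC1 (fun p => u p + v p) (fun p => ux p + vx p) (fun p => uy p + vy p).
Proof.
move=> hu hv p Dp; have [u1 u2 u3 u4 u5] := hu p Dp; have [v1 v2 v3 v4 v5] := hv p Dp.
split; [exact: is_deriveD|exact: is_deriveD| | |]; exact: cvgD.
Qed.

Lemma RC1_mul u ux uy v vx vy : RC1 u ux uy -> RC1 v vx vy ->
  RC1 (fun p => u p * v p) (fun p => ux p * v p + u p * vx p) (fun p => uy p * v p + u p * vy p).
Proof.
move=> hu hv p Dp; have [u1 u2 u3 u4 u5] := hu p Dp; have [v1 v2 v3 v4 v5] := hv p Dp.
split.
- apply: (is_derive_eq (is_deriveM u1 v1)).
  by rewrite -surjective_pairing addrC; congr (_ + _); exact: mulrC.
- apply: (is_derive_eq (is_deriveM u2 v2)).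
  by rewrite -surjective_pairing addrC; congr (_ + _); exact: mulrC.
- exact: cvgM.
- by apply: cvgD; exact: cvgM.
- by apply: cvgD; exact: cvgM.
Qed.

Lemma RC1_cst c : RC1 (fun=> c) (fun=> 0) (fun=> 0).
Proof.
by move=> p Dp; split; [exact: is_derive_cst|exact: is_derive_cst| | |]; exact: cvg_cst.
Qed.

Lemma RC1_fst : RC1 fst (fun=> 1) (fun=> 0).
Proof.
move=> p Dp; split; [exact: is_derive_id|exact: is_derive_cst| exact: cvg_fst| |]; exact: cvg_cst.
Qed.

Lemma RC1_snd : RC1 snd (fun=> 0) (fun=> 1).
Proof.
move=> p Dp; split; [exact: is_derive_cst|exact: is_derive_id| exact: cvg_snd| |]; exact: cvg_cst.
Qed.

(** Closed disks are used because they are compact: a function continuous on the open unit disk is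
    bounded on them, hence integrable. *)
Definition dcl (rho : R) : set T2 := [set p | p.1 ^+ 2 + p.2 ^+ 2 <= rho ^+ 2].

Lemma dcl_sub rho : 0 <= rho -> rho < 1 -> dcl rho `<=` D.
Proof.
move=> r0 r1 p; rewrite /dcl /= => h; apply/diskE; apply: (le_lt_trans h).
by rewrite expr_lt1.
Qed.

Lemma measurable_dcl rho : measurable (dcl rho).
Proof.
have mf : measurable_fun setT (fun p : T2 => p.1 ^+ 2 + p.2 ^+ 2 : R).
  by apply: measurable_funD; apply: measurable_funX;
    [exact: measurable_coord1|exact: measurable_coord2].
rewrite (_ : dcl rho = setT `&` (fun p : T2 => p.1 ^+ 2 + p.2 ^+ 2 : R) @^-1` `]-oo, rho ^+ 2]).
  exact: mf.
by rewrite setTI; apply/seteqP; split => p /=; rewrite in_itv.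
Qed.

Lemma compact_dcl rho : compact (dcl rho : set (R * R)).
Proof.
apply: (@subclosed_compact _ _ (`[- `|rho|, `|rho|] `*` `[- `|rho|, `|rho|])).
- have cf : continuous (fun p : R * R => p.1 ^+ 2 + p.2 ^+ 2 : R).
    move=> p; apply: cvgD; rewrite /expr2 -/(_ ^+ 2); under eq_fun do rewrite expr2; apply: cvgM;
    by [exact: cvg_fst|exact: cvg_snd].
  have : closed [set x : R | x <= rho ^+ 2] by exact: closed_le.
  by move/(closed_comp (fun p _ => cf p)).
- by apply: compact_setX; exact: segment_compact.
- move=> p; rewrite /dcl /= => h; rewrite !in_itv /= -!ler_norml.
  by split; rewrite -(@ler_pXn2r _ 2)// ?nnegrE// !real_normK ?num_real//;
    have := sqr_ge0 p.1; have := sqr_ge0 p.2; lra.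
Qed.

Lemma continuous_sqr_sum : continuous (fun p : R * R => p.1 ^+ 2 + p.2 ^+ 2 : R).
Proof.
move=> p; apply: cvgD; under eq_fun do rewrite expr2; apply: cvgM;
  by [exact: cvg_fst|exact: cvg_snd].
Qed.

Lemma open_disk2 : open (D : set (R * R)).
Proof.
have := open_comp (fun p _ => @continuous_sqr_sum p) (@open_lt R 1).
by congr open; apply/seteqP; split => p /=; rewrite diskE.
Qed.

Lemma continuous_dcl_integrable rho w : 0 <= rho -> rho < 1 ->
  (forall p, D p -> {for p, continuous w}) -> (@area R).-integrable (dcl rho) (EFin \o w).
Proof.
move=> r0 r1 cw; apply: measurable_bounded_integrable.
- exact: measurable_dcl.
- apply: le_lt_trans (area_drho_fin 1); apply: le_measure; rewrite ?inE.
  + exact: measurable_dcl.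
  + exact: measurable_drho.
  + by rewrite drho1; exact: dcl_sub.
- apply: (@measurable_funS _ _ _ _ D); [exact: measurable_disk2|exact: dcl_sub|].
  by apply: continuous_measurable2 => //; exact: open_disk2.
- have : compact (w @` dcl rho).
    apply: continuous_compact; last exact: compact_dcl.
    by apply: continuous_in_subspaceT => p; rewrite inE => /(dcl_sub r0 r1) /cw.
  move=> /compact_bounded [M [Mr hM]]; exists M; split => // x Mx p Dp.
  by apply: (hM x Mx); exists p.
Qed.

Lemma slice1 w (x y : R) : {for (x, y), continuous w} -> {for x, continuous (fun t => w (t, y))}.
Proof.
move=> cw; have h : (t, y) @[t --> x] --> (x, y).
  by apply: (@cvg_pair _ _ _ _ (nbhs x) (nbhs y)); [exact: cvg_id|exact: cvg_cst].
exact: (cvg_comp _ _ h cw).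
Qed.

Lemma slice2 w (x y : R) : {for (x, y), continuous w} -> {for y, continuous (fun t => w (x, t))}.
Proof.
move=> cw; have h : (x, t) @[t --> y] --> (x, y).
  by apply: (@cvg_pair _ _ _ _ (nbhs x) (nbhs y)); [exact: cvg_cst|exact: cvg_id].
exact: (cvg_comp _ _ h cw).
Qed.

Lemma slice_integral (rho z : R) (f F : R -> R) : 0 <= rho -> rho < 1 ->
  (forall x, x ^+ 2 + z ^+ 2 < 1 -> is_derive x 1 F (f x) /\ {for x, continuous f}) ->
  (forall x, x ^+ 2 + z ^+ 2 = rho ^+ 2 -> F x = 0) ->
  (\int[leb]_(x in [set x | (x ^+ 2 + z ^+ 2 <= rho ^+ 2)%R]) (f x)%:E = 0)%E.
Proof.
move=> r0 r1 h F0; have r21 : rho ^+ 2 < 1 by rewrite expr_lt1.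
have [zr|zr] := leP (z ^+ 2) (rho ^+ 2); last first.
  rewrite (_ : [set _ | _] = set0) ?integral_set0//.
  apply/seteqP; split => // x /=; have := sqr_ge0 x; lra.
pose s := Num.sqrt (rho ^+ 2 - z ^+ 2).
have s0 : 0 <= s by exact: sqrtr_ge0.
have s2 : s ^+ 2 = rho ^+ 2 - z ^+ 2 by rewrite sqr_sqrtr// subr_ge0.
have -> : [set x | x ^+ 2 + z ^+ 2 <= rho ^+ 2] = `[- s, s]%classic.
  apply/seteqP; split => x /=; rewrite in_itv /= -ler_norml => H.
    by rewrite -(@ler_pXn2r _ 2)// ?nnegrE// real_normK ?num_real// s2; lra.
  have : `|x| ^+ 2 <= s ^+ 2 by rewrite ler_pXn2r// nnegrE.
  by rewrite real_normK ?num_real// s2; lra.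
have inD x : x \in `[- s, s] -> x ^+ 2 + z ^+ 2 < 1.
  rewrite in_itv /= -ler_norml => H.
  have : `|x| ^+ 2 <= s ^+ 2 by rewrite ler_pXn2r// nnegrE.
  by rewrite real_normK ?num_real// s2; lra.
have [s_0|s_n0] := eqVneq s 0.
  by rewrite s_0 oppr0 set_itv1 integral_set1.
have ss : - s < s by have : 0 < s; [by rewrite lt_neqAle eq_sym s_n0|lra].
have sin : s \in `[- s, s] by rewrite in_itv /= lexx andbT ltW.
have Nsin : - s \in `[- s, s] by rewrite in_itv /= lexx ltW.
have dF x : x \in `[- s, s] -> {for x, continuous F}.
  move=> /inD /h [[dFx _] _]; apply: differentiable_continuous.
  exact/derivable1_diffP.
rewrite (@continuous_FTC2 _ f F)//.
- have -> : F s = 0 by apply: F0; rewrite s2; lra.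
  have -> : F (- s) = 0 by apply: F0; rewrite sqrrN s2; lra.
  by rewrite subee.
- by apply: continuous_in_subspaceT => x; rewrite inE /= => /inD /h [].
- split.
  + move=> x /subset_itv_oo_cc /inD /h [[]] //.
  + exact/cvg_at_right_filter/dF.
  + exact/cvg_at_left_filter/dF.
- move=> x /subset_itv_oo_cc /inD /h [[]] _ <- _.
  by rewrite derive1E.
Qed.

(** By Fubini it suffices to integrate over horizontal chords. There the integral is the difference
    of u at the two end points, which lie on the circle. *)
Lemma green1 rho u ux uy : 0 <= rho -> rho < 1 -> RC1 u ux uy ->
  (forall p, p.1 ^+ 2 + p.2 ^+ 2 = rho ^+ 2 -> u p = 0) ->
  Rintegral (@area R) (dcl rho) ux = 0.
Proof.
move=> r0 r1 hu u0; rewrite /Rintegral integral_mkcond.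
have iu : (@area R).-integrable (dcl rho) (EFin \o ux).
  by apply: continuous_dcl_integrable => // p /hu [].
have {}iu : (@area R).-integrable setT ((EFin \o ux) \_ (dcl rho)).
  by move/(integrable_mkcond _ (measurable_dcl rho)) : iu.
rewrite /area -integral21_prod_meas1//.
rewrite integral0_eq// => y _.
rewrite -[RHS](@slice_integral rho y (fun x => ux (x, y)) (fun x => u (x, y)) r0 r1).
- rewrite integral_mkcond; apply: eq_integral => x _.
  by rewrite /patch /=; congr (if _ then _ else _); apply/idP/idP; rewrite !inE.
- move=> x xy; have [d1 _ _ c1 _] := hu (x, y) (proj2 (diskE (x, y)) xy).
  by split => //; exact: slice1.
- by move=> x; exact: (u0 (x, y)).
Qed.

Lemma green2 rho u ux uy : 0 <= rho -> rho < 1 -> RC1 u ux uy ->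
  (forall p, p.1 ^+ 2 + p.2 ^+ 2 = rho ^+ 2 -> u p = 0) ->
  Rintegral (@area R) (dcl rho) uy = 0.
Proof.
move=> r0 r1 hu u0; rewrite /Rintegral integral_mkcond.
have iu : (@area R).-integrable (dcl rho) (EFin \o uy).
  by apply: continuous_dcl_integrable => // p /hu [].
have {}iu : (@area R).-integrable setT ((EFin \o uy) \_ (dcl rho)).
  by move/(integrable_mkcond _ (measurable_dcl rho)) : iu.
rewrite /area -integral12_prod_meas1//.
rewrite integral0_eq// => x _.
rewrite -[RHS](@slice_integral rho x (fun y => uy (x, y)) (fun y => u (x, y)) r0 r1).
- rewrite integral_mkcond; apply: eq_integral => y _.
  by rewrite /patch /=; congr (if _ then _ else _); apply/idP/idP; rewrite !inE /dcl /= addrC.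
- move=> y; rewrite addrC => xy; have [_ d1 _ _ c1] := hu (x, y) (proj2 (diskE (x, y)) xy).
  by split => //; exact: slice2.
- by move=> y; rewrite addrC; exact: (u0 (x, y)).
Qed.

End Green.

(** * Holomorphic functions and their area moments *)

Section StrictDiff.
Variable R : realType.
Local Notation C := R[i].
Local Notation Re := (@complex.Re R).
Local Notation Im := (@complex.Im R).
Local Notation ii := (Complex 0 1 : C).
Implicit Types (F G : C -> C) (a z w : C).

Lemma is_derive_eps (f : R -> R) (x d : R) :
  (forall e, 0 < e -> exists2 r, 0 < r & forall h, `|h| < r -> `|f (x + h) - f x - h * d| <= e * `|h|) ->
  is_derive x 1 f d.
Proof.
move=> H.
have cv : h^-1 *: ((f \o shift x) (h *: (1 : R)) - f x) @[h --> 0^'] --> d.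
  apply/cvgrPdist_le => /= e e0; have [r r0 hr] := H e e0.
  rewrite near_withinE; apply/nbhs_ballP; exists r => //= h; rewrite /ball /= sub0r normrN => hh hn0.
  have := hr h hh; rewrite /shift /= /GRing.scale /= mulr1 [h + x]addrC => h1.
  rewrite distrC -(ler_pM2r (x := `|h|)) ?normr_gt0// -normrM.
  apply: le_trans h1; rewrite le_eqVlt; apply/orP; left; apply/eqP; congr (`|_|).
  by field.
apply: DeriveDef; first by apply/cvg_ex; exists d.
exact: cvg_lim cv.
Qed.

Lemma continuous_eps (u : R * R -> R) (p : R * R) :
  (forall e, 0 < e -> exists2 r, 0 < r &
     forall q, normc (cplx q - cplx p) < r -> `|u q - u p| <= e) ->
  {for p, continuous u}.
Proof.
move=> H; apply/cvgrPdist_le => /= e e0; have [r r0 hr] := H e e0.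
have r20 : 0 < r / 2 by lra.
have := @nbhsx_ballx _ _ p _ r20; apply: filterS => q /ball2 [q1 q2].
rewrite distrC; apply: hr.
have := le_normcD ((q.1 - p.1)%:C : C) ((q.2 - p.2)%:C * ii).
rewrite (_ : _ + _ = cplx q - cplx p); last first.
  by apply/eqP; rewrite eq_complex /=; apply/andP; split; apply/eqP; ring.
rewrite normcM /= !expr0n /= !addr0 expr1n add0r sqrtr1 mulr1 !sqrtr_sqr.
by rewrite -(normrN (q.1 - _)) -(normrN (q.2 - _)) !opprB => /le_lt_trans; apply; lra.
Qed.

(* Strict differentiability: it makes the partial derivatives continuous, so that
   Green's formula applies. *)
Definition sdiff F z0 a := forall e : R, 0 < e -> exists2 r : R, 0 < r & forall z w,
  normc (z - z0) < r -> normc (w - z0) < r ->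
  normc (F z - F w - a * (z - w)) <= e * normc (z - w).

Lemma disk_normc z : disk z <-> normc z < 1.
Proof. by rewrite /disk /= normcE (_ : (1 : C) = 1%:C) ?ltcR. Qed.

Lemma disk_ball z0 : disk z0 -> exists2 r : R, 0 < r & forall z, normc (z - z0) < r -> disk z.
Proof.
move=> /disk_normc z0d; exists (1 - normc z0); first by rewrite subr_gt0.
move=> z zz; apply/disk_normc.
by have := le_normcD (z - z0) z0; rewrite subrK; lra.
Qed.

Lemma normc_subC z w : normc (z - w) = normc (w - z).
Proof. by rewrite -[LHS]normcN opprB. Qed.

Lemma normcB_le z w : normc z <= normc (z - w) + normc w.
Proof. by have := le_normcD (z - w) w; rewrite subrK. Qed.

Lemma sdiff_lip F z0 a : sdiff F z0 a -> exists2 r : R, 0 < r & forall z,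
  normc (z - z0) < r -> normc (F z - F z0) <= (normc a + 1) * normc (z - z0).
Proof.
move=> h; have [r r0 hr] := h 1 ltr01; exists r => // z zr.
have := hr z z0 zr; rewrite subrr normc0 => /(_ r0) h1.
have := normcB_le (F z - F z0) (a * (z - z0)); rewrite normcM; lra.
Qed.

(** A strict estimate around z0 also controls difference quotients at nearby points, so derivatives
    there are close to the one at z0: the derivative is continuous. *)
Lemma sdiff_uniq F z0 a b e r : 0 < r -> (forall z w,
   normc (z - z0) < r -> normc (w - z0) < r ->
   normc (F z - F w - a * (z - w)) <= e * normc (z - w)) ->
  0 < e -> forall z1, normc (z1 - z0) < r -> sdiff F z1 b -> normc (b - a) <= 2 * e.
Proof.
move=> r0 hr e0 z1 z1r h1; have [r1 r10 hr1] := h1 e e0.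
set m := Num.min r1 (r - normc (z1 - z0)).
have m0 : 0 < m by rewrite lt_min r10 subr_gt0.
have m1 : m <= r1 by rewrite ge_min lexx.
have m2 : m <= r - normc (z1 - z0) by rewrite ge_min lexx orbT.
have [t tE] : exists t, t = m / 2 by exists (m / 2).
have t0 : 0 < t by rewrite tE; lra.
have tr1 : t < r1 by rewrite tE; lra.
have tr : t < r - normc (z1 - z0) by rewrite tE; lra.
have nt : normc (t%:C : C) = t by rewrite /= expr0n /= addr0 sqrtr_sqr gtr0_norm.
have zt : z1 + t%:C - z1 = t%:C by rewrite addrAC subrr add0r.
have A := hr1 (z1 + t%:C) z1; rewrite zt subrr nt normc0 in A; have {}A := A tr1 r10.
have B := hr (z1 + t%:C) z1; rewrite zt nt in B.
have {}B : normc (F (z1 + t%:C) - F z1 - a * t%:C) <= e * t.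
  by apply: B z1r; have := le_normcD (z1 - z0) (t%:C : C); rewrite nt addrAC; lra.
have : normc ((b - a) * t%:C) <= 2 * e * t.
  have := le_normcD (F (z1 + t%:C) - F z1 - a * t%:C) (- (F (z1 + t%:C) - F z1 - b * t%:C)).
  rewrite normcN (_ : _ + _ = (b - a) * t%:C); last by ring.
  lra.
by rewrite normcM nt ler_pM2r.
Qed.

End StrictDiff.

(** * Green's formula in complex form *)

Section CauchyGreen.
Variable R : realType.
Local Notation C := R[i].
Local Notation cj := (@conjc R).
Local Notation Re := (@complex.Re R).
Local Notation Im := (@complex.Im R).
Local Notation D := (@disk2 R).
Local Notation ii := (Complex 0 1 : C).
Implicit Types (F G : C -> C) (a z w : C).

Definition CC1 F Fx Fy := RC1 (cre F) (cre Fx) (cre Fy) /\ RC1 (cim F) (cim Fx) (cim Fy).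

Lemma CC1_add F Fx Fy G Gx Gy : CC1 F Fx Fy -> CC1 G Gx Gy ->
  CC1 (fun z => F z + G z) (fun z => Fx z + Gx z) (fun z => Fy z + Gy z).
Proof.
move=> [f1 f2] [g1 g2]; split.
- have := RC1_add f1 g1; congr (RC1 _ _ _); apply/funext => p; by rewrite /cre cReD.
- have := RC1_add f2 g2; congr (RC1 _ _ _); apply/funext => p; by rewrite /cim cImD.
Qed.

Lemma RC1_opp (u ux uy : R * R -> R) : RC1 u ux uy ->
  RC1 (fun p => - u p) (fun p => - ux p) (fun p => - uy p).
Proof.
move=> h; have := RC1_mul (@RC1_cst _ (-1)) h.
by congr (RC1 _ _ _); apply/funext => p; rewrite ?mul0r ?add0r mulN1r.
Qed.

Lemma CC1_mul F Fx Fy G Gx Gy : CC1 F Fx Fy -> CC1 G Gx Gy ->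
  CC1 (fun z => F z * G z) (fun z => Fx z * G z + F z * Gx z) (fun z => Fy z * G z + F z * Gy z).
Proof.
move=> [f1 f2] [g1 g2]; split.
- have := RC1_add (RC1_mul f1 g1) (RC1_opp (RC1_mul f2 g2)); congr (RC1 _ _ _);
    apply/funext => p; rewrite /cre /cim; cbv beta; rewrite ?cReD !cReM; ring.
- have := RC1_add (RC1_mul f1 g2) (RC1_mul f2 g1); congr (RC1 _ _ _);
    apply/funext => p; rewrite /cre /cim; cbv beta; rewrite ?cImD !cImM; ring.
Qed.

Lemma CC1_cst a : CC1 (fun=> a) (fun=> 0) (fun=> 0).
Proof. by split; exact: RC1_cst. Qed.

Lemma CC1_id : CC1 id (fun=> 1) (fun=> ii).
Proof. by split; [exact: RC1_fst|exact: RC1_snd]. Qed.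

Lemma CC1_conj F Fx Fy : CC1 F Fx Fy ->
  CC1 (fun z => cj (F z)) (fun z => cj (Fx z)) (fun z => cj (Fy z)).
Proof.
move=> [f1 f2]; split.
- by move: f1; congr (RC1 _ _ _); apply/funext => p; rewrite /cre cReC.
- by have := RC1_opp f2; congr (RC1 _ _ _); apply/funext => p; rewrite /cim cImC.
Qed.

Lemma CC1_cjX n : CC1 (fun z => cj z ^+ n) (fun z => n%:R * cj z ^+ n.-1)
  (fun z => - ii * (n%:R * cj z ^+ n.-1)).
Proof.
elim: n => [|n IH].
  by have := CC1_cst 1; congr (CC1 _ _ _); apply/funext => z; rewrite ?expr0 ?mul0r ?mulr0.
have := CC1_mul (CC1_conj CC1_id) IH; congr (CC1 _ _ _); apply/funext => z; cbv beta.
- by rewrite exprS.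
- rewrite (_ : cj 1 = 1); last by rewrite conjc1.
  by case: n {IH} => [|n] /=; rewrite ?expr0 ?mul0r ?mulr0 ?addr0 ?exprS -?natr1; ring.
- rewrite (_ : cj ii = - ii); last by apply/eqP; rewrite eq_complex /= oppr0 !eqxx.
  by case: n {IH} => [|n] /=; rewrite ?expr0 ?mul0r ?mulr0 ?addr0 ?exprS -?natr1; ring.
Qed.

(** The partial derivatives are F' and i F', which is the Cauchy-Riemann equation. *)
Lemma sdiff_CC1 F dF : (forall z, disk z -> sdiff F z (dF z)) ->
  CC1 F dF (fun z => ii * dF z).
Proof.
move=> h.
have cF p : D p -> forall e, 0 < e -> exists2 r, 0 < r &
     forall q, normc (cplx q - cplx p) < r -> normc (F (cplx q) - F (cplx p)) <= e.
  move=> Dp e e0; have [r r0 hr] := sdiff_lip (h _ Dp).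
  have a0 := normc_ge0 (dF (cplx p)).
  exists (Num.min r (e / (normc (dF (cplx p)) + 1))).
    by rewrite lt_min r0 divr_gt0//; lra.
  move=> q; rewrite lt_min => /andP[q1 q2]; apply: (le_trans (hr _ q1)).
  by rewrite mulrC -ler_pdivlMr ?ltW//; lra.
have cdF p : D p -> forall e, 0 < e -> exists2 r, 0 < r &
     forall q, normc (cplx q - cplx p) < r -> normc (dF (cplx q) - dF (cplx p)) <= e.
  move=> Dp e e0; have e20 : 0 < e / 2 by lra.
  have [r r0 hr] := h _ Dp _ e20; have [r' r'0 hr'] := disk_ball Dp.
  exists (Num.min r r'); first by rewrite lt_min r0.
  move=> q; rewrite lt_min => /andP[q1 q2].
  by have := sdiff_uniq r0 hr e20 q1 (h _ (hr' _ q2)); lra.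
have dx p : D p -> forall e, 0 < e -> exists2 r, 0 < r &
     forall k : R, `|k| < r -> normc (F (cplx (p.1 + k, p.2)) - F (cplx p) - k%:C * dF (cplx p)) <= e * `|k|.
  move=> Dp e e0; have [r r0 hr] := h _ Dp _ e0; exists r => // k kr.
  have E : cplx (p.1 + k, p.2) - cplx p = k%:C.
    by apply/eqP; rewrite eq_complex /=; apply/andP; split; apply/eqP; ring.
  have nk : normc (k%:C : C) = `|k| by rewrite /= expr0n /= addr0 sqrtr_sqr.
  have := hr (cplx (p.1 + k, p.2)) (cplx p); rewrite E subrr normc0 nk mulrC.
  exact.
have dy p : D p -> forall e, 0 < e -> exists2 r, 0 < r &
     forall k : R, `|k| < r -> normc (F (cplx (p.1, p.2 + k)) - F (cplx p) - k%:C * (ii * dF (cplx p))) <= e * `|k|.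
  move=> Dp e e0; have [r r0 hr] := h _ Dp _ e0; exists r => // k kr.
  have E : cplx (p.1, p.2 + k) - cplx p = k%:C * ii.
    by apply/eqP; rewrite eq_complex /=; apply/andP; split; apply/eqP; ring.
  have nk : normc (k%:C * ii : C) = `|k|.
    by rewrite normcM /= !expr0n /= addr0 add0r expr1n sqrtr1 mulr1 sqrtr_sqr.
  have := hr (cplx (p.1, p.2 + k)) (cplx p); rewrite E subrr normc0 nk.
  by rewrite (mulrC (dF _)) mulrA; exact.
have ReB z w : Re (z - w) = Re z - Re w by rewrite cReD cReN.
have ImB z w : Im (z - w) = Im z - Im w by rewrite cImD cImN.
have Rek (k : R) z : Re (k%:C * z) = k * Re z by rewrite cReM /= mul0r subr0.
have Imk (k : R) z : Im (k%:C * z) = k * Im z by rewrite cImM /= mul0r addr0.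
have Reii z : Re (ii * z) = - Im z by rewrite cReM /= mul0r sub0r mul1r.
have Imii z : Im (ii * z) = Re z by rewrite cImM /= mul0r add0r mul1r.
split => p Dp; (split; [apply: is_derive_eps => e e0; have [r r0 hr] := dx p Dp e e0
   |apply: is_derive_eps => e e0; have [r r0 hr] := dy p Dp e e0
   |apply: continuous_eps => e e0; have [r r0 hr] := cF p Dp e e0
   |apply: continuous_eps => e e0; have [r r0 hr] := cdF p Dp e e0
   |apply: continuous_eps => e e0; have [r r0 hr] := cdF p Dp e e0]);
  exists r => // q qr; apply: le_trans (hr q qr); rewrite /cre /cim.
- by apply: le_trans (abs_Re_le _); rewrite !ReB Rek -surjective_pairing.
- by apply: le_trans (abs_Re_le _); rewrite !ReB Rek -surjective_pairing.
- by apply: le_trans (abs_Re_le _); rewrite ReB.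
- by apply: le_trans (abs_Re_le _); rewrite ReB.
- by apply: le_trans (abs_Im_le _); rewrite !Reii ImB -opprD normrN.
- by apply: le_trans (abs_Im_le _); rewrite !ImB Imk -surjective_pairing.
- by apply: le_trans (abs_Im_le _); rewrite !ImB Imk -surjective_pairing.
- by apply: le_trans (abs_Im_le _); rewrite ImB.
- by apply: le_trans (abs_Im_le _); rewrite ImB.
- by apply: le_trans (abs_Re_le _); rewrite !Imii ReB.
Qed.

Lemma CC1_cint rho F Fx Fy : 0 <= rho -> rho < 1 -> CC1 F Fx Fy -> cint (dcl rho) F.
Proof.
move=> r0 r1 [f1 f2].
by split; apply: continuous_dcl_integrable => // p Dp; [have [] := f1 p Dp|have [] := f2 p Dp].
Qed.

Lemma CC1_cint_x rho F Fx Fy : 0 <= rho -> rho < 1 -> CC1 F Fx Fy -> cint (dcl rho) Fx.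
Proof.
move=> r0 r1 [f1 f2].
by split; apply: continuous_dcl_integrable => // p Dp; [have [] := f1 p Dp|have [] := f2 p Dp].
Qed.

Lemma CC1_cint_y rho F Fx Fy : 0 <= rho -> rho < 1 -> CC1 F Fx Fy -> cint (dcl rho) Fy.
Proof.
move=> r0 r1 [f1 f2].
by split; apply: continuous_dcl_integrable => // p Dp; [have [] := f1 p Dp|have [] := f2 p Dp].
Qed.

(** The integrand is twice the derivative of F with respect to conj(z), which sees only the
    antiholomorphic part. *)
Lemma cgreen rho F Fx Fy : 0 <= rho -> rho < 1 -> CC1 F Fx Fy ->
  (forall p, p.1 ^+ 2 + p.2 ^+ 2 = rho ^+ 2 -> F (cplx p) = 0) ->
  cI (dcl rho) (fun z => Fx z + ii * Fy z) = 0.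
Proof.
move=> r0 r1 h F0; have mdc := measurable_dcl rho.
have ix := CC1_cint_x r0 r1 h; have iy := CC1_cint_y r0 r1 h.
rewrite cI_add ?cI_scale//; last exact: cint_scale.
case: h => h1 h2; rewrite /cI.
by rewrite !(green1 r0 r1 h1, green2 r0 r1 h1, green1 r0 r1 h2, green2 r0 r1 h2) ?mulr0 ?addr0//;
  move=> p hp; rewrite /cre /cim F0.
Qed.

(* Green's formula for (rho^2 - |z|^2) F(z) conj(z)^n, which vanishes on the circle. *)
Lemma moment_step rho F dF n : 0 <= rho -> rho < 1 ->
  (forall z, disk z -> sdiff F z (dF z)) ->
  n.+1%:R * cI (dcl rho) (fun z => z * F z * cj z ^+ n) =
  n%:R * (rho ^+ 2)%:C * cI (dcl rho) (fun z => F z * cj z ^+ n.-1).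
Proof.
move=> r0 r1 hF; have mdc := measurable_dcl rho.
have cF := sdiff_CC1 hF.
have cr : CC1 (fun z => (rho ^+ 2)%:C + (- 1) * (z * cj z)) _ _ :=
  CC1_add (CC1_cst _) (CC1_mul (CC1_cst _) (CC1_mul CC1_id (CC1_conj CC1_id))).
have cU := CC1_mul cr (CC1_mul cF (CC1_cjX n)).
have := cgreen r0 r1 cU; cbv beta.
have i1 := CC1_cint r0 r1 (CC1_mul (CC1_mul CC1_id cF) (CC1_cjX n)).
have i2 := CC1_cint r0 r1 (CC1_mul cF (CC1_cjX n.-1)).
move=> H.
(* The terms with F' cancel, and the derivatives of rho^2 - |z|^2 and of conj(z)^n remain. For n = 0
   the truncated exponent [n.-1] is harmless because its coefficient is 0. *)
have {}H : cI (dcl rho) (fun z => (- 2 * n.+1%:R) * (z * F z * cj z ^+ n) +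
     (2 * n%:R * (rho ^+ 2)%:C) * (F z * cj z ^+ n.-1)) = 0.
  rewrite -[RHS]H; last first.
    move=> p hp; rewrite (_ : _ + _ = 0) ?mul0r//.
    rewrite -hp; apply/eqP; rewrite eq_complex /=; apply/andP; split; apply/eqP; ring.
  apply: cI_eq => p _; set z := cplx p; cbv beta.
  have i_sqr : ii * ii = -1 by apply/eqP; rewrite eq_complex /=; apply/andP; split; apply/eqP; ring.
  rewrite (_ : cj 1 = 1); last by rewrite conjc1.
  rewrite (_ : cj ii = - ii); last by apply/eqP; rewrite eq_complex /= oppr0 !eqxx.
  move: (F z) (dF z) (cj z) ((rho ^+ 2)%:C) => F0 d w r2.
  rewrite [RHS](_ : _ = - (w + z) * (F0 * w ^+ n)
     + (r2 - z * w) * (d * w ^+ n + F0 * (n%:R * w ^+ n.-1))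
     + (ii * ii) * (- (w - z) * (F0 * w ^+ n)
        + (r2 - z * w) * (d * w ^+ n - F0 * (n%:R * w ^+ n.-1)))); last by ring.
  rewrite i_sqr; case: n {cU i1 i2 H} => [|n] /=; first by rewrite expr0; ring.
  by rewrite -[n.+2%:R]natr1 -[n.+1%:R]natr1 exprS; ring.
have j1 : cint (dcl rho) (fun z => (- 2 * n.+1%:R) * (z * F z * cj z ^+ n)) by exact: cint_scale.
have j2 : cint (dcl rho) (fun z => (2 * n%:R * (rho ^+ 2)%:C) * (F z * cj z ^+ n.-1)) by exact: cint_scale.
rewrite cI_add// !cI_scale// in H.
have two : (2 : C) != 0 by rewrite pnatr_eq0.
apply: (mulfI two); apply/eqP; rewrite -subr_eq0 -oppr_eq0; apply/eqP; rewrite -[RHS]H; ring.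
Qed.

End CauchyGreen.

Section SdiffAlgebra.
Variable R : realType.
Local Notation C := R[i].
Implicit Types (F G : C -> C) (a : nat -> C) (b c z w : C).

Lemma normc_sum (I : Type) (s : seq I) (f : I -> C) :
  normc (\sum_(i <- s) f i) <= \sum_(i <- s) normc (f i).
Proof.
elim: s => [|i s IH]; first by rewrite !big_nil normc0.
by rewrite !big_cons; apply: le_trans (normcD_le _ _) _; rewrite lerD2l.
Qed.

Lemma normc_real (x : R) : 0 <= x -> normc (x%:C : C) = x.
Proof. by move=> x0; rewrite /= expr0n /= addr0 sqrtr_sqr ger0_norm. Qed.

Lemma normc_eq0 z : normc z = 0 -> z = 0. Proof. exact: eq0_normc. Qed.

Lemma sdiff_near F G z0 b r : 0 < r -> (forall z, normc (z - z0) < r -> F z = G z) ->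
  sdiff F z0 b -> sdiff G z0 b.
Proof.
move=> r0 FG h e e0; have [r1 r10 hr] := h e e0.
exists (Num.min r r1); first by rewrite lt_min r0.
move=> z w; rewrite !lt_min => /andP[z1 z2] /andP[w1 w2].
by rewrite -!FG//; exact: hr.
Qed.

Lemma sdiff_cst c z0 : sdiff (fun=> c) z0 0.
Proof.
move=> e e0; exists 1 => // z w _ _.
by rewrite mul0r subrr subr0 normc0 mulr_ge0 ?normc_ge0// ltW.
Qed.

Lemma sdiff_id z0 : sdiff id z0 1.
Proof.
move=> e e0; exists 1 => // z w _ _.
by rewrite mul1r subrr normc0 mulr_ge0 ?normc_ge0// ltW.
Qed.

Lemma sdiff_add F G z0 b c : sdiff F z0 b -> sdiff G z0 c ->
  sdiff (fun z => F z + G z) z0 (b + c).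
Proof.
move=> hF hG e e0; have e20 : 0 < e / 2 by lra.
have [r r0 hr] := hF _ e20; have [s s0 hs] := hG _ e20.
exists (Num.min r s); first by rewrite lt_min r0.
move=> z w; rewrite !lt_min => /andP[z1 z2] /andP[w1 w2].
have := hr z w z1 w1; have := hs z w z2 w2.
have := normcD_le (F z - F w - b * (z - w)) (G z - G w - c * (z - w)).
rewrite (_ : _ + _ = F z + G z - (F w + G w) - (b + c) * (z - w)); last by ring.
lra.
Qed.

Lemma sdiff_mul F G z0 b c : sdiff F z0 b -> sdiff G z0 c ->
  sdiff (fun z => F z * G z) z0 (b * G z0 + F z0 * c).
Proof.
move=> hF hG e e0.
have [rf rf0 hrf] := sdiff_lip hF; have [rg rg0 hrg] := sdiff_lip hG.
set KF := normc b + 1 in hrf; set KG := normc c + 1 in hrg.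
have KF0 : 0 < KF by rewrite ltr_wpDl// normc_ge0.
have KG0 : 0 < KG by rewrite ltr_wpDl// normc_ge0.
have fz0 := normc_ge0 (F z0); have gz0 := normc_ge0 (G z0).
pose K := normc (F z0) + normc (G z0) + KF + KG.
have K0 : 0 < K by rewrite /K; lra.
have e40 : 0 < e / (4 * (K + 1)) by rewrite divr_gt0//; lra.
have [r r0 hr] := hF _ e40; have [s s0 hs] := hG _ e40.
have [d [d0 d1 d2]] : exists d, [/\ 0 < d, d <= 1 & d <= e / (4 * K * K)].
  exists (Num.min 1 (e / (4 * K * K))).
  by rewrite lt_min ltr01 divr_gt0 ?mulr_gt0// !ge_min !lexx orbT.
exists (Num.min (Num.min r s) (Num.min (Num.min rf rg) d)).
  by rewrite !lt_min r0 s0 rf0 rg0 d0.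
move=> z w; rewrite !lt_min => /andP[/andP[z1 z2] /andP[/andP[z3 z4] z5]].
move=> /andP[/andP[w1 w2] /andP[/andP[w3 w4] w5]].
have zw0 := normc_ge0 (z - w).
have A1 := hr z w z1 w1; have A2 := hs z w z2 w2.
have Fz : normc (F z - F z0) <= KF * d by apply: le_trans (hrf z z3) _; rewrite ler_pM2l// ltW.
have Gw : normc (G w - G z0) <= KG * d by apply: le_trans (hrg w w4) _; rewrite ler_pM2l// ltW.
have Fz' : normc (F z) <= K.
  by have := normcB_le (F z) (F z0); have : KF * d <= KF; [rewrite ler_piMr// ltW|rewrite /K; lra].
have Gw' : normc (G w) <= K.
  by have := normcB_le (G w) (G z0); have : KG * d <= KG; [rewrite ler_piMr// ltW|rewrite /K; lra].
have bK : normc b <= K by rewrite /K /KF; lra.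
have cK : normc c <= K by rewrite /K /KG; have := normc_ge0 b; rewrite /KF; lra.
have KK : 4 * K * K > 0 by rewrite !mulr_gt0.
have dK : K * d * K <= e / 4.
  have : d * (4 * K * K) <= e by rewrite -ler_pdivlMr.
  lra.
have KFK : KF <= K by rewrite /K; lra.
have KGK : KG <= K by rewrite /K; lra.
have t1 : normc (F z * (G z - G w - c * (z - w))) <= e / 4 * normc (z - w).
  rewrite normcM; apply: (@le_trans _ _ (K * (e / (4 * (K + 1)) * normc (z - w)))).
    by rewrite ler_pM ?normc_ge0.
  rewrite mulrA ler_wpM2r// mulrA ler_pdivrMr; last lra.
  have : 0 <= e by exact: ltW.
  lra.
have t2 : normc (G w * (F z - F w - b * (z - w))) <= e / 4 * normc (z - w).
  rewrite normcM; apply: (@le_trans _ _ (K * (e / (4 * (K + 1)) * normc (z - w)))).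
    by rewrite ler_pM ?normc_ge0.
  rewrite mulrA ler_wpM2r// mulrA ler_pdivrMr; last lra.
  have : 0 <= e by exact: ltW.
  lra.
have t3 : normc ((F z - F z0) * (c * (z - w))) <= e / 4 * normc (z - w).
  rewrite !normcM mulrA ler_wpM2r//; apply: le_trans dK.
  by rewrite ler_pM ?normc_ge0// (le_trans Fz)// ler_wpM2r// ltW.
have t4 : normc ((G w - G z0) * (b * (z - w))) <= e / 4 * normc (z - w).
  rewrite !normcM mulrA ler_wpM2r//; apply: le_trans dK.
  by rewrite ler_pM ?normc_ge0// (le_trans Gw)// ler_wpM2r// ltW.
rewrite (_ : _ - _ = F z * (G z - G w - c * (z - w)) + G w * (F z - F w - b * (z - w))
  + (F z - F z0) * (c * (z - w)) + (G w - G z0) * (b * (z - w))); last by ring.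
apply: le_trans (normcD_le _ _) _; apply: le_trans (lerD (normcD_le _ _) (lexx _)) _.
apply: le_trans (lerD (lerD (normcD_le _ _) (lexx _)) (lexx _)) _.
lra.
Qed.

End SdiffAlgebra.

(** * Strict differentiability of power series *)

Section SdiffPowerSeries.
Variable R : realType.
Local Notation C := R[i].
Implicit Types (F G : C -> C) (a : nat -> C) (b c z w : C).

Definition sdiffable F z0 := exists b, sdiff F z0 b.

Lemma sdiffable_mul F G z0 : sdiffable F z0 -> sdiffable G z0 -> sdiffable (fun z => F z * G z) z0.
Proof. by move=> [b hb] [c hc]; eexists; exact: sdiff_mul hb hc. Qed.

Lemma sdiffable_add F G z0 : sdiffable F z0 -> sdiffable G z0 -> sdiffable (fun z => F z + G z) z0.
Proof. by move=> [b hb] [c hc]; eexists; exact: sdiff_add hb hc. Qed.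

Lemma sdiffable_cst c z0 : sdiffable (fun=> c) z0.
Proof. by eexists; exact: sdiff_cst. Qed.

Lemma sdiffable_exp n z0 : sdiffable (fun z => z ^+ n) z0.
Proof.
elim: n => [|n IH]; first exact: sdiffable_cst.
have := sdiffable_mul (ex_intro _ _ (sdiff_id z0)) IH.
by congr sdiffable; apply/funext => z; rewrite exprS.
Qed.

Lemma sdiffable_sum (I : Type) (s : seq I) (f : I -> C -> C) z0 :
  (forall i, sdiffable (f i) z0) -> sdiffable (fun z => \sum_(i <- s) f i z) z0.
Proof.
move=> h; elim: s => [|i s IH].
  by under eq_fun do rewrite big_nil; exact: sdiffable_cst.
by under eq_fun do rewrite big_cons; exact: sdiffable_add.
Qed.

Lemma sdiff_inv z0 : z0 != 0 -> sdiff (fun z => z^-1) z0 (- z0^-1 ^+ 2).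
Proof.
move=> z00 e e0; have n0 : 0 < normc z0.
  by rewrite lt_neqAle normc_ge0 andbT eq_sym; apply: contra z00 => /eqP/normc_eq0/eqP.
set m := normc z0 in n0 *.
have m3 : 0 < m ^+ 3 by rewrite exprn_gt0.
have [d [d0 d1 d2]] : exists d, [/\ 0 < d, d <= m / 2 & d <= e * m ^+ 3 / 10].
  exists (Num.min (m / 2) (e * m ^+ 3 / 10)).
  by rewrite lt_min !divr_gt0 ?mulr_gt0// !ge_min !lexx orbT.
exists d => // z w zd wd.
have nz : m / 2 <= normc z by have := normcB_le z0 z; rewrite normc_subC -/m; lra.
have nw : m / 2 <= normc w by have := normcB_le z0 w; rewrite normc_subC -/m; lra.
have z_0 : z != 0 by apply/eqP => z_0; rewrite z_0 normc0 in nz; lra.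
have w_0 : w != 0 by apply/eqP => w_0; rewrite w_0 normc0 in nw; lra.
have -> : z^-1 - w^-1 - - z0^-1 ^+ 2 * (z - w) =
  (z - w) * (((z - z0) * w + z0 * (w - z0)) / (z * w * z0 ^+ 2)).
  by field; rewrite z_0 w_0 z00.
rewrite normcM mulrC ler_wpM2r ?normc_ge0// normcM normcV.
have D0 : 0 < normc (z * w * z0 ^+ 2).
  by rewrite !normcM -/m !mulr_gt0//; lra.
rewrite ler_pdivrMr//; apply: le_trans (normcD_le _ _) _.
rewrite !normcM -/m.
have wm : normc w <= 3 / 2 * m by have := normcB_le w z0; rewrite -/m; lra.
have h1 : normc (z - z0) * normc w <= d * (3 / 2 * m).
  by rewrite ler_pM ?normc_ge0// ltW.
have h2 : m * normc (w - z0) <= m * d by rewrite ler_wpM2l// ltW.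
have h3 : m / 2 * (m / 2) <= normc z * normc w by rewrite ler_pM//; lra.
have h4 : e * m ^+ 2 * (m / 2 * (m / 2)) <= e * m ^+ 2 * (normc z * normc w).
  by rewrite ler_wpM2l// mulr_ge0 ?exprn_ge0// ltW.
have h5 : d * m <= e * m ^+ 3 / 10 * m by rewrite ler_wpM2r// ltW.
move: h4 h5; rewrite !exprS !expr0; lra.
Qed.

Definition psum a n (h : C) : C := \sum_(k < n) a k * h ^+ k.

Definition has_ps F z0 (r : R) a := forall z, normc (z - z0) < r ->
  forall e : R, 0 < e -> exists N, forall n, (N <= n)%N -> normc (psum a n (z - z0) - F z) <= e.

Lemma has_psS F z0 r r' a : r' <= r -> has_ps F z0 r a -> has_ps F z0 r' a.
Proof. by move=> rr h z zr; apply: h; exact: lt_le_trans rr. Qed.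

Lemma has_ps_bound F z0 r a (x : R) : has_ps F z0 r a -> 0 <= x -> x < r ->
  exists2 M, 0 < M & forall n, normc (a n) * x ^+ n <= M.
Proof.
move=> h x0 xr; have E : z0 + x%:C - z0 = x%:C by rewrite addrAC subrr add0r.
have := h (z0 + x%:C); rewrite E normc_real// => /(_ xr 1 ltr01) [N hN].
(* The term is the difference of two consecutive partial sums, each within 1 of the limit. *)
have hM n : (N <= n)%N -> normc (a n) * x ^+ n <= 2.
  move=> Nn; have := hN n Nn; have := hN n.+1 (leqW Nn).
  rewrite {1}/psum big_ord_recr /= -/(psum a n _).
  set S := psum a n _; set t := F _ => h1 h2.
  have : normc (a n * x%:C ^+ n) <= normc (S + a n * x%:C ^+ n - t) + normc (S - t).
    rewrite -(normcNR (S - t)).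
    rewrite [X in normc X <= _](_ : _ = (S + a n * x%:C ^+ n - t) + - (S - t)); last by ring.
    exact: normcD_le.
  rewrite normcM normcX normc_real//; lra.
pose M := 2 + \sum_(k < N) normc (a k) * x ^+ k.
have s0 : 0 <= \sum_(k < N) normc (a k) * x ^+ k.
  by apply: sumr_ge0 => k _; rewrite mulr_ge0 ?normc_ge0// exprn_ge0.
exists M; first by rewrite /M; lra.
move=> n; have [Nn|nN] := leqP N n; first by have := hM n Nn; rewrite /M; lra.
rewrite /M (bigD1 (Ordinal nN))//= addrCA lerDl addr_ge0//.
by apply: sumr_ge0 => k _; rewrite mulr_ge0 ?normc_ge0// exprn_ge0.
Qed.

Lemma normc_subX (u v : C) (d : R) n : normc u <= d -> normc v <= d ->
  normc (u ^+ n.+1 - v ^+ n.+1) <= normc (u - v) * (n.+1%:R * d ^+ n).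
Proof.
move=> ud vd; have d0 : 0 <= d := le_trans (normc_ge0 u) ud.
rewrite subrXX normcM ler_wpM2l ?normc_ge0//; apply: le_trans (normc_sum _ _) _.
apply: (@le_trans _ _ (\sum_(i < n.+1) d ^+ n)); last by rewrite sumr_const card_ord mulr_natl.
apply: ler_sum => i _; rewrite normcM !normcX.
have -> : d ^+ n = d ^+ (n.+1.-1 - i) * d ^+ i.
  by rewrite -exprD subnK//= -ltnS.
by apply: ler_pM; rewrite ?exprn_ge0 ?normc_ge0//; apply: lerXn2r; rewrite ?nnegrE ?normc_ge0.
Qed.

Lemma geo_sum (q : R) n : 0 <= q -> q <= 2^-1 -> \sum_(k < n) q ^+ k <= 2.
Proof.
move=> q0 q1; suff : \sum_(k < n) q ^+ k <= 2 - 2 * q ^+ n by have := exprn_ge0 n q0; lra.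
elim: n => [|n IH]; first by rewrite big_ord0 expr0; lra.
rewrite big_ord_recr /= exprS; have := exprn_ge0 n q0.
have : 0 <= q ^+ n * (2^-1 - q) by rewrite mulr_ge0 ?exprn_ge0//; lra.
lra.
Qed.

Lemma sdiff_ps F z0 r a : 0 < r -> has_ps F z0 r a -> sdiff F z0 (a 1%N).
Proof.
move=> r0 h e e0.
have [x [x0 xr]] : exists x, 0 < x /\ x < r by exists (r / 2); split; lra.
have [M M0 hM] := has_ps_bound h (ltW x0) xr.
have [d [d0 d1 d2]] : exists d, [/\ 0 < d, d <= x / 4 & 4 * M * d <= e * x ^+ 2].
  exists (Num.min (x / 4) (e * x ^+ 2 / (4 * M))).
  rewrite lt_min !divr_gt0 ?mulr_gt0 ?exprn_gt0// ge_min lexx; split=> //.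
  by rewrite mulrC -ler_pdivlMr ?mulr_gt0// ge_min lexx orbT.
exists d => // z w zd wd.
set u := z - z0; set v := w - z0.
have uv : z - w = u - v by rewrite /u /v; ring.
(* The factor 2 absorbs i + 2 <= 2^(i+1), the number of terms in u^(i+2) - v^(i+2) over u - v; the
   choice d <= x / 4 then makes q at most 1/2. *)
pose q := 2 * d / x.
have q0 : 0 <= q by rewrite divr_ge0 ?(ltW x0)//; lra.
have q1 : q <= 2^-1 by rewrite ler_pdivrMr//; lra.
have key n : normc (psum a n.+2 u - psum a n.+2 v - a 1%N * (u - v)) <= normc (u - v) * e.
  rewrite /psum !big_ord_recl /= !expr0 !expr1.
  rewrite [X in normc X](_ : _ = \sum_(i < n) a i.+2 * (u ^+ i.+2 - v ^+ i.+2)); last first.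
    under [RHS]eq_bigr do rewrite mulrBr.
    by rewrite sumrB; ring.
  apply: le_trans (normc_sum _ _) _.
  apply: (@le_trans _ _ (\sum_(i < n) normc (u - v) * (M / x * q) * q ^+ i)).
    apply: ler_sum => i _; rewrite normcM.
    apply: (@le_trans _ _ (normc (a i.+2) * (normc (u - v) * (i.+2%:R * d ^+ i.+1)))).
      by rewrite ler_wpM2l ?normc_ge0// normc_subX// ltW.
    rewrite mulrCA -[leRHS]mulrA ler_wpM2l ?normc_ge0//.
    apply: (@le_trans _ _ (normc (a i.+2) * x ^+ i.+2 * (x^-1 * q ^+ i.+1))).
      rewrite -[leRHS]mulrA ler_wpM2l ?normc_ge0// /q.
      have -> : x ^+ i.+2 * (x^-1 * (2 * d / x) ^+ i.+1) = 2 ^+ i.+1 * d ^+ i.+1.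
        rewrite !exprMn exprVn [x ^+ i.+2]exprS; field.
        by rewrite expf_neq0// gt_eqF.
      rewrite ler_wpM2r ?exprn_ge0 ?(ltW d0)//.
      by rewrite -natrX ler_nat ltn_expl.
    rewrite [leRHS](_ : _ = M * (x^-1 * q ^+ i.+1)); last by rewrite exprS; ring.
    by rewrite ler_wpM2r ?mulr_ge0 ?exprn_ge0 ?invr_ge0 ?(ltW x0).
  rewrite -mulr_sumr -mulrA ler_wpM2l ?normc_ge0//.
  apply: (@le_trans _ _ (M / x * q * 2)).
    by rewrite ler_wpM2l ?geo_sum// mulr_ge0// divr_ge0 ?(ltW M0) ?(ltW x0).
  rewrite (_ : _ * 2 = 4 * M * d / x ^+ 2); last by rewrite /q; field; rewrite gt_eqF.
  by rewrite ler_pdivrMr// exprn_gt0.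
apply/ler_addgt0Pr => eta eta0; have eta20 : 0 < eta / 2 by lra.
have zr : normc (z - z0) < r by lra.
have wr : normc (w - z0) < r by lra.
have [N1 h1] := h z zr _ eta20; have [N2 h2] := h w wr _ eta20.
have := h1 _ (leqW (leqW (leq_addr N2 N1))); have := h2 _ (leqW (leqW (leq_addl N1 N2))).
have := key (N1 + N2)%N; rewrite -/u -/v -uv.
set S := psum _ _ u; set T := psum _ _ v => k1 k2 k3.
rewrite [X in normc X](_ : _ = (S - T - a 1%N * (z - w)) + (- (S - F z) + (T - F w))); last by ring.
apply: le_trans (normcD_le _ _) _.
have := normcD_le (- (S - F z)) (T - F w); rewrite normcNR; lra.
Qed.

End SdiffPowerSeries.

(** * Area moments of holomorphic functions *)

Section Moments.
Variable R : realType.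
Local Notation C := R[i].
Local Notation cj := (@conjc R).
Local Notation Re := (@complex.Re R).
Local Notation Im := (@complex.Im R).
Implicit Types (F G : C -> C) (a : nat -> C) (b c z w : C).

Definition hol F := forall z, disk z -> sdiffable F z.

Lemma hol_choice F : hol F -> exists dF, forall z, disk z -> sdiff F z (dF z).
Proof.
move=> h; pose P z b := disk z -> sdiff F z b.
have [dF hd] : {dF : C -> C & forall z, P z (dF z)}.
  apply: (@choice _ _ P) => z; rewrite /P.
  have [Dz|Dz] := pselect (disk z); last by exists 0.
  by have [b hb] := h z Dz; exists b.
by exists dF.
Qed.

Lemma hol_exp n : hol (fun z => z ^+ n).
Proof. by move=> z _; exact: sdiffable_exp. Qed.

Lemma hol_mul F G : hol F -> hol G -> hol (fun z => F z * G z).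
Proof. by move=> hF hG z Dz; apply: sdiffable_mul; [exact: hF|exact: hG]. Qed.

Section Rho.
Variable (rho : R).
Hypotheses (r0 : 0 <= rho) (r1 : rho < 1).
Let mdc := measurable_dcl rho.

Lemma hol_cint F n : hol F -> cint (dcl rho) (fun z => F z * cj z ^+ n).
Proof.
move=> /hol_choice [dF hd].
have := CC1_cint r0 r1 (CC1_mul (sdiff_CC1 hd) (@CC1_cjX R n)); exact.
Qed.

Lemma mom_step F n : hol F ->
  n.+1%:R * cI (dcl rho) (fun z => z * F z * cj z ^+ n) =
  n%:R * (rho ^+ 2)%:C * cI (dcl rho) (fun z => F z * cj z ^+ n.-1).
Proof. by move=> /hol_choice [dF hd]; exact: (moment_step n r0 r1 hd). Qed.

Lemma nat_neq0 n : n.+1%:R != 0 :> C. Proof. by rewrite pnatr_eq0. Qed.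

(** [mom_step] removes one z and one conj(z) at a time. As m > n, a factor z is left when the
    conjugates are used up, and the prefactor n = 0 then kills the integral. *)
Lemma mom_gt F m n : hol F -> (n < m)%N ->
  cI (dcl rho) (fun z => z ^+ m * F z * cj z ^+ n) = 0.
Proof.
move=> hF; elim: n m => [|n IH] [|m]//= nm.
  apply: (mulfI (nat_neq0 0)); rewrite mulr0.
  rewrite (_ : cI _ _ = cI (dcl rho) (fun z => z * (z ^+ m * F z) * cj z ^+ 0)).
    by rewrite mom_step ?mul0r//; apply: hol_mul => //; exact: hol_exp.
  by apply: cI_eq => p _; rewrite exprS mulrA.
apply: (mulfI (nat_neq0 n.+1)); rewrite mulr0.
rewrite (_ : cI _ _ = cI (dcl rho) (fun z => z * (z ^+ m * F z) * cj z ^+ n.+1)).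
  rewrite mom_step; last by apply: hol_mul => //; exact: hol_exp.
  by rewrite IH ?mulr0.
by apply: cI_eq => p _; rewrite exprS mulrA.
Qed.

Definition carea : C := cI (dcl rho) (fun=> 1).

Lemma mom_diag n : n.+1%:R * cI (dcl rho) (fun z => z ^+ n * cj z ^+ n) =
  (rho ^+ (n + n))%:C * carea.
Proof.
elim: n => [|n IH].
  rewrite !mul1r; apply: cI_eq => p _; by rewrite !expr0 mulr1.
rewrite (_ : cI _ _ = cI (dcl rho) (fun z => z * z ^+ n * cj z ^+ n.+1)); last first.
  by apply: cI_eq => p _; rewrite -exprS.
rewrite mom_step /=; last exact: hol_exp.
rewrite mulrAC IH mulrAC -rcM -exprD; congr ((rho ^+ _)%:C * _); lia.
Qed.

Lemma mom_mono m n : n.+1%:R * cI (dcl rho) (fun z => z ^+ m * cj z ^+ n) =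
  if m == n then (rho ^+ (n + n))%:C * carea else 0.
Proof.
have cst1 : hol (fun=> 1) by move=> z _; exact: sdiffable_cst.
have [->|mn] := eqVneq m n; first exact: mom_diag.
have [h|h] : (n < m)%N \/ (m < n)%N by lia.
  rewrite -[RHS](mulr0 n.+1%:R) -(mom_gt cst1 h); congr (_ * _).
  by apply: cI_eq => p _; rewrite mulr1.
rewrite -[RHS](mulr0 n.+1%:R) -(conjc0 R) -(mom_gt cst1 h) -cI_conj//; last first.
  by apply: hol_cint; apply: hol_mul => //; exact: hol_exp.
congr (_ * _); apply: cI_eq => p _.
by rewrite mulr1 conjcM !conjcX cjK mulrC.
Qed.

End Rho.

(** The Taylor remainder divided by z^N, with the value at 0 that makes it holomorphic on the whole
    disk. *)
Definition quot F a N z : C := if z == 0 then a N else (F z - psum a N z) / z ^+ N.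

Lemma quotE F r a N z : 0 < r -> has_ps F 0 r a ->
  F z = psum a N z + z ^+ N * quot F a N z.
Proof.
move=> r0 h; rewrite /quot; case: eqVneq => [->|z0]; last first.
  by rewrite mulrC divfK ?expf_neq0// addrC subrK.
have -> : F 0 = a 0%N.
  apply/eqP; rewrite -subr_eq0; apply/eqP/normc_eq0/eqP; rewrite eq_le normc_ge0 andbT.
  apply/ler_addgt0Pr => e e0; rewrite add0r.
  have := h 0; rewrite subrr normc0 => /(_ r0 e e0) [n] /(_ n.+1 (leqnSn _)).
  rewrite /psum big_ord_recl /= expr0 mulr1 big1 ?addr0; first by rewrite normc_subC.
  by move=> i _; rewrite expr0n mulr0.
case: N => [|N]; first by rewrite /psum big_ord0 add0r mul1r.
rewrite /psum big_ord_recl /= expr0 mulr1 big1 ?addr0 ?expr0n ?mul0r ?addr0//.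
by move=> i _; rewrite expr0n mulr0.
Qed.

Lemma psum_split a N n z : psum a (N + n) z = psum a N z + z ^+ N * psum (fun k => a (N + k)%N) n z.
Proof.
rewrite /psum big_split_ord /=; congr (_ + _); rewrite mulr_sumr.
by apply: eq_bigr => i _; rewrite exprD mulrCA.
Qed.

Lemma quot_ps F r a N : 0 < r -> has_ps F 0 r a -> has_ps (quot F a N) 0 r (fun k => a (N + k)%N).
Proof.
move=> r0 h z; rewrite subr0 => zr e e0; rewrite /quot; case: eqVneq => [->|z0].
  exists 1%N; case=> // n _.
  rewrite /psum big_ord_recl /= expr0 mulr1 big1 ?addr0 ?addn0 ?subrr ?normc0 ?ltW//.
  by move=> i _; rewrite expr0n mulr0.
have zN : 0 < normc (z ^+ N).
  by rewrite lt_neqAle normc_ge0 andbT eq_sym; apply/eqP => /normc_eq0/eqP; rewrite expf_eq0 (negPf z0) andbF.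
have := h z; rewrite subr0 => /(_ zr (e * normc (z ^+ N)) (mulr_gt0 e0 zN)) [M hM].
exists M => n Mn; have := hM (N + n)%N (leq_trans Mn (leq_addl _ _)).
rewrite psum_split => H; rewrite -(ler_pM2r zN) -normcM; apply: le_trans H.
rewrite le_eqVlt; apply/orP; left; apply/eqP; congr (normc _).
by field; rewrite expf_neq0.
Qed.

Lemma hol_quot F r a N : 0 < r -> has_ps F 0 r a -> hol F -> hol (quot F a N).
Proof.
move=> r0 h hF z Dz; have [->|z0] := eqVneq z 0.
  by exists (a (N + 1)%N); exact: (sdiff_ps r0 (quot_ps N r0 h)).
have nz : 0 < normc z.
  by rewrite lt_neqAle normc_ge0 andbT eq_sym; apply/eqP => /normc_eq0/eqP; rewrite (negPf z0).
have [b hb] : sdiffable (fun z => (F z + (- 1) * psum a N z) * z^-1 ^+ N) z.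
  apply: sdiffable_mul.
    apply: sdiffable_add; first exact: hF.
    apply: sdiffable_mul; first exact: sdiffable_cst.
    rewrite /psum; apply: sdiffable_sum => i.
    by apply: sdiffable_mul; [exact: sdiffable_cst|exact: sdiffable_exp].
  elim: N => [|N IH]; first exact: sdiffable_cst.
  have := sdiffable_mul (ex_intro _ _ (sdiff_inv z0)) IH.
  by congr sdiffable; apply/funext => w; rewrite exprS.
exists b; apply: sdiff_near nz _ hb => w wz.
rewrite /quot; case: eqVneq => [w0|_]; last by rewrite mulN1r exprVn.
by move: wz; rewrite w0 sub0r normcNR ltxx.
Qed.

Lemma cI_sum (rho : R) N (f : nat -> C -> C) : (forall k, cint (dcl rho) (f k)) ->
  cint (dcl rho) (fun z => \sum_(k < N) f k z) /\
  cI (dcl rho) (fun z => \sum_(k < N) f k z) = \sum_(k < N) cI (dcl rho) (f k).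
Proof.
move=> hf; have mdc := measurable_dcl rho; elim: N => [|N [IH1 IH2]].
  rewrite [X in cint _ X](_ : _ = fun=> 0) ?[X in cI _ X](_ : _ = fun=> 0) ?big_ord0;
    [|by apply/funext => z; rewrite big_ord0..].
  have z0 : cint (dcl rho) (fun=> 0 : C).
    by have := cint_scale 0 mdc (hf 0%N); congr cint; apply/funext => z; rewrite mul0r.
  split => //; transitivity (cI (dcl rho) (fun z => 0 * f 0%N z)).
    by apply: cI_eq => p _; rewrite mul0r.
  by rewrite cI_scale// mul0r.
rewrite (_ : (fun z => \sum_(k < N.+1) f k z) = (fun z => \sum_(k < N) f k z + f N z)); last first.
  by apply/funext => z; rewrite big_ord_recr.
by rewrite big_ord_recr /= -IH2 cI_add//; split => //; exact: cint_add.
Qed.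

(** The series of F may converge only on a disk smaller than that of radius rho. So F is split into
    its Taylor polynomial of degree n and z^(n+1) times a holomorphic function; the moments of the
    latter vanish by [mom_gt], and those of monomials are known. *)
Lemma mom_ps rho F r a m n : 0 <= rho -> rho < 1 -> hol F -> 0 < r -> has_ps F 0 r a ->
  n.+1%:R * cI (dcl rho) (fun z => z ^+ m * F z * cj z ^+ n) =
  if (m <= n)%N then a (n - m)%N * ((rho ^+ (n + n))%:C * carea rho) else 0.
Proof.
move=> r0 r1 hF rr h; have mdc := measurable_dcl rho.
have hq := hol_quot n.+1 rr h hF.
have ic k : cint (dcl rho) (fun z => a k * (z ^+ (m + k) * cj z ^+ n)).
  by apply: cint_scale => //; apply: hol_cint => //; exact: hol_exp.
have [s1 s2] := cI_sum n.+1 ic.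
have iq : cint (dcl rho) (fun z => z ^+ (n.+1 + m) * quot F a n.+1 z * cj z ^+ n).
  by apply: hol_cint => //; apply: hol_mul => //; exact: hol_exp.
rewrite (_ : cI _ _ = cI (dcl rho) (fun z =>
    \sum_(k < n.+1) a k * (z ^+ (m + k) * cj z ^+ n)
    + z ^+ (n.+1 + m) * quot F a n.+1 z * cj z ^+ n)); last first.
  apply: cI_eq => p _; rewrite {1}(quotE n.+1 (cplx p) rr h) mulrDr mulrDl; congr (_ + _).
    rewrite /psum mulr_sumr mulr_suml; apply: eq_bigr => k _; rewrite exprD; ring.
  rewrite exprD; ring.
rewrite cI_add// mom_gt//; last by rewrite ltn_addr.
rewrite addr0 s2 mulr_sumr.
under eq_bigr => k _.
  rewrite cI_scale//; last by apply: hol_cint => //; exact: hol_exp.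
  rewrite mulrCA mom_mono//; over.
case: leqP => mn; last first.
  rewrite big1// => k _; rewrite (_ : (m + k == n)%N = false) ?mulr0//.
  by apply/negbTE; rewrite neq_ltn (leq_trans mn (leq_addr _ _)) orbT.
have kn : (n - m < n.+1)%N by rewrite ltnS leq_subr.
rewrite (bigD1 (Ordinal kn))//= subnKC// eqxx big1 ?addr0// => k /eqP kk.
rewrite ifN ?mulr0//; apply/eqP => mk; apply: kk; apply/val_inj => /=.
by apply/eqP; rewrite -(eqn_add2l m) mk subnKC.
Qed.

End Moments.

(** * Area of the disk and exhaustion by closed disks *)

Section Area.
Variable R : realType.
Local Notation T2 := (measurableTypeR R * measurableTypeR R)%type.
Local Notation D := (@disk2 R).
Local Notation leb := (@lebesgue_measure R).

(** The full length of the vertical chord at x. Since [Num.sqrt] is 0 on negative numbers, it is 0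
    for |x| > 1, where the section is empty. *)
Definition half_chord (x : R) : R := 2 * Num.sqrt (1 - x ^+ 2).

Lemma half_chord_sin (t : R) : - (pi / 2) <= t <= pi / 2 ->
  half_chord (sin t) = 2 * cos t.
Proof.
move=> tt; rewrite /half_chord -(cos2Dsin2 t) addrK sqrtr_sqr ger0_norm//.
exact: cos_ge0_pihalf.
Qed.

Lemma xsection_disk (x : R) :
  leb (xsection (D : set T2) x) = (half_chord x)%:E.
Proof.
have -> : xsection (D : set T2) x = `]- Num.sqrt (1 - x ^+ 2), Num.sqrt (1 - x ^+ 2)[%classic.
  apply/seteqP; split => y; rewrite /xsection /= inE diskE /= in_itv /= -ltr_norml.
    move=> h; have p : 0 <= 1 - x ^+ 2 by have := sqr_ge0 y; lra.
    rewrite -(@ltr_pXn2r _ 2)// ?nnegrE ?sqrtr_ge0// sqr_sqrtr// real_normK ?num_real//; lra.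
  move=> h; have s0 : 0 < Num.sqrt (1 - x ^+ 2) by exact: le_lt_trans h.
  have p : 0 <= 1 - x ^+ 2 by rewrite ltW// -sqrtr_gt0.
  have : `|y| ^+ 2 < Num.sqrt (1 - x ^+ 2) ^+ 2 by rewrite ltr_pXn2r// nnegrE sqrtr_ge0.
  by rewrite sqr_sqrtr// real_normK ?num_real//; lra.
rewrite lebesgue_measure_itv /= lte_fin /half_chord; case: ifPn => [_|].
  by rewrite -EFinB; congr EFin; ring.
rewrite -leNgt => h; have := sqrtr_ge0 (1 - x ^+ 2) => h0.
by congr EFin; lra.
Qed.

Lemma continuous_half_chord : continuous half_chord.
Proof.
move=> x; apply: cvgM; first exact: cvg_cst.
apply: (@cvg_comp _ _ _ (fun x => 1 - x ^+ 2) Num.sqrt _ (nbhs (1 - x ^+ 2))).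
  by apply: cvgB; [exact: cvg_cst|under eq_fun do rewrite expr2; apply: cvgM; exact: cvg_id].
exact: sqrt_continuous.
Qed.

(** Cavalieri's principle and the substitution x = sin t lead to the integral of 2 cos^2 t, with
    primitive t + sin t cos t. *)
Lemma area_disk : area (D : set T2) = (pi : R)%:E.
Proof.
rewrite /area /product_measure1 /= /product_measure1.
transitivity (\int[leb]_(x in `[(sin (- (pi / 2))), (sin (pi / 2))]) (half_chord x)%:E)%E.
  rewrite [RHS]integral_mkcond; apply: eq_integral => x _ /=.
  rewrite [LHS]xsection_disk /patch; case: ifPn => //.
  rewrite notin_setE /= in_itv /= sinN sin_pihalf => /negP.
  rewrite -ler_norml -ltNge => x1; rewrite /half_chord ler0_sqrtr ?mulr0//.
  by rewrite subr_le0 -real_normK ?num_real// exprn_ege1// ltW.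
have pi0 := pi_gt0 R.
have dsin : derive1 (@sin R) = cos by apply/funext => x; rewrite derive1E derive_val.
rewrite integration_by_substitution_increasing.
- transitivity (\int[leb]_(x in [set` `[- (pi / 2) : R, pi / 2]%R]) (2 * cos x ^+ 2)%:E)%E.
    apply: eq_integral => x; rewrite inE /= in_itv /= => xx.
    by rewrite dsin; congr EFin; rewrite -[LHS]/(half_chord (sin x) * cos x) half_chord_sin//; ring.
  rewrite (@continuous_FTC2 _ (fun x => 2 * cos x ^+ 2) (fun x => x + sin x * cos x)).
  + rewrite sinN cosN sin_pihalf cos_pihalf !mulr0 !addr0 -EFinB.
    by congr EFin; lra.
  + lra.
  + apply: continuous_subspaceT => x; apply: cvgM; first exact: cvg_cst.
    by under eq_fun do rewrite expr2; apply: cvgM; exact: continuous_cos.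
  + have c : continuous (fun x : R => x + sin x * cos x).
      by move=> x; apply: cvgD; [exact: cvg_id|apply: cvgM; [exact: continuous_sin|exact: continuous_cos]].
    split; [|exact/cvg_at_right_filter/c|exact/cvg_at_left_filter/c].
    move=> x _; apply: derivableD; first exact: derivable_id.
    by apply: derivableM.
  + by move=> x _; rewrite derive1E derive_val /GRing.scale /=; have := cos2Dsin2 x; rewrite !expr2; lra.
- lra.
- by move=> x y xi yi xy; rewrite ltr_sin.
- by rewrite dsin => x _; exact: continuous_cos.
- rewrite dsin; apply/cvg_ex; exists (cos (- (pi / 2))); exact/cvg_at_right_filter/continuous_cos.
- rewrite dsin; apply/cvg_ex; exists (cos (pi / 2)); exact/cvg_at_left_filter/continuous_cos.
- split; [by move=> x _; exact: derivable_sin|exact/cvg_at_right_filter/continuous_sin|exact/cvg_at_left_filter/continuous_sin].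
- by apply: continuous_subspaceT; exact: continuous_half_chord.
Qed.

Definition rhok (k : nat) : R := 1 - k.+1%:R^-1.

Lemma rhok_ge0 k : 0 <= rhok k.
Proof. by rewrite subr_ge0 invf_le1// ler1n. Qed.

Lemma rhok_lt1 k : rhok k < 1.
Proof. by rewrite ltrBlDr ltrDl invr_gt0. Qed.

Lemma rhok_cvg : rhok @ \oo --> (1 : R).
Proof.
rewrite -[X in _ --> X]subr0; apply: cvgB; first exact: cvg_cst.
exact: cvg_harmonic.
Qed.

Lemma rhokX_cvg n : (fun k => rhok k ^+ n) @ \oo --> (1 : R).
Proof.
elim: n => [|n IH]; first by under eq_fun do rewrite expr0; exact: cvg_cst.
under eq_fun do rewrite exprS.
by have h := cvgM rhok_cvg IH; rewrite mulr1 in h; exact: h.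
Qed.

(** Dominated convergence for the restrictions of u to the closed disks of radius [rhok k], with |u|
    as dominating function. *)
Lemma Rint_limit (u : R * R -> R) : (@area R).-integrable D (EFin \o u) ->
  (fun k => Rintegral (@area R) (dcl (rhok k)) u) @ \oo --> Rintegral (@area R) D u.
Proof.
move=> iu; have mD := @measurable_disk2 R.
have mdk k := measurable_dcl (rhok k).
have sub k : dcl (rhok k) `<=` D by apply: dcl_sub; [exact: rhok_ge0|exact: rhok_lt1].
pose f_ k := (EFin \o u) \_ (dcl (rhok k)).
have mu : measurable_fun D (EFin \o u) by exact: measurable_int iu.
have mf_ k : measurable_fun D (f_ k).
  apply/(measurable_restrict _ (mdk k) mD).
  by apply: measurable_funS mu => //; exact: subIsetr.
have cf : {ae (@area R), forall p, D p -> f_ ^~ p @ \oo --> (EFin \o u) p}.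
  apply: aeW => p Dp; apply: cvg_near_cst.
  have h : \forall k \near \oo, p.1 ^+ 2 + p.2 ^+ 2 < rhok k ^+ 2.
    by move/diskE : Dp => Dp; move: (rhokX_cvg 2) => /cvgr_gt /(_ _ Dp).
  by apply: filterS h => k pk; rewrite /f_ /patch mem_set//= /dcl /= ltW.
have iabs : (@area R).-integrable D (abse \o (EFin \o u)) by exact: integrable_abse.
have dom : {ae (@area R), forall p k, D p -> (`|f_ k p| <= (abse \o (EFin \o u)) p)%E}.
  apply: aeW => p k Dp; rewrite /f_ /patch; case: ifP => // _.
  by rewrite abse0 abse_ge0.
have [_ _ H] := dominated_convergence mD mf_ mu cf iabs dom.
have E k : (\int[@area R]_(p in D) f_ k p)%E = (\int[@area R]_(p in dcl (rhok k)) (u p)%:E)%E.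
  by rewrite /f_ -integral_mkcondr setIidr.
apply: fine_cvg; rewrite fineK; last exact: integrable_fin_num.
under eq_fun do rewrite -E.
exact: H.
Qed.

End Area.

(** * Power series and the identity theorem *)

Section IdentityTheorem.
Variable R : realType.
Local Notation C := R[i].
Implicit Types (F G : C -> C) (a b : nat -> C) (c z w l : C) (u v : nat -> C).
Local Notation Re := (@complex.Re R).
Local Notation Im := (@complex.Im R).

Definition clim u l := forall e : R, 0 < e -> exists N, forall n, (N <= n)%N -> normc (u n - l) <= e.

Lemma clim_unique u l l' : clim u l -> clim u l' -> l = l'.
Proof.
move=> h h'; apply/eqP; rewrite -subr_eq0; apply/eqP/normc_eq0/eqP.
rewrite eq_le normc_ge0 andbT; apply/ler_addgt0Pr => e e0; rewrite add0r.
have e20 : 0 < e / 2 by lra.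
have [N hN] := h _ e20; have [N' hN'] := h' _ e20.
have := hN _ (leq_addr N' N); have := hN' _ (leq_addl N N').
rewrite (_ : l - l' = - (u (N + N')%N - l) + (u (N + N')%N - l')); last by ring.
by have := normcD_le (- (u (N + N')%N - l)) (u (N + N')%N - l'); rewrite normcNR; lra.
Qed.

Lemma clim_cst c : clim (fun=> c) c.
Proof. by move=> e e0; exists 0%N => n _; rewrite subrr normc0 ltW. Qed.

Lemma clim_eq u v l : u =1 v -> clim u l -> clim v l.
Proof. by move=> uv h e e0; have [N hN] := h e e0; exists N => n nN; rewrite -uv hN. Qed.

Lemma clim_add u v l l' : clim u l -> clim v l' -> clim (fun n => u n + v n) (l + l').
Proof.
move=> h h' e e0; have e20 : 0 < e / 2 by lra.
have [N hN] := h _ e20; have [N' hN'] := h' _ e20.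
exists (N + N')%N => n nN.
have := hN n (leq_trans (leq_addr _ _) nN); have := hN' n (leq_trans (leq_addl _ _) nN).
rewrite (_ : u n + v n - (l + l') = (u n - l) + (v n - l')); last by ring.
by have := normcD_le (u n - l) (v n - l'); lra.
Qed.

Lemma clim_scale c u l : clim u l -> clim (fun n => c * u n) (c * l).
Proof.
move=> h e e0; have c1 : 0 < normc c + 1 by rewrite ltr_wpDl// normc_ge0.
have [N hN] := h _ (divr_gt0 e0 c1); exists N => n nN.
rewrite -mulrBr normcM; apply: (@le_trans _ _ ((normc c + 1) * (e / (normc c + 1)))).
  by rewrite ler_pM ?normc_ge0 ?hN// lerDl.
by rewrite mulrC divfK// gt_eqF.
Qed.

Lemma clim_sum N (u : nat -> nat -> C) (l : nat -> C) : (forall k, clim (u k) (l k)) ->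
  clim (fun n => \sum_(k < N) u k n) (\sum_(k < N) l k).
Proof.
move=> h; elim: N => [|N IH].
  by rewrite big_ord0; apply: clim_eq (clim_cst 0) => n; rewrite big_ord0.
rewrite big_ord_recr /=; apply: clim_eq (clim_add IH (h N)) => n.
by rewrite big_ord_recr.
Qed.

Lemma clim_bound u l c (B : R) : clim u l -> (forall n, normc (u n - c) <= B) -> normc (l - c) <= B.
Proof.
move=> h hB; apply/ler_addgt0Pr => e e0; have [N hN] := h e e0.
have := hN N (leqnn N); have := hB N.
rewrite (_ : l - c = (u N - c) + - (u N - l)); last by ring.
by have := normcD_le (u N - c) (- (u N - l)); rewrite normcNR; lra.
Qed.

Lemma clim_real (u : nat -> C) (x y : R) : (fun n => Re (u n)) @ \oo --> x ->
  (fun n => Im (u n)) @ \oo --> y -> clim u (x +i* y).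
Proof.
move=> hx hy e e0; have e20 : 0 < e / 2 by lra.
have [N _ hN] := (cvgrPdist_le _ _).1 hx _ e20.
have [N' _ hN'] := (cvgrPdist_le _ _).1 hy _ e20.
exists (N + N')%N => n nN.
have h1 := hN n (leq_trans (leq_addr _ _) nN); have h2 := hN' n (leq_trans (leq_addl _ _) nN).
have -> : u n - (x +i* y) = (Re (u n) - x)%:C + (Im (u n) - y)%:C * (Complex 0 1).
  by case: (u n) => p q; apply/eqP; rewrite eq_complex /=; apply/andP; split; apply/eqP; ring.
apply: le_trans (normcD_le _ _) _; rewrite normcM /= !expr0n /= !addr0 add0r expr1n sqrtr1 mulr1.
rewrite !sqrtr_sqr; rewrite /= distrC in h1; rewrite /= distrC in h2; lra.
Qed.

Lemma geo_tail (q : R) N n : 0 <= q -> q < 1 -> \sum_(N <= k < N + n) q ^+ k <= q ^+ N / (1 - q).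
Proof.
move=> q0 q1; have q1' : 0 < 1 - q by lra.
rewrite ler_pdivlMr//; elim: n => [|n IH].
  by rewrite addn0 big_geq// mul0r exprn_ge0.
have H : forall n, (\sum_(N <= k < N + n) q ^+ k) * (1 - q) = q ^+ N - q ^+ (N + n).
  elim=> [|j IHj]; first by rewrite addn0 big_geq// mul0r subrr.
  by rewrite addnS big_nat_recr ?leq_addr//= mulrDl IHj exprS; ring.
by rewrite H lerBlDr lerDl exprn_ge0.
Qed.

Lemma geo_series (c : nat -> C) (M q : R) : 0 <= q -> q < 1 -> 0 <= M ->
  (forall k, normc (c k) <= M * q ^+ k) -> exists l, clim (fun n => \sum_(k < n) c k) l.
Proof.
move=> q0 q1 M0 hc.
have gs : cvgn (series (fun k => M * q ^+ k)).
  by apply: is_cvg_geometric_series; rewrite ger0_norm.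
have cr (f : nat -> R) : (forall k, `|f k| <= M * q ^+ k) -> cvgn (series f).
  move=> hf; apply: normed_cvg; apply: (series_le_cvg _ _ _ gs) => [k|k|k] /=.
  - exact: normr_ge0.
  - by rewrite mulr_ge0// exprn_ge0.
  - exact: hf.
have c1 := cr _ (fun k => le_trans (abs_Re_le (c k)) (hc k)).
have c2 := cr _ (fun k => le_trans (abs_Im_le (c k)) (hc k)).
exists (limn (series (fun k => Re (c k))) +i* limn (series (fun k => Im (c k)))).
have Rs n : Re (\sum_(k < n) c k) = series (fun k => Re (c k)) n.
  rewrite /series /= big_mkord; elim: n => [|n IH]; first by rewrite !big_ord0.
  by rewrite !big_ord_recr cReD IH.
have Is n : Im (\sum_(k < n) c k) = series (fun k => Im (c k)) n.
  rewrite /series /= big_mkord; elim: n => [|n IH]; first by rewrite !big_ord0.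
  by rewrite !big_ord_recr cImD IH.
by apply: clim_real; [under eq_fun do rewrite Rs|under eq_fun do rewrite Is].
Qed.

Lemma binom_le (x y : R) (n m : nat) : 0 <= x -> 0 <= y ->
  x ^+ (n - m) * y ^+ m *+ 'C(n, m) <= (x + y) ^+ n.
Proof.
move=> x0 y0; have [mn|nm] := leqP m n; last first.
  by rewrite bin_small// mulr0n exprn_ge0// addr_ge0.
have mn' : (m < n.+1)%N by [].
rewrite exprDn (bigD1 (Ordinal mn'))//= lerDl sumr_ge0// => i _.
by rewrite mulrn_wge0// mulr_ge0// exprn_ge0.
Qed.

(** Rearrangement of the double series of a_n (z0 + h)^n. The radius r = (1 - s) / 3 leaves room for
    x = s + 2 r < 1, where a_n x^n is bounded; the geometric series of ratio (s + r) / x then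
    dominates everything. *)
Lemma recenter F a z0 : has_ps F 0 1 a -> normc z0 < 1 ->
  exists2 r : R, 0 < r & exists b, has_ps F z0 r b.
Proof.
move=> h z01; set s := normc z0 in z01; have s0 : 0 <= s := normc_ge0 z0.
pose r := (1 - s) / 3; have r0 : 0 < r by rewrite /r; lra.
pose x := s + 2 * r; have x0 : 0 < x by rewrite /x; lra.
have x1 : x < 1 by rewrite /x /r; lra.
have [M M0 hM] := has_ps_bound h (ltW x0) x1.
pose q := (s + r) / x.
have q0 : 0 <= q by rewrite divr_ge0 ?(ltW x0)//; lra.
have q1 : q < 1 by rewrite ltr_pdivrMr// mul1r /x; lra.
have aq n : normc (a n) * (s + r) ^+ n <= M * q ^+ n.
  rewrite /q exprMn exprVn [leRHS]mulrCA [leLHS]mulrC ler_wpM2l ?exprn_ge0//; first by lra.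
  by rewrite ler_pdivlMr ?exprn_gt0.
pose t m n := a n * (z0 ^+ (n - m) *+ 'C(n, m)).
have tb m n : normc (t m n) * r ^+ m <= M * q ^+ n.
  apply: le_trans (aq n); rewrite normcM -mulrA ler_wpM2l ?normc_ge0//.
  rewrite -mulr_natr normcM normcX (_ : normc 'C(n, m)%:R = 'C(n, m)%:R); last first.
    by rewrite -rcn normc_real.
  by rewrite mulrAC mulr_natr; exact: binom_le (ltW r0).
have hb m : exists l, clim (fun n => \sum_(k < n) t m k) l.
  apply: (@geo_series _ (M / r ^+ m) q) => //.
    by rewrite divr_ge0 ?exprn_ge0// ltW.
  by move=> k; rewrite mulrAC ler_pdivlMr ?exprn_gt0.
have [b hbl] : {b : nat -> C & forall m, clim (fun n => \sum_(k < n) t m k) (b m)}.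
  by apply: (@choice _ _ (fun m l => clim (fun n => \sum_(k < n) t m k) l)).
exists r => //; exists b => z zr.
set hh := z - z0 in zr *.
have zz1 : normc (z - 0) < 1.
  by rewrite subr0; have := normcB_le z z0; rewrite -/s -/hh /r in zr *; lra.
(* Both sides are compared at a finite truncation n of the series in a, with a bound independent of
   n; [clim_bound] then lets n tend to infinity, so that infinite sums are not exchanged. *)
have key K : normc (psum b K hh - F z) <= M * (q ^+ K / (1 - q)).
  have c1 : clim (fun n => \sum_(m < K) hh ^+ m * \sum_(k < n) t m k) (\sum_(m < K) hh ^+ m * b m).
    by apply: (@clim_sum _ (fun m n => hh ^+ m * \sum_(k < n) t m k) (fun m => hh ^+ m * b m)) => m; exact: clim_scale.
  have c2 : clim (fun n => psum a n z) (F z).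
    by have := h z zz1; rewrite subr0.
  have c3 := clim_add c1 (clim_scale (-1) c2).
  have -> : psum b K hh - F z = \sum_(m < K) hh ^+ m * b m + -1 * F z - 0.
    rewrite subr0 mulN1r; congr (_ - _); rewrite /psum; apply: eq_bigr => m _.
    by rewrite mulrC.
  apply: (clim_bound c3) => n; rewrite subr0.
  have -> : \sum_(m < K) hh ^+ m * \sum_(k < n) t m k + -1 * psum a n z =
     \sum_(k < n) a k * (\sum_(m < K) (z0 ^+ (k - m) * hh ^+ m *+ 'C(k, m)) - z ^+ k).
    rewrite mulN1r /psum; under [RHS]eq_bigr do rewrite mulrBr.
    rewrite sumrB; congr (_ - _); under eq_bigr do rewrite mulr_sumr.
    rewrite exchange_big /=; apply: eq_bigr => k _; rewrite mulr_sumr.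
    by apply: eq_bigr => m _; rewrite /t mulrCA mulrnAr [_ ^+ m * _]mulrC.
  have zE k : z ^+ k = \sum_(m < k.+1) (z0 ^+ (k - m) * hh ^+ m *+ 'C(k, m)).
    by rewrite -exprDn /hh addrC subrK.
  (* Below K the binomial expansion is complete and the difference vanishes; from K on, the missing
     terms are dominated by part of the expansion of (s + r)^k. *)
  have small k : (k < K)%N -> \sum_(m < K) (z0 ^+ (k - m) * hh ^+ m *+ 'C(k, m)) = z ^+ k.
    move=> kK; rewrite [RHS]zE [RHS](big_ord_widen K (fun m => z0 ^+ (k - m) * hh ^+ m *+ 'C(k, m)))//.
    rewrite [RHS]big_mkcond /=; apply: eq_bigr => m _; case: ifPn => //.
    by rewrite -leqNgt => km; rewrite bin_small.
  have large k : (K <= k)%N -> normc (\sum_(m < K) (z0 ^+ (k - m) * hh ^+ m *+ 'C(k, m)) - z ^+ k)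
      <= (s + r) ^+ k.
    move=> kK; rewrite zE.
    have -> : \sum_(m < K) (z0 ^+ (k - m) * hh ^+ m *+ 'C(k, m)) -
       \sum_(m < k.+1) (z0 ^+ (k - m) * hh ^+ m *+ 'C(k, m)) =
       - \sum_(m < k.+1 | ~~ (m < K)%N) (z0 ^+ (k - m) * hh ^+ m *+ 'C(k, m)).
      rewrite (big_ord_widen k.+1 (fun m => z0 ^+ (k - m) * hh ^+ m *+ 'C(k, m))) ?leqW//.
      by rewrite [X in _ - X](bigID (fun m : 'I_k.+1 => (m < K)%N)) /=; ring.
    rewrite normcNR exprDn; apply: (@le_trans _ _ (\sum_(m < k.+1 | ~~ (m < K)%N)
        normc (z0 ^+ (k - m) * hh ^+ m *+ 'C(k, m)))).
      rewrite -big_filter -[leRHS]big_filter; exact: normc_sum.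
    rewrite big_mkcond /=; apply: ler_sum => m _; case: ifP => _; last first.
      by rewrite mulrn_wge0// mulr_ge0 ?exprn_ge0// ltW.
    rewrite -mulr_natr normcM -rcn normc_real// mulr_natr lerMn2r; apply/orP; right.
    rewrite normcM !normcX; apply: ler_pM; rewrite ?exprn_ge0 ?normc_ge0//.
    by apply: lerXn2r; rewrite ?nnegrE ?normc_ge0 ?(ltW r0) ?(ltW zr).
  apply: le_trans (normc_sum _ _) _.
  apply: (@le_trans _ _ (\sum_(K <= k < K + n) M * q ^+ k)); last first.
    by rewrite -mulr_sumr ler_wpM2l ?(ltW M0) ?geo_tail.
  have [nK|Kn] := leqP n K.
    rewrite big1; last by move=> k _; rewrite small ?subrr ?mulr0 ?normc0// (leq_trans _ nK).
    by apply: sumr_ge0 => k _; rewrite mulr_ge0 ?exprn_ge0// ltW.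
  rewrite -(big_mkord xpredT (fun k => normc (a k * (\sum_(m < K) (z0 ^+ (k - m) * hh ^+ m *+ 'C(k, m)) - z ^+ k)))).
  rewrite (big_cat_nat _ (n := K))//=; last exact: ltnW.
  rewrite big_nat big1 ?add0r; last first.
    by move=> k /andP[_ kK]; rewrite small ?subrr ?mulr0 ?normc0.
  apply: (@le_trans _ _ (\sum_(K <= k < n) M * q ^+ k)).
    rewrite big_nat [leRHS]big_nat; apply: ler_sum => k /andP[Kk _].
    rewrite normcM; apply: le_trans (aq k); rewrite ler_wpM2l ?normc_ge0//; exact: large.
  have -> : \sum_(K <= k < K + n) M * q ^+ k =
      \sum_(K <= k < n) M * q ^+ k + \sum_(n <= k < K + n) M * q ^+ k.
    by rewrite -(@big_cat_nat _ _ _ n)// ?leq_addl// ltnW.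
  rewrite lerDl.
  by apply: sumr_ge0 => k _; rewrite mulr_ge0 ?exprn_ge0// ltW.
move=> e e0; have q1' : 0 < 1 - q by lra.
have [N hN] : exists N, forall n, (N <= n)%N -> q ^+ n <= e * (1 - q) / M.
  have := @cvg_expr R q; rewrite ger0_norm// => /(_ q1) /cvgrPdist_le.
  have E0 : 0 < e * (1 - q) / M by rewrite divr_gt0// mulr_gt0.
  move=> /(_ _ E0) [N _ hN]; exists N => n nN.
  by have := hN n nN; rewrite /= sub0r normrN ger0_norm// exprn_ge0.
exists N => n nN; apply: le_trans (key n) _.
rewrite mulrA ler_pdivrMr// mulrC -ler_pdivlMr//; exact: hN.
Qed.

Lemma has_ps_unique F G z0 r a : has_ps F z0 r a -> has_ps G z0 r a ->
  forall z, normc (z - z0) < r -> F z = G z.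
Proof. by move=> hF hG z zr; apply: clim_unique (hF z zr) (hG z zr). Qed.

Lemma has_ps_lin F G z0 r a b c : has_ps F z0 r a -> has_ps G z0 r b ->
  has_ps (fun z => c * F z + G z) z0 r (fun n => c * a n + b n).
Proof.
move=> hF hG z zr; have := clim_add (clim_scale c (hF z zr)) (hG z zr).
apply: clim_eq => n; rewrite /psum mulr_sumr -big_split /=.
by apply: eq_bigr => k _; rewrite mulrDl mulrA.
Qed.

(** If b_m is the first nonzero coefficient, F is (z - z0)^m times a function that takes the value
    b_m at z0 and is Lipschitz there, hence has no zero nearby. *)
Lemma ps_dichotomy F z0 r b : 0 < r -> has_ps F z0 r b ->
  (forall z, normc (z - z0) < r -> F z = 0) \/
  exists2 d : R, 0 < d & forall z, z != z0 -> normc (z - z0) < d -> F z != 0.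
Proof.
move=> r0 h; have [bz|] := pselect (forall n, b n = 0).
  left=> z zr; apply: clim_unique (h z zr) _; apply: clim_eq (clim_cst 0) => n.
  by rewrite /psum big1// => k _; rewrite bz mul0r.
move=> /existsNP [n0 /eqP bn0]; right.
have ex : exists n, b n != 0 by exists n0.
have [m bm mmin] := ex_minnP ex.
pose G w := F (z0 + w).
have hG : has_ps G 0 r b.
  move=> w; rewrite subr0 => wr.
  by have := h (z0 + w); rewrite addrAC subrr add0r; exact.
have hq := quot_ps m r0 hG; have sq := sdiff_ps r0 hq.
have [d d0 hd] := sdiff_lip sq.
have nb : 0 < normc (b m).
  by rewrite lt_neqAle normc_ge0 andbT eq_sym; apply: contra bm => /eqP/normc_eq0/eqP.
set K := normc _ + 1 in hd.
have K0 : 0 < K by rewrite ltr_wpDl// normc_ge0.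
exists (Num.min d (normc (b m) / K)); first by rewrite lt_min d0 divr_gt0.
move=> z zz0; rewrite lt_min => /andP[zd zb].
have := hd (z - z0); rewrite subr0 => /(_ zd) hz.
have q0 : quot G b m 0 = b m by rewrite /quot eqxx.
have qn : quot G b m (z - z0) != 0.
  apply/eqP => qz; move: hz; rewrite qz q0 sub0r normcNR.
  by move: zb; rewrite ltr_pdivlMr// mulrC => h1 h2; have := lt_le_trans h1 h2; rewrite ltxx.
have -> : F z = G (z - z0) by rewrite /G addrC subrK.
rewrite (quotE m (z - z0) r0 hG) /psum big1 ?add0r; last first.
  move=> k _; apply/eqP; rewrite mulf_eq0; apply/orP; left; apply/negPn/negP => /mmin.
  by rewrite leqNgt ltn_ord.
by rewrite mulf_neq0// expf_neq0// subr_eq0.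
Qed.

Definition analytic F := forall z0, disk z0 -> exists2 r : R, 0 < r & exists b, has_ps F z0 r b.

(* The set of t such that F vanishes on [0, t z1] is open and closed in [0, 1]. *)
Lemma identity_thm F r : analytic F -> 0 < r -> (forall z, normc z < r -> F z = 0) ->
  forall z, disk z -> F z = 0.
Proof.
move=> hF r0 F0 z1 /disk_normc z1d.
pose A := [set t : R | 0 <= t <= 1 /\ forall s, 0 <= s <= t -> F (s%:C * z1) = 0].
have A0 : A 0.
  split; first by rewrite lexx ler01.
  move=> s ss; have -> : s = 0 by lra.
  by rewrite mul0r F0// normc0.
have supA : has_sup A by split; [exists 0|exists 1 => t [] /andP[]].
set T := sup A.
have T1 : T <= 1 by apply: sup_le_ub; [exists 0|move=> t [] /andP[]].
have T0 : 0 <= T by exact: (sup_upper_bound supA).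
have below s : 0 <= s -> s < T -> F (s%:C * z1) = 0.
  move=> s0 sT; have [t [_ At] st] := sup_adherent (eps := T - s) ltac:(by rewrite subr_gt0) supA.
  by apply: At; rewrite s0 ltW//; move: st; rewrite -/T; lra.
have nz s : 0 <= s -> normc (s%:C * z1) = s * normc z1 by move=> s0; rewrite normcM normc_real.
have n1 := normc_ge0 z1.
have dz : disk (T%:C * z1).
  apply/disk_normc; rewrite nz//; apply: le_lt_trans z1d.
  by rewrite ler_piMl.
have Tpos : 0 < T.
  have [t [t0 t1 tr]] : exists t, [/\ 0 < t, t <= 1 & t < r].
    exists (Num.min 1 (r / 2)); rewrite lt_min ltr01 divr_gt0// ge_min lexx; split=> //.
    by apply: (@le_lt_trans _ _ (r / 2)); [rewrite ge_min lexx orbT|lra].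
  apply: (lt_le_trans t0); apply: (sup_upper_bound supA); split; first by rewrite t1 ltW.
  move=> s /andP[s0 st]; apply: F0; rewrite nz//; apply: le_lt_trans tr.
  by apply: (le_trans _ st); rewrite ler_piMr// ltW.
have [e e0 [b hb]] := hF _ dz.
have [z10|z10] := eqVneq z1 0; first by rewrite z10 F0// normc0.
have nz1 : 0 < normc z1.
  by rewrite lt_neqAle normc_ge0 andbT eq_sym; apply: contra z10 => /eqP/normc_eq0/eqP.
have dist s : normc (s%:C * z1 - T%:C * z1) = `|s - T| * normc z1.
  by rewrite -mulrBl normcM -rcB /= expr0n /= addr0 sqrtr_sqr.
have [Z|[d d0 Z]] := ps_dichotomy e0 hb; last first.
  pose s := Num.max 0 (T - d / 2).
  have s0 : 0 <= s by rewrite le_max lexx.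
  have sT : s < T by rewrite gt_max Tpos; lra.
  have sd : T - s <= d / 2.
    have h : T - d / 2 <= s by rewrite le_max lexx orbT.
    by lra.
  have := Z (s%:C * z1); rewrite dist below// eqxx => H.
  have : false; last by [].
  apply: H; first by apply/eqP => /(mulIf z10) [sTe]; move: sT; rewrite sTe ltxx.
  rewrite distrC gtr0_norm; last by rewrite subr_gt0.
  apply: (@le_lt_trans _ _ (d / 2)); last by lra.
  by apply: (le_trans _ sd); rewrite ler_piMr ?ltW// subr_gt0.
have [T_1|T_1] := eqVneq T 1.
  rewrite -[z1]mul1r (_ : (1 : C) = T%:C); last by rewrite T_1.
  by apply: Z; rewrite subrr normc0.
have T1' : T < 1 by rewrite lt_neqAle T_1.
have [t [Tt t1 te]] : exists t, [/\ T < t, t <= 1 & t - T < e].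
  exists (Num.min 1 (T + e / 2)); rewrite lt_min T1' ge_min lexx; split => //; first by lra.
  have : Num.min 1 (T + e / 2) <= T + e / 2 by rewrite ge_min lexx orbT.
  lra.
have : A t.
  split; first by rewrite t1 (le_trans T0)// ltW.
  move=> s /andP[s0 st]; have [sT|Ts] := ltP s T; first exact: below.
  apply: Z; rewrite dist ger0_norm ?subr_ge0//; apply: (@le_lt_trans _ _ (t - T)) => //.
  apply: (@le_trans _ _ (s - T)); last by lra.
  by rewrite ler_piMr ?subr_ge0// ltW.
by move=> /(sup_upper_bound supA); rewrite leNgt Tt.
Qed.

End IdentityTheorem.

(** * Coefficients in the Bergman space *)

Section BergmanMoments.
Variable R : realType.
Local Notation C := R[i].
Local Notation cj := (@conjc R).
Local Notation T2 := (measurableTypeR R * measurableTypeR R)%type.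
Local Notation D := (@disk2 R).
Local Notation Re := (@complex.Re R).
Local Notation Im := (@complex.Im R).
Implicit Types (f g h F G : C -> C) (a b : nat -> C) (z w : C).

Lemma clim_series (v : nat -> C) (l : C) :
  (series (v : nat -> C^o) @ \oo --> (l : C^o)) <-> clim (fun n => \sum_(k < n) v k) l.
Proof.
split.
  move=> /cvgrPdist_le h e e0; have e0' : (0 : C) < e%:C by rewrite ltcR.
  have [N _ hN] := h _ e0'; exists N => n nN; have := hN n nN.
  by rewrite /= /series /= big_mkord normcE lecR normc_subC.
move=> h; apply/cvgrPdist_le => e e0.
have [e1 e2] : 0 < Re e /\ e = (Re e)%:C.
  by move: e0; rewrite ltcE; case: e => x y /= /andP[/eqP-> ?].
have [N hN] := h _ e1; exists N => // n nN; have := hN n nN.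
by rewrite /= /series /= big_mkord e2 normcE lecR normc_subC.
Qed.

Lemma analyticE f : analytic_on_disk f <-> analytic f.
Proof.
split=> hf z0 /hf.
  move=> [r [a [r0 h]]]; exists r => //; exists a => z zr.
  by apply: (proj1 (clim_series (fun k => a k * (z - z0) ^+ k) (f z))); apply: h; rewrite normcE ltcR.
move=> [r r0 [a h]]; exists r, a; split=> // z; rewrite normcE ltcR => zr.
exact: (proj2 (clim_series (fun k => a k * (z - z0) ^+ k) (f z)) (h z zr)).
Qed.

Lemma analytic_lin (c : C) f g : analytic f -> analytic g -> analytic (c *: f + g).
Proof.
move=> hf hg z0 d0; have [r r0 [a ha]] := hf _ d0; have [s s0 [b hb]] := hg _ d0.
have [x [x0 xr xs]] : exists x, [/\ 0 < x, x <= r & x <= s].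
  by exists (Num.min r s); rewrite lt_min r0 s0 !ge_min !lexx orbT.
exists x => //; eexists; have := has_ps_lin c (has_psS xr ha) (has_psS xs hb); exact.
Qed.

Lemma analytic_hol f : analytic f -> hol f.
Proof. by move=> hf z dz; have [r r0 [a ha]] := hf _ dz; eexists; exact: sdiff_ps ha. Qed.

Lemma analytic_eq f g : (forall z, disk z -> f z = g z) -> analytic f -> analytic g.
Proof.
move=> fg hf z0 dz; have [r r0 [a ha]] := hf _ dz.
have z1 : 0 < 1 - normc z0 by rewrite subr_gt0; exact/disk_normc.
have [x [x0 xr x1]] : exists x, [/\ 0 < x, x <= r & x <= 1 - normc z0].
  by exists (Num.min r (1 - normc z0)); rewrite lt_min r0 z1 !ge_min !lexx orbT.
exists x => //; exists a => z zx; rewrite -fg; first exact: (has_psS xr ha).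
apply/disk_normc; rewrite -[z](subrK z0); apply: le_lt_trans (normcD_le _ _) _.
by rewrite -ltrBrDr; exact: lt_le_trans x1.
Qed.

Lemma ps_analytic F a : has_ps F 0 1 a -> analytic F.
Proof. by move=> h z0 /disk_normc hz; exact: recenter h hz. Qed.

Lemma bergman_lin (c : C) f g : bergman f -> bergman g -> bergman (c *: f + g).
Proof.
move=> [Lf Af] [Lg Ag]; split; first exact: L2_lin.
exact: (proj2 (analyticE _) (analytic_lin c (proj1 (analyticE f) Af) (proj1 (analyticE g) Ag))).
Qed.

Lemma bergman0 : bergman (0 : C -> C).
Proof.
split; first exact: L20.
apply/analyticE/(@ps_analytic _ (fun=> 0)) => z _; apply: clim_eq (clim_cst 0) => n.
by rewrite /psum big1// => k _; rewrite mul0r.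
Qed.

Lemma restrict_diskE f z : disk z -> restrict_disk f z = f z.
Proof. by rewrite /restrict_disk /disk /= => ->. Qed.

Lemma restrict_on_disk f : on_disk (restrict_disk f).
Proof. by move=> z; rewrite /restrict_disk /disk /=; case: ifP. Qed.

Lemma L2_bounded f : cmeas D f -> (forall p, D p -> normc (f (cplx p)) <= 1) -> L2 (restrict_disk f).
Proof.
move=> mf f1; have mD := @measurable_disk2 R.
have L1 : L2 (restrict_disk (fun=> 1 : C)).
  have m1 : cmeas D (restrict_disk (fun=> 1 : C)).
    apply: cmeas_eq (cmeas_cst D 1) => // p Dp; rewrite restrict_diskE//.
  apply: L2P => //; first exact: restrict_on_disk.
  have := (@cint_cst R D 1 mD); rewrite -{1}drho1 => /(_ (area_drho_fin 1))[+ _].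
  apply: eq_integrable => // p; rewrite inE => Dp /=.
  by rewrite restrict_diskE// /cre /= expr1n expr0n /= addr0 sqrtr1 expr1n.
have := L2_mul L1 mf f1; congr L2; apply/funext => z.
by rewrite /restrict_disk; case: ifP; rewrite ?mulr1 ?mulr0.
Qed.

Definition mono n : C -> C := restrict_disk (fun z => z ^+ n).

Lemma disk_exp_le1 n (z : C) : disk z -> normc (z ^+ n) <= 1.
Proof. by move=> /disk_normc h; rewrite normcX exprn_ile1 ?normc_ge0// ltW. Qed.

Lemma mono_L2 n : L2 (mono n).
Proof.
apply: L2_bounded; last by move=> p Dp; exact: disk_exp_le1.
by apply: cmeas_exp; [|apply: cmeas_id]; exact: measurable_disk2.
Qed.

Lemma mono_ps n : has_ps (fun z => z ^+ n) 0 1 (fun k => (k == n)%:R).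
Proof.
move=> z _ e e0; exists n.+1 => m nm; rewrite subr0.
rewrite /psum (bigD1 (Ordinal nm)) //= eqxx mul1r big1 ?addr0 ?subrr ?normc0 ?ltW//.
by move=> i /negPf; rewrite -val_eqE /= => ->; rewrite mul0r.
Qed.

Lemma mono_bergman n : bergman (mono n).
Proof.
split; first exact: mono_L2.
apply/analyticE/(analytic_eq _ (ps_analytic (mono_ps n))) => z dz.
by rewrite /mono restrict_diskE.
Qed.

Lemma bergman_ps h : bergman h -> hol h /\ exists2 r : R, 0 < r & exists a, has_ps h 0 r a.
Proof.
move=> [_ /analyticE hA]; split; first exact: analytic_hol.
by apply: hA; apply/disk_normc; rewrite normc0.
Qed.

Lemma cI_limit f : cint D f -> clim (fun k => cI (dcl (rhok R k)) f) (cI D f).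
Proof. by move=> [i1 i2]; apply: clim_real; exact: Rint_limit. Qed.

Lemma carea_limit n : clim (fun k => (rhok R k ^+ n)%:C * carea (rhok R k)) (pi%:C).
Proof.
have mD := @measurable_disk2 R.
have i1 : cint D (fun=> 1) by apply: cint_cst => //; rewrite -drho1; exact: area_drho_fin.
have E1 : Rintegral (@area R) D (cre (fun=> 1)) = pi.
  transitivity (fine (area (D : set T2))); last by rewrite area_disk.
  by rewrite /Rintegral (eq_integral (cst 1%:E)) // integral_cst// mul1e.
have i0 (S : set T2) : Rintegral (@area R) S (cim (fun=> 1)) = 0.
  by rewrite /Rintegral integral0_eq.
have H k : (rhok R k ^+ n)%:C * carea (rhok R k) =
    (rhok R k ^+ n * Rintegral (@area R) (dcl (rhok R k)) (cre (fun=> 1)))%:C.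
  rewrite rcM; congr (_ * _); rewrite /carea /cI /=.
  by rewrite i0.
apply: clim_eq (fun k => esym (H k)) _; apply: clim_real => /=.
  rewrite -[X in _ --> X]mul1r -E1; apply: cvgM; first exact: rhokX_cvg.
  by case: i1 => i1 _; exact: Rint_limit.
exact: cvg_cst.
Qed.

Lemma cint_mono h m n : L2 h -> cint D (fun z => z ^+ m * h z * cj z ^+ n).
Proof.
move=> Lh; have mD := @measurable_disk2 R.
have L1 : L2 (fun z => z ^+ m * h z).
  apply: L2_mul => //; first by apply: cmeas_exp => //; exact: cmeas_id.
  by move=> p; exact: disk_exp_le1.
apply: cint_eq (L2_cint L1 (mono_L2 n)) => // p Dp.
by rewrite /mono restrict_diskE// conjcX.
Qed.

(** [mom_ps] holds on closed disks of radius less than 1; square integrability of h lets the radii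
    tend to 1. *)
Lemma bergman_moment h r a m n : bergman h -> 0 < r -> has_ps h 0 r a ->
  n.+1%:R * cI D (fun z => z ^+ m * h z * cj z ^+ n) =
  if (m <= n)%N then a (n - m)%N * pi%:C else 0.
Proof.
move=> bh r0 ha; have [hh _] := bergman_ps bh; have [Lh _] := bh.
have c1 := clim_scale n.+1%:R (cI_limit (cint_mono m n Lh)).
have E k := mom_ps m n (rhok_ge0 R k) (rhok_lt1 R k) hh r0 ha.
apply: (clim_unique c1); apply: clim_eq (fun k => esym (E k)) _.
case: ifP => _; last exact: clim_cst.
exact: clim_scale (carea_limit _).
Qed.

Lemma ip_mono h r a m n : bergman h -> 0 < r -> has_ps h 0 r a ->
  ip (fun z => z ^+ m * h z) (mono n) =
  if (m <= n)%N then a (n - m)%N / n.+1%:R else 0.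
Proof.
move=> bh r0 ha; have := bergman_moment m n bh r0 ha.
rewrite ipE (@cI_eq _ _ _ (fun z => z ^+ m * h z * cj z ^+ n)); last first.
  by move=> p Dp; rewrite /mono restrict_diskE// conjcX.
have n0 : (n.+1%:R : C) != 0 by rewrite pnatr_eq0.
have pi0 : (pi : R)%:C != 0 :> C by apply/eqP => -[] /eqP; rewrite gt_eqF ?pi_gt0.
set I := cI _ _ => E; have -> : I = (if (m <= n)%N then a (n - m)%N * (pi : R)%:C else 0) / n.+1%:R.
  by rewrite -E mulrAC divff// mul1r.
case: ifP => _; last by rewrite mul0r mulr0.
by rewrite rcV mulrA mulrCA mulVf// mulr1.
Qed.

End BergmanMoments.

Section Basis.
Variable R : realType.
Local Notation C := R[i].
Local Notation V := (C -> C).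
Local Notation e := (@e_ R).
Implicit Types (f g h F G : C -> C) (a b c : nat -> C) (z w : C).

Definition coef f n : C := ip f (e n).
Definition sq n : C := (Num.sqrt n.+1%:R)%:C.

Lemma sq_neq0 n : sq n != 0.
Proof. by apply/eqP => -[] /eqP; rewrite sqrtr_eq0 leNgt ltr0n. Qed.

Lemma sq2 n : sq n * sq n = n.+1%:R.
Proof. by rewrite -rcM -expr2 sqr_sqrtr ?ler0n// rcn. Qed.

Lemma e_E n : e n = sq n *: @mono R n.
Proof.
apply/funext => z; rewrite /e_ /mono /restrict_disk.
by change ((if `|z| < 1 then sq n * z ^+ n else 0) = sq n * (if `|z| < 1 then z ^+ n else 0));
  case: ifP => //; rewrite mulr0.
Qed.

Lemma e_bergman n : bergman (e n).
Proof.
by have := bergman_lin (sq n) (@mono_bergman R n) (@bergman0 R); rewrite addr0 -e_E.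
Qed.

Lemma e_L2 n : L2 (e n). Proof. by have [] := e_bergman n. Qed.

Lemma bergmanL f : bergman f -> L2 f. Proof. by case. Qed.

Lemma bergmanZ (x : C) f : bergman f -> bergman (x *: f).
Proof. by move=> bf; have := bergman_lin x bf (@bergman0 R); rewrite addr0. Qed.

Lemma bergmanD f g : bergman f -> bergman g -> bergman (f + g).
Proof. by move=> bf bg; have := bergman_lin 1 bf bg; rewrite scale1r. Qed.

Lemma bergmanN f : bergman f -> bergman (- f).
Proof. by move=> /(bergmanZ (-1)); rewrite scaleN1r. Qed.

Lemma bergmanB f g : bergman f -> bergman g -> bergman (f - g).
Proof. by move=> bf bg; exact: bergmanD bf (bergmanN bg). Qed.

Lemma bergman_sum (I : Type) (r : seq I) (F : I -> V) :
  (forall i, bergman (F i)) -> bergman (\sum_(i <- r) F i).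
Proof.
by move=> h; elim: r => [|i r IH]; rewrite ?big_nil ?big_cons; [exact: bergman0|exact: (bergmanD (h i) IH)].
Qed.

Lemma ip_zmul_e h r a m n : bergman h -> 0 < r -> has_ps h 0 r a ->
  ip (fun z => z ^+ m * h z) (e n) = if (m <= n)%N then a (n - m)%N / sq n else 0.
Proof.
move=> bh r0 ha; rewrite e_E ipZr; [|exact: mono_L2|]; last first.
  apply: L2_mul; first by case: bh.
  - by apply: cmeas_exp; [|apply: cmeas_id]; exact: measurable_disk2.
  - by move=> p; exact: disk_exp_le1.
rewrite (ip_mono m n bh r0 ha) conjcR; case: ifP => _; last by rewrite mulr0.
by rewrite -sq2 invfM mulrCA mulrA mulrA mulfK ?sq_neq0// mulrC.
Qed.

Lemma coef_ps h r a n : bergman h -> 0 < r -> has_ps h 0 r a -> coef h n = a n / sq n.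
Proof.
move=> bh r0 ha; have E : (fun z => z ^+ 0 * h z) = h.
  by apply/funext => z; rewrite expr0 mul1r.
by have := ip_zmul_e 0 n bh r0 ha; rewrite E /= subn0.
Qed.

Lemma coefD f g n : bergman f -> bergman g -> coef (f + g) n = coef f n + coef g n.
Proof. by move=> /bergmanL Lf /bergmanL Lg; apply: ipDl => //; exact: e_L2. Qed.

Lemma coefB f g n : bergman f -> bergman g -> coef (f - g) n = coef f n - coef g n.
Proof. by move=> /bergmanL Lf /bergmanL Lg; apply: ipBl => //; exact: e_L2. Qed.

Lemma coefZ x f n : bergman f -> coef (x *: f) n = x * coef f n.
Proof. by move=> /bergmanL Lf; apply: ipZl => //; exact: e_L2. Qed.

Lemma coef0 n : coef 0 n = 0. Proof. by apply: ip0l; exact: e_L2. Qed.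

Lemma coef_sum (I : Type) (r : seq I) (F : I -> V) n : (forall i, bergman (F i)) ->
  coef (\sum_(i <- r) F i) n = \sum_(i <- r) coef (F i) n.
Proof.
move=> h; elim: r => [|i r IH]; first by rewrite !big_nil coef0.
by rewrite !big_cons coefD ?IH//; exact: bergman_sum.
Qed.

Lemma e_ps n : has_ps (e n) 0 1 (fun k => sq n * (k == n)%:R).
Proof.
move=> z zr; have -> : e n z = sq n * z ^+ n.
  by rewrite /e_ restrict_diskE//; apply/disk_normc; rewrite -[z]subr0.
apply: clim_eq (clim_scale (sq n) (mono_ps n zr)) => m.
by rewrite /psum mulr_sumr; apply: eq_bigr => k _; rewrite mulrA.
Qed.

Lemma coef_e m n : coef (e m) n = (m == n)%:R.
Proof.
rewrite (coef_ps n (e_bergman m) ltr01 (e_ps m)) eq_sym; case: eqVneq => [->|_].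
  by rewrite mulr1 divff ?sq_neq0.
by rewrite mulr0 mul0r.
Qed.

Lemma nrm_e n : nrm (e n) = 1.
Proof. by rewrite /nrm -/(coef _ _) coef_e eqxx /= sqrtr1. Qed.

Lemma coef_inj f : bergman f -> (forall n, coef f n = 0) -> f = 0.
Proof.
move=> bf h; have [hf [r r0 [a ha]]] := bergman_ps bf.
have az n : a n = 0.
  by move/eqP: (coef_ps n bf r0 ha); rewrite h eq_sym mulf_eq0 invr_eq0 (negPf (sq_neq0 _)) orbF => /eqP.
have [[od _ _ _] /analyticE Af] := bf.
apply/funext => z; have [dz|/od//] := pselect (disk z).
apply: (identity_thm Af r0) dz => w wr; rewrite -[w]subr0 in wr.
apply: clim_unique (ha w wr) _; apply: clim_eq (clim_cst 0) => n.
by rewrite /psum big1// => k _; rewrite az mul0r.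
Qed.

Lemma coef_ext f g : bergman f -> bergman g -> (forall n, coef f n = coef g n) -> f = g.
Proof.
move=> bf bg h; apply/eqP; rewrite -subr_eq0; apply/eqP/coef_inj; first exact: bergmanB.
by move=> n; rewrite coefB// h subrr.
Qed.

Lemma coef_le f n : bergman f -> normc (coef f n) <= nrm f.
Proof.
move=> /bergmanL Lf; apply: le_trans (cauchy_schwarz Lf (e_L2 n)) _.
by rewrite nrm_e mulr1.
Qed.

Lemma succ_expr_le (q : R) n : 0 <= q -> q < 1 -> n.+1%:R * q ^+ n <= (1 - q)^-1.
Proof.
move=> q0 q1; apply: le_trans (_ : \sum_(0 <= k < 0 + n.+1) q ^+ k <= _); last first.
  by apply: le_trans (geo_tail 0 _ q0 q1) _; rewrite expr0 mul1r.
rewrite add0n big_mkord mulr_natl -[X in _ *+ X]card_ord -sumr_const.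
by apply: ler_sum => i _; apply: ler_wiXn2l => //; rewrite ?ltW// -ltnS.
Qed.

(** The radius of the given series at 0 is unknown. But |coef f n| <= nrm f makes the coefficients
    grow at most like sqrt(n + 1), so the series converges on the whole disk, and its sum is f by
    the identity theorem. *)
Lemma bergman_global_ps f : bergman f -> has_ps f 0 1 (fun n => coef f n * sq n).
Proof.
move=> bf; set a := fun n => _; have [hf [r r0 [b hb]]] := bergman_ps bf.
have ab : a = b by apply/funext => n; rewrite /a (coef_ps n bf r0 hb) divfK ?sq_neq0.
have ex z : exists l, normc z < 1 -> clim (fun n => psum a n z) l.
  have [z1|] := ltP (normc z) 1; last by exists 0.
  (* With q = sqrt |z| one has |z|^k = q^k q^k: one factor absorbs the growth sqrt(k + 1) through
     [succ_expr_le], and the other gives a geometric series. *)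
  have [q [q0 q1 qz]] : exists q, [/\ 0 <= q, q < 1 & normc z = q ^+ 2].
    exists (Num.sqrt (normc z)); rewrite sqrtr_ge0 sqr_sqrtr ?normc_ge0//; split => //.
    by rewrite -sqrtr1 ltr_sqrt.
  have q1' : 0 < 1 - q by rewrite subr_gt0.
  have bound k : normc (a k * z ^+ k) <= (nrm f / (1 - q)) * q ^+ k.
    rewrite normcM normcX qz /a normcM normc_real ?sqrtr_ge0//.
    have s1 : Num.sqrt k.+1%:R <= k.+1%:R :> R.
      rewrite -[leRHS]ger0_norm ?ler0n// -sqrtr_sqr ler_sqrt ?sqr_ge0//.
      by rewrite -natrX ler_nat expnS leq_pmulr// expn1.
    have B : k.+1%:R * q ^+ k <= (1 - q)^-1 by exact: succ_expr_le.
    have qk : 0 <= q ^+ k by exact: exprn_ge0.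
    rewrite -exprM mulnC exprM expr2 -!mulrA.
    apply: ler_pM; [exact: normc_ge0| |exact: coef_le|].
      by apply: mulr_ge0; [exact: sqrtr_ge0|exact: mulr_ge0].
    rewrite [in leLHS]mulrA; apply: ler_wpM2r => //; apply: le_trans B.
    exact: ler_wpM2r.
  have [l hl] := geo_series q0 q1 (divr_ge0 (nrm_ge0 _) (ltW q1')) bound.
  by exists l.
have [F hF] := choice ex.
have Fps : has_ps F 0 1 a by move=> z; rewrite subr0; exact: hF.
have AF := ps_analytic Fps.
have [_ /analyticE Af] := bf.
have [x [x0 x1 xr]] : exists x, [/\ 0 < x, x <= 1 & x <= r].
  by exists (Num.min 1 r); rewrite lt_min r0 ltr01 !ge_min !lexx orbT.
have Ff z : disk z -> (-1) * F z + f z = 0.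
  have AG := analytic_lin (-1) AF Af.
  apply: (identity_thm AG x0) => w wx; rewrite -[w]subr0 in wx.
  have h1 := has_psS x1 Fps; have h2 := has_psS xr hb; rewrite -ab in h2.
  have E := has_ps_unique h1 h2 wx.
  by change (-1 * F w + f w = 0); rewrite E mulN1r addNr.
move=> z zr; have -> : f z = F z.
  have /Ff : disk z by apply/disk_normc; rewrite -[z]subr0.
  by rewrite mulN1r addrC => /eqP; rewrite subr_eq0 => /eqP.
exact: Fps.
Qed.

End Basis.

(** * Bessel's inequality, Parseval's identity and density of the basis *)

Section Parseval.
Variable R : realType.
Local Notation C := R[i].
Local Notation V := (C -> C).
Local Notation e := (@e_ R).
Local Notation cj := (@conjc R).
Local Notation T2 := (measurableTypeR R * measurableTypeR R)%type.
Local Notation D := (@disk2 R).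
Implicit Types (f g h F G : C -> C) (a b c : nat -> C) (z w : C).

Lemma limn_einf_le (u : (\bar R)^nat) (M : \bar R) : (forall n, u n <= M)%E -> (limn_einf u <= M)%E.
Proof.
move=> uM; rewrite limn_einf_lim; apply: lime_le; first exact: is_cvg_einfs.
apply: nearW => n; apply: le_trans (uM n); apply: ereal_inf_lbound.
by exists n => //=.
Qed.

Lemma nrm_fatou (G : nat -> V) f (M : R) : L2 f -> (forall n, L2 (G n)) ->
  (forall z, disk z -> clim (fun n => G n z) (f z)) ->
  (forall n, nrm (G n) ^+ 2 <= M) -> nrm f ^+ 2 <= M.
Proof.
move=> Lf LG GF GM; have mD := @measurable_disk2 R.
have pi0 := pi_gt0 R.
have int2 g : L2 g -> (\int[@area R]_(p in D) (normc (g (cplx p)) ^+ 2)%:E =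
    (pi * nrm g ^+ 2)%:E)%E.
  move=> Lg; rewrite nrm_sqr_int mulrA divff ?gt_eqF// mul1r /Rintegral fineK//.
  by apply: integrable_fin_num => //; exact: L2_sqr_integrable.
have := @fatou _ _ R (@area R) D mD (fun n p => (normc (G n (cplx p)) ^+ 2)%:E).
have h1 n : measurable_fun D (fun p => (normc (G n (cplx p)) ^+ 2)%:E).
  by apply/measurable_EFinP; apply: measurable_normc2; apply: L2_meas; exact: LG.
have h2 n (p : T2) : D p -> (0 <= (normc (G n (cplx p)) ^+ 2)%:E)%E.
  by move=> _; rewrite lee_fin sqr_ge0.
move=> /(_ h1 h2) => le1.
have E : (\int[@area R]_(p in D) limn_einf (fun n => (normc (G n (cplx p)) ^+ 2)%:E) =
    (pi * nrm f ^+ 2)%:E)%E.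
  rewrite -int2//; apply: eq_integral => p; rewrite inE => Dp.
  have /cvg_limn_einf_sup [-> _] // : (fun n => (normc (G n (cplx p)) ^+ 2)%:E) @ \oo -->
    (normc (f (cplx p)) ^+ 2)%:E.
  apply: cvg_EFin; first exact: nearW.
  have nc : (fun n => normc (G n (cplx p))) @ \oo --> normc (f (cplx p)).
    apply/cvgrPdist_le => d d0; have [N hN] := GF _ Dp d d0; exists N => // n nN.
    apply: le_trans (hN n nN); set x := f _; set y := G _ _.
    have h3 := normcD_le (x - y) y; have h4 := normcD_le (y - x) x.
    rewrite !subrK (normc_subC x y) in h3 h4; rewrite ler_norml.
    by move: h3 h4; set u := normc (y - x); lra.
  have := cvgM nc nc; exact.
have le2 : ((pi * nrm f ^+ 2)%:E <= (pi * M)%:E)%E.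
  rewrite -E; apply: le_trans le1 _; apply: limn_einf_le => n.
  by rewrite int2// lee_fin ler_pM2l.
by move: le2; rewrite lee_fin ler_pM2l.
Qed.

Definition fpart f n : V := \sum_(k < n) coef f k *: e k.

Lemma fpart_bergman f n : bergman (fpart f n).
Proof. by apply: bergman_sum => k; apply: bergmanZ; exact: e_bergman. Qed.

Lemma coef_fpart f n k : coef (fpart f n) k = if (k < n)%N then coef f k else 0.
Proof.
rewrite /fpart coef_sum; last by move=> i; apply: bergmanZ; exact: e_bergman.
rewrite (eq_bigr (fun i : 'I_n => coef f i * (i == k :> nat)%:R)); last first.
  by move=> i _; rewrite coefZ; [rewrite coef_e|exact: e_bergman].
case: ltnP => [kn|nk].
  rewrite (bigD1 (Ordinal kn)) //= eqxx mulr1 big1 ?addr0// => i.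
  by rewrite -val_eqE /= => /negPf->; rewrite mulr0.
rewrite big1// => i _; rewrite (_ : (i == k :> nat) = false) ?mulr0//.
by apply/negbTE; rewrite neq_ltn (leq_trans (ltn_ord i) nk).
Qed.

Lemma nrm_sum_e n (x : nat -> C) :
  nrm (\sum_(k < n) x k *: e k) ^+ 2 = \sum_(k < n) normc (x k) ^+ 2.
Proof.
elim: n => [|n IH]; first by rewrite !big_ord0 nrm0 expr0n.
have bs : bergman (\sum_(k < n) x k *: e k).
  by apply: bergman_sum => k; apply: bergmanZ; exact: e_bergman.
rewrite !big_ord_recr /= -IH pythagoras.
- by rewrite nrmZ ?nrm_e ?mulr1//; exact: e_L2.
- exact: bergmanL.
- by apply: L2Z; exact: e_L2.
rewrite ipZr; [|exact: e_L2|exact: bergmanL].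
suff -> : ip (\sum_(k < n) x k *: e k) (e n) = 0 by rewrite mulr0.
rewrite -/(coef _ _) coef_sum; last by move=> i; apply: bergmanZ; exact: e_bergman.
rewrite big1// => k _; rewrite coefZ ?coef_e; last exact: e_bergman.
by rewrite ltn_eqF ?mulr0.
Qed.

Lemma ip_sum_e f n (x : nat -> C) : bergman f ->
  ip f (\sum_(k < n) x k *: e k) = \sum_(k < n) cj (x k) * coef f k.
Proof.
move=> bf; elim: n => [|n IH].
  by rewrite !big_ord0 ip_conj ?ip0l ?conjc0//; [exact: bergmanL|exact: L20|exact: bergmanL].
have bs : bergman (\sum_(k < n) x k *: e k).
  by apply: bergman_sum => k; apply: bergmanZ; exact: e_bergman.
rewrite !big_ord_recr /= ipDr; [|exact: bergmanL| |exact: bergmanL].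
  by rewrite IH ipZr//; [exact: e_L2|exact: bergmanL].
by apply: L2Z; exact: e_L2.
Qed.

Lemma nrm_fpart f n : nrm (fpart f n) ^+ 2 = \sum_(k < n) normc (coef f k) ^+ 2.
Proof. exact: nrm_sum_e. Qed.

Lemma nrm_sub_fpart f n : bergman f ->
  nrm f ^+ 2 = nrm (f - fpart f n) ^+ 2 + \sum_(k < n) normc (coef f k) ^+ 2.
Proof.
move=> bf; have bp := fpart_bergman f n.
rewrite -nrm_fpart -(pythagoras (bergmanL (bergmanB bf bp)) (bergmanL bp)) ?subrK//.
rewrite ip_sum_e; last exact: bergmanB bf bp.
by rewrite big1// => k _; rewrite coefB// coef_fpart ltn_ord subrr mulr0.
Qed.

Lemma bessel f n : bergman f -> \sum_(k < n) normc (coef f k) ^+ 2 <= nrm f ^+ 2.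
Proof. by move=> bf; rewrite (nrm_sub_fpart n bf) lerDr sqr_ge0. Qed.

(** The converse of [bessel]: the partial sums converge to f at every point of the disk, and Fatou's
    lemma passes the bound on to f. *)
Lemma nrm_le_coef f (M : R) : bergman f ->
  (forall n, \sum_(k < n) normc (coef f k) ^+ 2 <= M) -> nrm f ^+ 2 <= M.
Proof.
move=> bf h; apply: (@nrm_fatou (fpart f)); first exact: bergmanL.
- by move=> n; apply: bergmanL; exact: fpart_bergman.
- move=> z dz; have z1 : normc (z - 0) < 1 by rewrite subr0; exact/disk_normc.
  apply: clim_eq (bergman_global_ps bf z1) => n; rewrite /psum /fpart subr0.
  elim: n => [|n IH]; first by rewrite !big_ord0.
  rewrite !big_ord_recr /= IH.
  change (fpart f n z + coef f n * sq R n * z ^+ n = fpart f n z + coef f n * e n z).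
  by rewrite /e_ restrict_diskE// mulrA.
- by move=> n; rewrite nrm_fpart.
Qed.

Lemma fpart_cvg f (d : R) : bergman f -> 0 < d ->
  exists N, forall n, (N <= n)%N -> nrm (f - fpart f n) < d.
Proof.
move=> bf d0.
have [[N hN]|] := pselect (exists N, nrm f ^+ 2 - d ^+ 2 < \sum_(k < N) normc (coef f k) ^+ 2).
  exists N => n Nn; rewrite -(@ltr_pXn2r _ 2)// ?nnegrE ?nrm_ge0 ?ltW//.
  have := nrm_sub_fpart n bf.
  have : \sum_(k < N) normc (coef f k) ^+ 2 <= \sum_(k < n) normc (coef f k) ^+ 2.
    rewrite -(subnKC Nn) big_split_ord /= lerDl.
    by apply: sumr_ge0 => k _; exact: sqr_ge0.
  by move: hN; lra.
(* Otherwise all sums of squares stay below nrm f^2 - d^2, and [nrm_le_coef] would bound nrm f^2 by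
   that. *)
move=> /forallNP h; have /(nrm_le_coef bf) : forall n, \sum_(k < n) normc (coef f k) ^+ 2 <= nrm f ^+ 2 - d ^+ 2.
  by move=> n; rewrite leNgt; exact/negP/h.
by have := exprn_gt0 2 d0; lra.
Qed.

Lemma nrm_coef_mono f g : bergman f -> bergman g -> (forall n, normc (coef f n) <= normc (coef g n)) ->
  nrm f <= nrm g.
Proof.
move=> bf bg h; rewrite -(@ler_pXn2r _ 2)// ?nnegrE ?nrm_ge0//.
apply: nrm_le_coef => // n; apply: le_trans (bessel n bg).
by apply: ler_sum => k _; rewrite ler_pXn2r ?nnegrE ?normc_ge0.
Qed.

(** The product of f with a partial sum of g is a finite sum of zeros; Cauchy-Schwarz makes the rest
    arbitrarily small. *)
Lemma ip_coef0 f g : bergman f -> bergman g -> (forall n, coef f n = 0 \/ coef g n = 0) -> ip f g = 0.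
Proof.
move=> bf bg h; apply/normc_eq0/eqP; rewrite eq_le normc_ge0 andbT.
apply/ler_addgt0Pr => d d0; rewrite add0r.
have n1 : 0 < nrm f + 1 by rewrite ltr_wpDl// nrm_ge0.
have [N /(_ N (leqnn N)) hN] := fpart_cvg bg (divr_gt0 d0 n1).
have bp := fpart_bergman g N.
rewrite -[g](subrK (fpart g N)) ipDr; [|exact: bergmanL (bergmanB bg bp)|exact: bergmanL|exact: bergmanL].
rewrite [X in _ + X]ip_sum_e// [X in _ + X]big1 ?addr0; last first.
  by move=> k _; case: (h k) => ->; rewrite ?mulr0// conjc0 mul0r.
apply: le_trans (cauchy_schwarz (bergmanL bf) (bergmanL (bergmanB bg bp))) _.
have := ltW hN; rewrite ler_pdivlMr// => hN'.
apply: le_trans hN'; rewrite mulrC; apply: ler_wpM2l; first exact: nrm_ge0.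
by rewrite lerDl.
Qed.

End Parseval.

(** * The operator in the basis [e_] *)

Section ShiftIndex.
Variable d : nat.

(* [Bs (e_ m)] is a multiple [beta m] of [e_ (sigma m)]. *)
Definition sigma (m : nat) : nat := if (m < d)%N then (d - m).*2.-1 else (m - d).*2.

Lemma sigma_inj : injective sigma.
Proof. move=> m n; rewrite /sigma; case: (ltnP m d) => ?; case: (ltnP n d) => ? ?; lia. Qed.

Lemma sigma_lt n m : (m < n)%N -> (sigma m < (d + n).*2)%N.
Proof. by rewrite /sigma => mn; case: (ltnP m d) => *; lia. Qed.

Lemma sigma_odd n m : n.*2.+1 = sigma m <-> d = (n.+1 + m)%N.
Proof. by rewrite /sigma; case: (ltnP m d) => h; split => *; lia. Qed.

Lemma sigma_even n m : n.*2 = sigma m <-> m = (n + d)%N.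
Proof. by rewrite /sigma; case: (ltnP m d) => h; split => *; lia. Qed.

Definition oddpart (m : nat) : nat := m %/ 2 ^ logn 2 m.

Lemma oddpart_odd i l : oddpart (i.*2.+1 * 2 ^ l) = i.*2.+1.
Proof.
rewrite /oddpart lognM ?expn_gt0// pfactorK//.
by rewrite (_ : logn 2 i.*2.+1 = 0%N) ?add0n ?mulnK ?expn_gt0// lognE dvdn2 /= odd_double.
Qed.

Lemma oddpartP m : (0 < m)%N -> exists i l, m = (i.*2.+1 * 2 ^ l)%N.
Proof.
move=> m0; have [q q2 ->] := @pfactor_coprime 2 m isT m0.
exists q./2, (logn 2 m); congr (_ * _)%N.
by rewrite -[LHS]odd_double_half -coprime2n q2.
Qed.

Lemma oddpart_double m : oddpart m.*2 = oddpart m.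
Proof.
have [->//|m0] := posnP m; have [i [l ->]] := oddpartP m0.
by rewrite -mul2n mulnCA -expnS !oddpart_odd.
Qed.

(* The orbits of [sigma]: the indices below [d.*2], the fixed point [d.*2], and the chains
   [d.*2 + (2 i + 1) 2^l] for [l >= 0]. *)
Definition block (n : nat) : bool + nat :=
  if (n < d.*2)%N then inl true
  else if n == d.*2 then inl false else inr (oddpart (n - d.*2))./2.

Lemma block_sigma m : (0 < d)%N -> block (sigma m) = block m.
Proof.
move=> d0; rewrite /block /sigma; case: (ltnP m d) => md.
  have h1 : ((d - m).*2.-1 < d.*2)%N by lia.
  have h2 : (m < d.*2)%N by lia.
  by rewrite h1 h2.
case: (ltnP m d.*2) => m2.
  have h1 : ((m - d).*2 < d.*2)%N by lia.
  by rewrite h1.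
have -> : ((m - d).*2 < d.*2)%N = false by lia.
have -> : ((m - d).*2 == d.*2) = (m == d.*2) by lia.
case: eqP => // _; have -> : ((m - d).*2 - d.*2 = (m - d.*2).*2)%N by lia.
by rewrite oddpart_double.
Qed.

Definition orbit (i l : nat) : nat := (d.*2 + i.*2.+1 * 2 ^ l)%N.

Lemma block_orbit i n : block n = inr i <-> exists l, orbit i l = n.
Proof.
rewrite /block /orbit; split.
  case: ltnP => // n2; case: eqP => // n2' [ni].
  have n0 : (0 < n - d.*2)%N by lia.
  have [j [l E]] := oddpartP n0; exists l; move: ni; rewrite E oddpart_odd /= uphalf_double => <-.
  by rewrite -E subnKC.
move=> [l <-]; have p0 : (0 < i.*2.+1 * 2 ^ l)%N by rewrite muln_gt0 expn_gt0.
have -> : (d.*2 + i.*2.+1 * 2 ^ l < d.*2)%N = false by lia.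
have -> : (d.*2 + i.*2.+1 * 2 ^ l == d.*2)%N = false by lia.
by rewrite addKn oddpart_odd /= uphalf_double.
Qed.

Lemma orbit_inj i : injective (orbit i).
Proof.
move=> l l' /addnI /eqP; rewrite eqn_pmul2l// eqn_exp2l// => /eqP; exact.
Qed.

Lemma sigma_orbit i l : sigma (orbit i l) = orbit i l.+1.
Proof. by rewrite /sigma /orbit ifF; [rewrite expnS; lia|lia]. 
Qed.

End ShiftIndex.

(** * Weights of the adjoint and their comparison *)

Section Weights.
Variables (R : realType) (s d : nat).
Hypothesis d0 : (0 < d)%N.

(** The first branch comes from e_(2n+1) with n = d - m - 1, which K sends to a conjugate monomial;
    the second comes from e_(2n) with n = m - d. *)
Definition beta (m : nat) : R :=
  if (m < d)%N then Num.sqrt (d - m).+1%:R * Num.sqrt m.+1%:R / (s + d).+1%:R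
  else Num.sqrt (m - d).+1%:R * Num.sqrt m.+1%:R / (s + m).+1%:R.

Lemma beta_gt0 m : 0 < beta m.
Proof.
by rewrite /beta; case: ifP => _; apply: divr_gt0; rewrite ?ltr0n//; apply: mulr_gt0; rewrite sqrtr_gt0 ltr0n.
Qed.

Lemma beta_sqr_lt m : (m < d)%N ->
  beta m ^+ 2 = (d%:R - m%:R + 1) * (m%:R + 1) / (s%:R + d%:R + 1) ^+ 2.
Proof.
move=> md; rewrite /beta md expr_div_n exprMn !sqr_sqrtr ?ler0n//.
by rewrite -!natr1 natrB ?natrD// ltnW.
Qed.

Lemma beta_sqr_ge m : (d <= m)%N ->
  beta m ^+ 2 = (m%:R - d%:R + 1) * (m%:R + 1) / (s%:R + m%:R + 1) ^+ 2.
Proof.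
move=> md; rewrite /beta ltnNge md /= expr_div_n exprMn !sqr_sqrtr ?ler0n//.
by rewrite -!natr1 natrB ?natrD.
Qed.

Lemma beta_ltE m n : (beta m ^+ 2 < beta n ^+ 2) = (beta m < beta n).
Proof. by rewrite ltr_pXn2r// nnegrE (ltW (beta_gt0 _)). Qed.

Lemma beta_leE m n : (beta m ^+ 2 <= beta n ^+ 2) = (beta m <= beta n).
Proof. by rewrite ler_pXn2r// nnegrE (ltW (beta_gt0 _)). Qed.

Lemma beta_le1 m : beta m <= 1.
Proof.
rewrite -(@ler_pXn2r _ 2)// ?nnegrE ?ler01 ?(ltW (beta_gt0 _))// expr1n.
have s0 : 0 <= s%:R :> R by rewrite ler0n.
have m0 : 0 <= m%:R :> R by rewrite ler0n.
have [md|dm] := ltnP m d.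
  have md' : m%:R + 1 <= d%:R :> R by rewrite natr1 ler_nat.
  rewrite beta_sqr_lt// ler_pdivrMr; last by apply: exprn_gt0; lra.
  by rewrite mul1r expr2; apply: ler_pM; lra.
have dm' : d%:R <= m%:R :> R by rewrite ler_nat.
have d1 : 0 <= d%:R :> R by rewrite ler0n.
rewrite beta_sqr_ge// ler_pdivrMr; last by apply: exprn_gt0; lra.
by rewrite mul1r expr2; apply: ler_pM; lra.
Qed.

(** The square is the product of (m - d + 1) / (s + m + 1) and (m + 1) / (s + m + 1), and both
    increase with m. *)
Lemma beta_mono m n : (d <= m)%N -> (m <= n)%N -> beta m <= beta n.
Proof.
move=> dm mn; rewrite -beta_leE !beta_sqr_ge ?(leq_trans dm)//.
have s0 : 0 <= s%:R :> R by rewrite ler0n.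
have d1 : 0 <= d%:R :> R by rewrite ler0n.
have dm' : d%:R <= m%:R :> R by rewrite ler_nat.
have mn' : m%:R <= n%:R :> R by rewrite ler_nat.
have P (x y u v p q : R) : 0 < u -> 0 < v -> 0 <= x -> 0 <= p -> x / u <= y / v -> p / u <= q / v ->
   x * p / u ^+ 2 <= y * q / v ^+ 2.
  move=> u0 v0 x0 p0 h1 h2; rewrite !expr2 -!mulf_div.
  by apply: ler_pM => //; apply: divr_ge0 => //; exact: ltW.
clear d0 dm mn; move: (m%:R) (n%:R) (s%:R) (d%:R) s0 d1 dm' mn' => x y u v u0 v0 vx xy.
have h1 : 0 <= (y - x) * (u + v) by apply: mulr_ge0; lra.
have h2 : 0 <= (y - x) * u by apply: mulr_ge0; lra.
by apply: P; try lra; (rewrite ler_pdivrMr; last lra);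
  (rewrite mulrAC ler_pdivlMr; last lra); lra.
Qed.

Lemma double_pred : d.*2.-1%:R = 2 * d%:R - 1 :> R.
Proof.
have : d.*2.-1%:R + 1 = 2 * d%:R :> R by rewrite natr1 prednK ?double_gt0// -mul2n natrM.
by lra.
Qed.

Lemma double_pred2 : d.*2.-2%:R = 2 * d%:R - 2 :> R.
Proof.
have : d.*2.-2%:R + 1 = d.*2.-1%:R :> R by rewrite natr1 prednK//; lia.
by rewrite double_pred; lra.
Qed.

(** [sigma] maps 2 d - 1 to 2 d - 2, so a larger weight at the earlier index contradicts
    hyponormality. *)
Lemma beta_lt_pred : (1 < d)%N -> beta (d.*2.-2) < beta d.*2.-1.
Proof.
move=> d1; rewrite -beta_ltE !beta_sqr_ge; [|lia|lia].
rewrite double_pred double_pred2.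
have s0 : 0 <= s%:R :> R by rewrite ler0n.
have d1' : 2 <= d%:R :> R by rewrite (ler_nat _ 2).
move: s0 d1'; set x := s%:R; set y := d%:R => s0 d1'.
have x2 : 0 < x + 2 * y - 1 by lra.
rewrite ltr_pdivrMr; last by apply: exprn_gt0; lra.
rewrite mulrAC ltr_pdivlMr; last by apply: exprn_gt0; lra.
have h1 : ((2 * y - 1) * (x + 2 * y)) ^+ 2 <= (2 * y * (x + 2 * y - 1)) ^+ 2.
  by rewrite ler_pXn2r ?nnegrE//; [nra|apply: mulr_ge0; lra|apply: mulr_ge0; lra].
have h2 : 0 < (2 * y - 1) * (x + 2 * y) ^+ 2 by apply: mulr_gt0; [lra|apply: exprn_gt0; lra].
rewrite (_ : x + (2 * y - 1) + 1 = x + 2 * y); last ring.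
rewrite (_ : x + (2 * y - 2) + 1 = x + 2 * y - 1); last ring.
move: h1 h2; rewrite !exprMn; move: ((x + 2 * y) ^+ 2) ((x + 2 * y - 1) ^+ 2) => u v; nra.
Qed.

(** [sigma] maps 0 to 2 d - 1, so an increase of the weight along this step contradicts
    co-hyponormality on the finite block. *)
Lemma beta0_lt : (1 < d)%N -> beta 0 < beta d.*2.-1.
Proof.
move=> d1; rewrite -beta_ltE (@beta_sqr_lt 0)// (@beta_sqr_ge d.*2.-1); last lia.
rewrite double_pred.
have s0 : 0 <= s%:R :> R by rewrite ler0n.
have d1' : 2 <= d%:R :> R by rewrite (ler_nat _ 2).
move: s0 d1'; set x := s%:R; set y := d%:R => s0 d1'.
rewrite ltr_pdivrMr; last by apply: exprn_gt0; lra.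
rewrite mulrAC ltr_pdivlMr; last by apply: exprn_gt0; lra.
have h1 : ((y + 1) * (x + 2 * y)) ^+ 2 <= (2 * y * (x + y + 1)) ^+ 2.
  by rewrite ler_pXn2r ?nnegrE//; [nra|apply: mulr_ge0; lra|apply: mulr_ge0; lra].
have h2 : 0 < y ^+ 2 * (x + y + 1) ^+ 2 by apply: mulr_gt0; apply: exprn_gt0; lra.
have y1 : 0 < y + 1 by lra.
rewrite -(ltr_pM2l y1); move: h1 h2; rewrite !exprMn mulr0n subr0 add0r mulr1.
rewrite (_ : x + (2 * y - 1) + 1 = x + 2 * y); last ring.
by move: ((x + 2 * y) ^+ 2) ((x + y + 1) ^+ 2) => u v; nra.
Qed.

Lemma beta_orbit_sqr i l :
  beta (orbit d i l) ^+ 2 = (i.*2.+1%:R * 2 ^+ l + d.+1%:R) * (i.*2.+1%:R * 2 ^+ l + (2 * d).+1%:R)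
     / (i.*2.+1%:R * 2 ^+ l + (s + (2 * d).+1)%:R) ^+ 2.
Proof.
rewrite beta_sqr_ge /orbit; last lia.
rewrite -!natr1 !natrD -mul2n !natrM natrX -!natr1.
by congr (_ * _ / _ ^+ 2); ring.
Qed.

(** For d = 1, [sigma] exchanges 0 and 1, and the two weights agree. *)
Lemma beta1_sigma m : d = 1%N -> (m <= 1)%N -> beta (sigma d m) = beta m.
Proof.
have key : d = 1%N -> beta 1 = beta 0.
  move=> d1; apply/eqP; rewrite -(@eqrXn2 _ 2)// ?ltW ?beta_gt0//; apply/eqP.
  rewrite (@beta_sqr_lt 0)// (@beta_sqr_ge 1) ?d1//.
  by congr (_ / _ ^+ 2); ring.
by move=> d1; case: m => [|[|//]] _; rewrite /sigma d1 /= ?key// -key.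
Qed.

Lemma beta1_sigma_mono m : d = 1%N -> beta m <= beta (sigma d m).
Proof.
move=> d1; have [m1|m2] := leqP m 1; first by rewrite beta1_sigma.
have dm : (d <= m)%N by lia.
by apply: beta_mono; rewrite // /sigma ltnNge dm /=; lia.
Qed.

End Weights.

Section Operator.
Variable R : realType.
Local Notation C := R[i].
Local Notation V := (C -> C).
Local Notation e := (@e_ R).
Local Notation cj := (@conjc R).
Local Notation D := (@disk2 R).
Variables (s d : nat) (P K Bs : V -> V).
Hypothesis (d0 : (0 < d)%N).
Hypothesis (hP : is_bergman_projection P) (hK : is_K_operator K).
Local Notation B := (HToeplitz P K (symbol (s + d) s)).
Hypothesis (hBs : is_adjoint bergman B Bs).
Implicit Types (f g h : V).
Local Notation sg := (sigma d).
Local Notation bt := (beta R s d).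

Lemma symbol_cmeas t : cmeas D (symbol t s : V).
Proof.
have mD := @measurable_disk2 R; apply: cmeas_mul => //.
  by apply: cmeas_exp => //; exact: cmeas_id.
by apply: cmeas_exp => //; apply: cmeas_conj => //; exact: cmeas_id.
Qed.

Lemma symbol_le1 t (z : C) : disk z -> normc (symbol t s z) <= 1.
Proof.
move=> dz; rewrite /symbol -[1]mulr1 normcM; apply: ler_pM; rewrite ?normc_ge0//.
  exact: disk_exp_le1.
change (normc (cj z ^+ s) <= 1); rewrite -conjcX normcJR; exact: disk_exp_le1.
Qed.

Lemma symbol_K_L2 f : bergman f -> L2 (fun z => symbol (s + d) s z * K f z).
Proof.
case: hK => -[K1 _ _] _ _ /K1[LK _]; apply: L2_mul => //; first exact: symbol_cmeas.
by move=> p; exact: symbol_le1.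
Qed.

Lemma B_bergman f : bergman f -> bergman (B f).
Proof. by move=> /symbol_K_L2/hP[]. Qed.

Lemma Bs_bergman f : bergman f -> bergman (Bs f).
Proof. by case: hBs => h _; exact: h. Qed.

Lemma coef_B_sym f m : bergman f -> coef (B f) m = ip (fun z => symbol (s + d) s z * K f z) (e m).
Proof.
move=> bf; have LS := symbol_K_L2 bf; have [bB hB] := hP LS.
have := hB _ (e_bergman R m); rewrite ipBl; [|exact: LS|exact: bergmanL bB|exact: e_L2].
by move=> /eqP; rewrite subr_eq0 => /eqP.
Qed.

Lemma ip_mono_mono m n : ip (@mono R m) (@mono R n) = if m == n then n.+1%:R^-1 else 0.
Proof.
have := coef_e R m n; rewrite /coef !e_E ipZl ?ipZr; try exact: mono_L2; last first.
  by apply: L2Z; exact: mono_L2.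
rewrite conjcR; case: eqP => [->|_] h.
  apply: (mulfI (sq_neq0 R n)); apply: (mulfI (sq_neq0 R n)).
  by rewrite h mulrA sq2 divff// pnatr_eq0.
apply: (mulfI (sq_neq0 R m)); apply: (mulfI (sq_neq0 R n)).
by rewrite mulrCA h !mulr0.
Qed.

Lemma ip_scaled_mono (x y : C) f g m n :
  (forall z, disk z -> f z * cj (g z) = x * cj y * (z ^+ m * cj z ^+ n)) ->
  ip f g = x * cj y * (if m == n then n.+1%:R^-1 else 0).
Proof.
move=> fg; have Lm := @mono_L2 R.
rewrite -ip_mono_mono -mulrA -ipZr// -ipZl//; last exact: L2Z.
rewrite !ipE; congr (_ * _); apply: cI_eq => p Dp; rewrite fg//.
change (x * cj y * (cplx p ^+ m * cj (cplx p) ^+ n) = x * @mono R m (cplx p) * cj (y * @mono R n (cplx p))).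
rewrite /mono !restrict_diskE// conjcM conjcX; ring.
Qed.

Lemma coef_B_e_even n m : coef (B (e n.*2)) m =
  sq R n * sq R m * (if (n + d == m)%N then (s + m).+1%:R^-1 else 0).
Proof.
rewrite coef_B_sym; last exact: e_bergman.
case: hK => _ K2 _; rewrite -mul2n K2.
rewrite (@ip_scaled_mono (sq R n) (sq R m) _ _ (s + d + n) (s + m)).
  by rewrite conjcR -addnA eqn_add2l addnC.
move=> z dz; rewrite /e_ !restrict_diskE// /symbol.
change (z ^+ (s + d) * cj z ^+ s * (sq R n * z ^+ n) * cj (sq R m * z ^+ m) =
  sq R n * cj (sq R m) * (z ^+ (s + d + n) * cj z ^+ (s + m))).
rewrite conjcM conjcX !exprD; ring.
Qed.

Lemma coef_B_e_odd n m : coef (B (e n.*2.+1)) m =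
  sq R n.+1 * sq R m * (if (d == n.+1 + m)%N then (s + d).+1%:R^-1 else 0).
Proof.
rewrite coef_B_sym; last exact: e_bergman.
case: hK => _ _ K3; rewrite -mul2n -addn1 K3.
rewrite (@ip_scaled_mono (sq R n.+1) (sq R m) _ _ (s + d) (s + (n.+1 + m))).
  by rewrite conjcR eqn_add2l; case: eqP => [->|].
move=> z dz; rewrite /e_ !restrict_diskE// /symbol.
change (z ^+ (s + d) * cj z ^+ s * cj (sq R n.+1 * z ^+ n.+1) * cj (sq R m * z ^+ m) =
  sq R n.+1 * cj (sq R m) * (z ^+ (s + d) * cj z ^+ (s + (n.+1 + m)))).
rewrite !conjcM !conjcX conjcR !exprD; ring.
Qed.

Lemma coef_B_e k m : coef (B (e k)) m = if k == sg m then (bt m)%:C else 0.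
Proof.
have [n [->|->]] : exists n, k = n.*2.+1 \/ k = n.*2.
  by exists k./2; rewrite -{1 3}[k]odd_double_half; case: (odd k); [left|right].
- rewrite coef_B_e_odd; case: eqP => [dE|dE].
    have -> : n.*2.+1 == sg m by apply/eqP/sigma_odd.
    rewrite /beta ifT; last by rewrite dE -[X in (X < _)%N]add0n ltn_add2r.
    have dm : (d - m = n.+1)%N by rewrite dE addnK.
    by rewrite rcM rcM rcV rcn dm.
  rewrite mulr0; case: eqP => // /sigma_odd; done.
- rewrite coef_B_e_even; case: eqP => [mE|mE].
    have -> : n.*2 == sg m by apply/eqP/sigma_even; rewrite mE.
    rewrite /beta ifF; last by rewrite -mE ltnNge leq_addl.
    have dm : (m - d = n)%N by rewrite -mE addnK.
    by rewrite rcM rcM rcV rcn dm.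
  rewrite mulr0; case: eqP => // /sigma_even E; by case: mE.
Qed.

Lemma B_e_sigma m : B (e (sg m)) = (bt m)%:C *: e m.
Proof.
apply: coef_ext; [exact: B_bergman (e_bergman R _)|exact: bergmanZ (e_bergman R _)|].
move=> n; rewrite coef_B_e coefZ; last exact: e_bergman.
rewrite coef_e (inj_eq (@sigma_inj d)); case: eqP => [->|_]; by rewrite ?mulr1 ?mulr0.
Qed.

Lemma B_e_off k : (forall m, k <> sg m) -> B (e k) = 0.
Proof.
move=> h; apply: coef_inj => [|m]; first exact: B_bergman (e_bergman R _).
by rewrite coef_B_e; case: eqP => // /h.
Qed.

Lemma ip_B_Bs f g : bergman f -> bergman g -> ip (B f) g = ip f (Bs g).
Proof. by case: hBs => _; exact. Qed.

Lemma ip_Bs_B f g : bergman f -> bergman g -> ip (Bs f) g = ip f (B g).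
Proof.
move=> bf bg; have bB := bergmanL (B_bergman bg); have bBs := bergmanL (Bs_bergman bf).
have [Lf Lg] := (bergmanL bf, bergmanL bg).
by rewrite (ip_conj Lg bBs) -ip_B_Bs// -(ip_conj bB Lf).
Qed.

Lemma coef_Bs f m : bergman f -> coef (Bs f) (sg m) = (bt m)%:C * coef f m.
Proof.
move=> bf; by rewrite /coef (ip_Bs_B bf (e_bergman R _)) B_e_sigma (ipZr _ (e_L2 R m) (bergmanL bf)) conjcR.
Qed.

Lemma coef_Bs_off f k : bergman f -> (forall m, k <> sg m) -> coef (Bs f) k = 0.
Proof.
move=> bf h; by rewrite /coef (ip_Bs_B bf (e_bergman R _)) (B_e_off h) (ip_conj (@L20 R) (bergmanL bf)) ip0l ?conjc0//; exact: bergmanL.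
Qed.

Lemma Bs_e m : Bs (e m) = (bt m)%:C *: e (sg m).
Proof.
apply: coef_ext; [exact: Bs_bergman (e_bergman R _)|exact: bergmanZ (e_bergman R _)|].
move=> n; rewrite coefZ; last exact: e_bergman.
have [[k ->]|h] := pselect (exists k, n = sg k).
  rewrite (coef_Bs _ (e_bergman R _)).
  rewrite !coef_e (inj_eq (@sigma_inj d)); case: eqP => [->//|_]; by rewrite !mulr0.
have h' k : n <> sg k by move=> E; apply: h; exists k.
rewrite (coef_Bs_off (e_bergman R _) h').
by rewrite coef_e; case: eqP => [E|_]; [case: h; exists m|rewrite mulr0].
Qed.

Lemma coef_B f m : bergman f -> coef (B f) m = (bt m)%:C * coef f (sg m).
Proof.
move=> bf; by rewrite /coef (ip_B_Bs bf (e_bergman R _)) Bs_e (ipZr _ (e_L2 R _) (bergmanL bf)) conjcR.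
Qed.

End Operator.

(** * Subspaces given by sets of indices *)

Section CoordinateSubspaces.
Variable R : realType.
Local Notation C := R[i].
Local Notation V := (C -> C).
Local Notation e := (@e_ R).
Implicit Types (f g h : V) (I : set nat).

(** Described by vanishing coefficients rather than as the closure of a span, so that closedness,
    invariance and orthogonality can be read off coefficients. *)
Definition cspan I : set V := [set f | bergman f /\ forall n, ~ I n -> coef f n = 0].

Lemma cspan_e I n : I n -> cspan I (e n).
Proof.
move=> In; split; first exact: e_bergman.
by move=> m Im; rewrite coef_e; case: eqP => // nm; case: Im; rewrite -nm.
Qed.

Lemma cspan_bergman I f : cspan I f -> bergman f. Proof. by case. Qed.

Lemma cspan_lin I (a : C) f g : cspan I f -> cspan I g -> cspan I (a *: f + g).
Proof.
move=> [bf f0] [bg g0]; split; first exact: bergman_lin.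
move=> n In; rewrite (coefD n (bergmanZ a bf) bg) (coefZ a n bf) f0// g0//.
by rewrite mulr0 addr0.
Qed.

Lemma cspan_closed I : closed_subspace bergman (cspan I).
Proof.
split.
- by move=> f [].
- by split=> [|n _]; [exact: bergman0|exact: coef0].
- exact: cspan_lin.
move=> f bf h; split=> // n In; apply/normc_eq0/eqP; rewrite eq_le normc_ge0 andbT.
apply/ler_addgt0Pr => d d0; rewrite add0r; have [g [bg g0] fg] := h d d0.
apply: le_trans (ltW fg); apply: le_trans (coef_le n (bergmanB bf bg)).
by rewrite (coefB n bf bg) g0// subr0.
Qed.

Lemma cspan_orthogonal I J f g : (forall n, I n -> ~ J n) -> cspan I f -> cspan J g -> ip f g = 0.
Proof.
move=> IJ [bf f0] [bg g0]; apply: ip_coef0 => // n.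
by have [/IJ/g0|/f0] := pselect (I n); [right|left].
Qed.

Lemma cspan_orthocomplement I : orthocomplement bergman (cspan I) = cspan (~` I).
Proof.
apply/seteqP; split=> f.
  move=> [bf h]; split=> // n /contrapT In; exact: (h _ (cspan_e In)).
move=> cf; split; first exact: cspan_bergman cf.
by move=> g; apply: cspan_orthogonal cf.
Qed.

Lemma cspan_basis (T : eqType) (nu : T -> nat) I : injective nu ->
  (forall n, I n <-> exists i, nu i = n) -> orthonormal_basis (cspan I) (fun i => e (nu i)).
Proof.
move=> nu_inj hI; split.
- by move=> i; apply: cspan_e; apply/hI; exists i.
- by move=> i j; have := coef_e R (nu i) (nu j); rewrite (inj_eq nu_inj).
move=> f [bf f0] eps eps0; have [N hN] := fpart_cvg bf eps0.
have key : exists r : seq T, \sum_(i <- r) coef f (nu i) *: e (nu i) = fpart f N.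
  elim: N {hN} => [|N [r hr]]; first by exists [::]; rewrite big_nil /fpart big_ord0.
  have [[i iN]|h] := pselect (exists i, nu i = N).
    exists (i :: r); rewrite big_cons hr /fpart big_ord_recr /= iN; exact: addrC.
  exists r; rewrite hr /fpart big_ord_recr /= (f0 N).
    by rewrite scale0r addr0.
  by move=> /hI.
have [r hr] := key; exists r, (fun i => coef f (nu i)); rewrite hr; exact: hN.
Qed.

Lemma cspan_direct_sum (J : eqType) (kappa : nat -> J) (S : J -> set V) :
  (forall j, S j = cspan [set n | kappa n = j]) -> orthogonal_direct_sum bergman S.
Proof.
move=> hS; split.
- by move=> j; rewrite hS; exact: cspan_closed.
- move=> j k jk f g; rewrite !hS; apply: cspan_orthogonal => n /= -> kj; exact: jk.
move=> f bf eps eps0; have [N hN] := fpart_cvg bf eps0.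
(* The blocks met by the first N indices, each once, so that the components g j add up to the
   partial sum of length N. *)
pose r := undup [seq kappa n | n <- iota 0 N].
pose g j : V := \sum_(n < N) (if kappa n == j then coef f n else 0) *: e n.
have bge j n : bergman ((if kappa n == j then coef f n else 0) *: e n) by exact: bergmanZ (e_bergman R n).
have bg j : bergman (g j) by apply: bergman_sum => n; exact: bge.
have cg j n : coef (g j) n = if (n < N)%N && (kappa n == j) then coef f n else 0.
  rewrite /g coef_sum; last by move=> i; exact: bge.
  rewrite (eq_bigr (fun i : 'I_N => (if kappa i == j then coef f i else 0) * (i == n :> nat)%:R)); last first.
    by move=> i _; rewrite (coefZ _ n (e_bergman R i)) coef_e.
  case: (ltnP n N) => nN /=.
    rewrite (bigD1 (Ordinal nN)) //= eqxx mulr1 big1 ?addr0// => i.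
    by rewrite -val_eqE /= => /negPf->; rewrite mulr0.
  rewrite big1// => i _; rewrite (_ : (i == n :> nat) = false) ?mulr0//.
  by apply/negbTE; rewrite neq_ltn (leq_trans (ltn_ord i) nN).
exists r, g; split.
  move=> j; rewrite hS; split; first exact: bg.
  by move=> n nj; rewrite cg; case: eqP => [/nj[]|_]; rewrite andbF.
suff -> : \sum_(j <- r) g j = fpart f N by exact: hN.
apply: coef_ext; [exact: bergman_sum|exact: fpart_bergman|] => n.
rewrite coef_sum// coef_fpart (eq_bigr _ (fun j _ => cg j n)).
case: (ltnP n N) => nN /=; last by rewrite big1.
rewrite -big_mkcond -big_filter (eq_filter (a2 := pred1 (kappa n))); last first.
  by move=> j; rewrite /= eq_sym.
rewrite filter_pred1_uniq ?undup_uniq ?big_seq1// mem_undup.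
by apply/mapP; exists n; rewrite // mem_iota.
Qed.

Lemma adjoint_nrm I T Ts f : is_adjoint (cspan I) T Ts -> (forall f, cspan I f -> cspan I (T f)) ->
  cspan I f -> ip (Ts (T f) - T (Ts f)) f = (nrm (T f) ^+ 2 - nrm (Ts f) ^+ 2)%:C.
Proof.
move=> [hs ad] hT Sf; have Sb g : cspan I g -> L2 g by case=> /bergmanL.
have L1 := Sb _ (hs _ (hT _ Sf)); have L2' := Sb _ (hT _ (hs _ Sf)).
rewrite ipBl//; [|exact: Sb Sf]; rewrite ad; [|exact: hs|exact: Sf].
rewrite (ip_conj (Sb _ Sf) L1) -ad; [|exact: Sf|exact: hT].
by rewrite !ip_self conjcR rcB.
Qed.

Lemma hyponormal_nrm I T : (forall f, cspan I f -> cspan I (T f)) ->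
  hyponormal (cspan I) T <-> exists Ts, is_adjoint (cspan I) T Ts /\
    forall f, cspan I f -> nrm (Ts f) <= nrm (T f).
Proof.
move=> hT; split=> -[Ts [ad h]]; exists Ts; split=> // f Sf; have := h f Sf.
  rewrite (adjoint_nrm ad hT Sf) lecR subr_ge0 ler_pXn2r// nnegrE; exact: nrm_ge0.
by rewrite (adjoint_nrm ad hT Sf) lecR subr_ge0 ler_pXn2r// nnegrE nrm_ge0.
Qed.

(** The entry equals <e_l, T* e_m>, which is at most the norm of T* e_m, and hyponormality bounds
    this by the norm of T e_m. *)
Lemma hyponormal_entry I T m l (b : R) : (forall f, cspan I f -> cspan I (T f)) ->
  hyponormal (cspan I) T -> I m -> I l -> ip (T (e l)) (e m) = b%:C -> 0 <= b -> b <= nrm (T (e m)).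
Proof.
move=> hT /(hyponormal_nrm hT)[Ts [[hs ad] hn]] Im Il E b0.
have Sm := cspan_e Im; have Sl := cspan_e Il.
apply: le_trans (hn _ Sm); rewrite ad// in E.
have := cauchy_schwarz (e_L2 R l) (bergmanL (cspan_bergman (hs _ Sm))).
by rewrite E normc_real// nrm_e mul1r.
Qed.

End CoordinateSubspaces.

(** * Hyponormality, contractivity and the decomposition *)

Section HToeplitzShifts.
Variable R : realType.
Local Notation C := R[i].
Local Notation V := (C -> C).
Local Notation e := (@e_ R).
Variables (s d : nat) (P K Bs : V -> V).
Hypothesis (d0 : (0 < d)%N).
Hypothesis (hP : is_bergman_projection P) (hK : is_K_operator K).
Local Notation B := (HToeplitz P K (symbol (s + d) s)).
Hypothesis (hBs : is_adjoint bergman B Bs).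
Implicit Types (f g h : V) (I : set nat).
Local Notation sg := (sigma d).
Local Notation bt := (beta R s d).

Let BsB f := @Bs_bergman R s d P K Bs hBs f.
Let BB f := @B_bergman R s d P K hP hK f.
Let cB f m := @coef_B R s d P K Bs hP hK hBs f m.
Let cBs f m := @coef_Bs R s d P K Bs hP hK hBs f m.
Let cBs0 f k := @coef_Bs_off R s d P K Bs hP hK hBs f k.
Let Bse m := @Bs_e R s d P K Bs hP hK hBs m.

Definition sigma_stable I := forall m, I (sg m) <-> I m.

Lemma cspan_Bs I f : sigma_stable I -> cspan I f -> cspan I (Bs f).
Proof.
move=> hI [bf f0]; split; first exact: BsB.
move=> n In; have [[k E]|h] := pselect (exists k, n = sg k).
  rewrite E (cBs _ bf) f0 ?mulr0// => /hI; by rewrite -E.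
by apply: (cBs0 bf) => k E; apply: h; exists k.
Qed.

Lemma cspan_B I f : sigma_stable I -> cspan I f -> cspan I (B f).
Proof.
move=> hI [bf f0]; split; first exact: BB.
by move=> n In; rewrite (cB _ bf) f0 ?mulr0// => /hI.
Qed.

Lemma cspan_adjoint I : sigma_stable I -> is_adjoint (cspan I) Bs B.
Proof.
move=> hI; split=> [f|f g [bf _] [bg _]]; first exact: cspan_B.
exact: (ip_Bs_B hP hK hBs bf bg).
Qed.

Lemma sigma_stableC I : sigma_stable I -> sigma_stable (~` I).
Proof. by move=> h m; split=> /= H /h. Qed.

Lemma cspan_reducing I : sigma_stable I -> reducing bergman Bs (cspan I).
Proof.
move=> hI; split; first exact: cspan_closed.
  by move=> f; exact: cspan_Bs.
by rewrite cspan_orthocomplement => f; apply: cspan_Bs; exact: sigma_stableC.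
Qed.

Lemma cspan_normal I : sigma_stable I -> (forall k, I k -> exists m, k = sg m) ->
  (forall m, I m -> bt (sg m) = bt m) -> normal (cspan I) Bs.
Proof.
move=> hI hr hb; exists B; split; first exact: cspan_adjoint.
move=> f [bf f0]; have bBs := BsB bf; have bB := BB bf.
apply: coef_ext; [exact: BB|exact: BsB|] => k; rewrite (cB _ bBs) (cBs _ bf).
have [Ik|Ik] := pselect (I k); last first.
  rewrite f0// !mulr0; have [[m E]|h] := pselect (exists m, k = sg m).
    by rewrite E (cBs _ bB) (cB _ bf) -E f0// !mulr0.
  by rewrite cBs0// => m E; apply: h; exists m.
have [m E] := hr _ Ik; rewrite E (cBs _ bB) (cB _ bf) hb//; apply/hI; by rewrite -E.
Qed.

Lemma bergman_cspan : bergman = cspan [set: nat] :> set V.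
Proof. by apply/seteqP; split=> [f bf|f []//]; split=> // n; case. Qed.

Lemma sigma_stableT : sigma_stable [set: nat]. Proof. by []. Qed.

(** [sigma] is injective and sends the indices below n to indices below 2 (d + n), so the left side
    is a subsum of the right side. *)
Lemma sum_sigma_le (x : nat -> R) n : (forall k, 0 <= x k) ->
  \sum_(m < n) x (sg m) <= \sum_(k < (d + n).*2) x k.
Proof.
move=> x0; pose f (m : 'I_n) : 'I_(d + n).*2 := Ordinal (sigma_lt d (ltn_ord m)).
have f_inj : injective f by move=> i j /(congr1 val)/sigma_inj/val_inj.
rewrite [leRHS](bigID (mem (f @: predT)%SET)) /= big_imset; last by move=> i j _ _; exact: f_inj.

by rewrite lerDl; apply: sumr_ge0.
Qed.

Lemma nrm_B_le f : bergman f -> nrm (B f) <= nrm f.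
Proof.
move=> bf; rewrite -(@ler_pXn2r _ 2)// ?nnegrE ?nrm_ge0//.
apply: nrm_le_coef => [|n]; first exact: BB.
apply: le_trans (bessel (d + n).*2 bf).
apply: le_trans (sum_sigma_le (x := fun k => normc (coef f k) ^+ 2) n _); last by move=> k; exact: sqr_ge0.
apply: ler_sum => m _; rewrite (cB _ bf) ler_pXn2r ?nnegrE ?normc_ge0//.
rewrite normcM normc_real ?(ltW (beta_gt0 _ _ _ _))//.
by rewrite ler_piMl ?normc_ge0// beta_le1.
Qed.

(** The square of the norm of Bs f is <f, B (Bs f)>, to which Cauchy-Schwarz and the bound on B
    apply. *)
Lemma nrm_Bs_le f : bergman f -> nrm (Bs f) <= nrm f.
Proof.
move=> bf; have [z|nz] := eqVneq (nrm (Bs f)) 0; first by rewrite z nrm_ge0.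
have p0 : 0 < nrm (Bs f) by rewrite lt_neqAle eq_sym nz nrm_ge0.
rewrite -(ler_pM2r p0) -expr2.
have bb := BsB bf; have := cauchy_schwarz (bergmanL bf) (bergmanL (BB bb)).
rewrite -(ip_Bs_B hP hK hBs bf bb) ip_self normc_real ?sqr_ge0// => h.
by apply: (le_trans h); rewrite ler_wpM2l ?nrm_ge0// nrm_B_le.
Qed.

Lemma contractive_of_le (T : V -> V) : (forall f, bergman f -> nrm (T f) <= nrm f) -> contractive bergman T.
Proof.
move=> h; apply: ge_ereal_sup => _ [f [bf f1] <-]; rewrite lee_fin.
exact: le_trans (h f bf) f1.
Qed.

(** The index 2 d + 1 is not a value of [sigma], so B annihilates e_(2d+1), although B maps e_(2d+2)
    to a positive multiple of it. *)
Lemma B_not_hyponormal : ~ hyponormal bergman B.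
Proof.
rewrite bergman_cspan => hyp.
have hT f : cspan [set: nat] f -> cspan [set: nat] (B f) by exact: cspan_B.
have E : sg d.*2.+1 = d.*2.+2 by rewrite /sigma; case: ltnP; lia.
have off m : d.*2.+1 <> sg m by rewrite /sigma; case: ltnP; lia.
have := @hyponormal_entry R [set: nat] B d.*2.+1 d.*2.+2 (bt d.*2.+1) hT hyp I I.
rewrite -{1}E (B_e_sigma s d hP hK) (ipZl _ (e_L2 R _) (e_L2 R _)) -/(coef _ _) coef_e eqxx mulr1.
move=> /(_ erefl (ltW (beta_gt0 _ _ _ _))).
by rewrite (B_e_off s hP hK off) nrm0 leNgt beta_gt0.
Qed.

Lemma nrm_Bs_e m : nrm (Bs (e m)) = bt m.
Proof. by rewrite Bse (nrmZ _ (e_L2 R _)) nrm_e mulr1 normc_real// ltW// beta_gt0. Qed.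

Lemma Bs_entry l : ip (Bs (e l)) (e (sg l)) = (bt l)%:C.
Proof. by rewrite Bse (ipZl _ (e_L2 R _) (e_L2 R _)) -/(coef _ _) coef_e eqxx mulr1. Qed.

(** The set I is left open because the same two basis vectors serve for the finite block and for the
    whole space. *)
Lemma Bs_not_hyponormal I : sigma_stable I -> I d.*2.-1 -> (1 < d)%N -> ~ hyponormal (cspan I) Bs.
Proof.
move=> hI I1 d1 hyp.
have hT f : cspan I f -> cspan I (Bs f) by exact: cspan_Bs.
have E : sg d.*2.-1 = d.*2.-2 by rewrite /sigma; case: ltnP; lia.
have I2 : I d.*2.-2 by rewrite -E; apply/hI.
have := hyponormal_entry hT hyp I2 I1 _ (ltW (beta_gt0 _ s d d.*2.-1)).
rewrite -{1}E => /(_ (Bs_entry _)); rewrite nrm_Bs_e leNgt.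
by rewrite beta_lt_pred.
Qed.

Lemma Bs_not_cohyponormal I : sigma_stable I -> I d.*2.-1 -> (1 < d)%N -> ~ cohyponormal (cspan I) Bs.
Proof.
move=> hI I1 d1 [Ts [[hs ad] hyp]].
have E : sg d.*2.-1 = d.*2.-2 by rewrite /sigma; case: ltnP; lia.
have E0 : sg 0 = d.*2.-1 by rewrite /sigma d0 subn0.
have I2 : I d.*2.-2 by rewrite -E; apply/hI.
have I0 : I 0%N by apply/hI; rewrite E0.
have S1 := cspan_e R I1; have S2 := cspan_e R I2.
have bT f : cspan I f -> bergman (Ts f) by move=> /hs /cspan_bergman.
have entry : ip (Ts (e d.*2.-2)) (e d.*2.-1) = (bt d.*2.-1)%:C.
  rewrite (ip_conj (e_L2 R _) (bergmanL (bT _ S2))) -ad// -{1}E Bs_entry; exact: conjcR.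
have := hyponormal_entry hs hyp I1 I2 entry (ltW (beta_gt0 _ _ _ _)).
(* [Ts] is only known to be some adjoint on the subspace, so its value at e_(2d-1) is recovered from
   its coefficients: only the index 0, the preimage of 2 d - 1 under [sigma], contributes. *)
suff : nrm (Ts (e d.*2.-1)) <= bt 0.
  by move=> h1 h2; have := le_trans h2 h1; rewrite leNgt beta0_lt.
have -> : bt 0 = nrm ((bt 0)%:C *: e 0).
  by rewrite (nrmZ _ (e_L2 R _)) nrm_e mulr1 normc_real// ltW// beta_gt0.
have be0 : bergman ((bt 0)%:C *: e 0) by exact: bergmanZ (e_bergman R 0).
apply: (nrm_coef_mono (bT _ S1) be0) => k.
rewrite (coefZ _ k (e_bergman R 0)) coef_e.
have [Ik|Ik] := pselect (I k); last first.
  by have [_ ->//] := hs _ S1; rewrite normc0 normc_ge0.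
have Sk := cspan_e R Ik.
rewrite /coef (ip_conj (e_L2 R k) (bergmanL (bT _ S1))) -ad// Bse.
rewrite (ipZl _ (e_L2 R _) (e_L2 R _)) -/(coef _ _) coef_e -E0 (inj_eq (@sigma_inj d)).
rewrite normcJR eq_sym; case: eqP => [<-//|_].
by rewrite !mulr0.
Qed.

(** For d = 1 the weights do not decrease along [sigma]. Coefficient m of B f has modulus beta m
    |f_(sigma m)|, and coefficient sigma (sigma m) of Bs f has modulus beta (sigma m) |f_(sigma m)|,
    which is at least as large. *)
Lemma Bs_hyponormal : d = 1%N -> hyponormal bergman Bs.
Proof.
move=> d1; rewrite bergman_cspan; apply/hyponormal_nrm; first by move=> f; exact: cspan_Bs.
exists B; split; first exact: cspan_adjoint.
move=> f [bf _]; rewrite -(@ler_pXn2r _ 2)// ?nnegrE ?nrm_ge0//.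
apply: nrm_le_coef => [|n]; first exact: BB.
have nb m k : normc ((bt m)%:C * coef f k) = bt m * normc (coef f k).
  by rewrite normcM normc_real// ltW// beta_gt0.
(* Two applications of [sum_sigma_le], one for each [sigma], bound the sum over the indices sigma
   (sigma m) by a full partial sum for Bs f. *)
pose y k := normc (coef (Bs f) (sg k)) ^+ 2.
apply: (@le_trans _ _ (\sum_(m < n) y (sg m))).
  apply: ler_sum => m _; rewrite /y (cB _ bf) (cBs _ bf) ler_pXn2r ?nnegrE ?normc_ge0//.
  rewrite !nb ler_wpM2r ?normc_ge0//; exact: beta1_sigma_mono.
apply: le_trans (sum_sigma_le (x := y) n _) _; first by move=> k; exact: sqr_ge0.
apply: le_trans (bessel _ (BsB bf)).
by apply: (sum_sigma_le (x := fun k => normc (coef (Bs f) k) ^+ 2)) => k; exact: sqr_ge0.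
Qed.

Definition orbit_span (j : bool + nat) : set V := cspan [set n | block d n = j].

Lemma block_stable j : sigma_stable [set n | block d n = j].
Proof. by move=> m /=; rewrite block_sigma. Qed.

(** The cases delta > 1 and delta = 1 share one decomposition and differ only in the property
    claimed for the finite block, which is therefore a parameter. *)
Lemma Bs_decomposition (propM : set V -> (V -> V) -> Prop) :
  propM (orbit_span (inl true)) Bs -> shift_decomposition bergman Bs (2 * d) propM d s.
Proof.
move=> hM; exists (orbit_span (inl true)), (orbit_span (inl false)), nat.
exists (fun i => orbit_span (inr i)), (fun i l => bt (orbit d i l)) => summand.
have sE j : summand j = orbit_span j by case: j => [[]|].
split.
- exact: (cspan_direct_sum sE).
- by move=> j; rewrite sE; apply: cspan_reducing; exact: block_stable.
- split=> //; exists (fun i : 'I_(2 * d) => e i).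
  apply: (@cspan_basis R _ (fun i : 'I_(2 * d) => i : nat)); first exact: val_inj.
  move=> n; rewrite /= /block -mul2n; split.
    by case: (ltnP n (2 * d)) => [nd _|_]; [exists (Ordinal nd)|case: ifP].
  by move=> [i <-]; rewrite ltn_ord.
- split.
    exists (fun=> e d.*2); apply: (@cspan_basis R _ (fun=> d.*2)); first by move=> i j _; rewrite !ord1.
    move=> n; rewrite /= /block; split; last by move=> [_ <-]; rewrite ltnn eqxx.
    by case: ltnP => // _; case: eqP => // -> _; exists ord0.
  apply: cspan_normal; first exact: block_stable.
    move=> k /=; rewrite /block; case: ltnP => // _; case: eqP => // -> _.
    by exists d.*2; rewrite /sigma; case: ltnP; lia.
  move=> m /=; rewrite /block; case: ltnP => // _; case: eqP => // -> _.
  by congr bt; rewrite /sigma; case: ltnP; lia.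
move=> i.
have hk k : k = 1%N \/ ((1 <= k)%N /\ k_range R d s k) -> k_hyponormal k (fun l => bt (orbit d i l)).
  apply: (@shift_k_hyponormal R d s i.*2.+1) => // l; exact: beta_orbit_sqr.
split; [|by apply: hk; left|by move=> k k1 kr; apply: hk; right].
split.
- by move=> l; exact: beta_gt0.
- by exists 1 => l; exact: beta_le1.
exists (fun l => e (orbit d i l)); split.
  apply: (@cspan_basis R _ (orbit d i)); first exact: orbit_inj.
  by move=> n; exact: block_orbit.
by move=> l; rewrite Bse sigma_orbit.
Qed.

End HToeplitzShifts.

Theorem theorem1p10 (R : realType) (s t : nat) (hst : (s < t)%N)
    (P K Bs : (R[i] -> R[i]) -> (R[i] -> R[i]))
    (hP : is_bergman_projection P) (hK : is_K_operator K)
    (hBs : is_adjoint bergman (HToeplitz P K (symbol t s)) Bs) :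
  let B := HToeplitz P K (symbol t s) in
  let delta := (t - s)%N in
  ((1 < delta)%N ->
     [/\ shift_decomposition bergman Bs (2 * delta)
           (fun H M => ~ hyponormal H M /\ ~ cohyponormal H M) delta s,
         ~ hyponormal bergman Bs, ~ hyponormal bergman B,
         contractive bergman Bs & contractive bergman B])
  /\
  (delta = 1%N ->
     [/\ shift_decomposition bergman Bs 2 (fun H M => normal H M) delta s,
         hyponormal bergman Bs, ~ hyponormal bergman B,
         contractive bergman Bs & contractive bergman B]).
Proof.
move=> B delta; rewrite {}/B.
have d0 : (0 < delta)%N by rewrite subn_gt0.
have tE : t = (s + delta)%N by rewrite subnKC// ltnW.
move: hBs; rewrite tE => {}hBs; move: (delta) d0 hBs => d d0 hBs.
have stable := @block_stable d d0.
have nB := B_not_hyponormal d0 hP hK hBs.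
have cBs : contractive bergman Bs by apply: contractive_of_le => f; exact: (nrm_Bs_le hP hK hBs).
have cB : contractive bergman (HToeplitz P K (symbol (s + d) s)).
  by apply: contractive_of_le => f; exact: (nrm_B_le hP hK hBs).
split=> d1; split=> //.
- apply: (Bs_decomposition d0 hP hK hBs).
  have b1 : block d d.*2.-1 = inl true by rewrite /block ifT//; lia.
  split; first exact: (Bs_not_hyponormal d0 hP hK hBs (stable _) b1 d1).
  exact: (Bs_not_cohyponormal d0 hP hK hBs (stable _) b1 d1).
- rewrite bergman_cspan; exact: (Bs_not_hyponormal d0 hP hK hBs (@sigma_stableT d) I d1).
- have -> : 2%N = (2 * d)%N by rewrite d1.
  apply: (Bs_decomposition d0 hP hK hBs).
  have le1 m : block d m = inl true -> (m <= 1)%N.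
    by rewrite /block d1; case: ltnP => [|_] //; case: ifP.
  apply: (cspan_normal hP hK hBs (stable _)) => m /le1 m1; last exact: beta1_sigma.
  by exists (sigma d m); rewrite d1; case: m m1 => [|[|]].
- exact: (Bs_hyponormal d0 hP hK hBs).
Qed.
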